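(* Let $\rho_1,\rho_2,\beta\ge 0$. The operator $\mathcal{A}$ is the generator of a $C_0$-semigroup $(S(t))_{t\ge0}$ of contractions on the Hilbert space $\mathcal{H}$. In consequence, for each $U_0\in D(\mathcal{A})$ the Cauchy problem $$\frac{dU}{dt}(t)=\mathcal{A}U(t)\quad(t>0),\qquad U(0)=U_0,$$ has a unique classical solution $U\in C^1([0,\infty),\mathcal{H})$, which depends continuously on the initial data $U_0$.
   Context: Let $l_0<l_1<l_2<l_3$ be real numbers, $I_1=(l_0,l_1)$, $I_2=(l_1,l_2)$, $I_3=(l_2,l_3)$, and let $\rho_1,\rho_2,\beta\ge 0$ be constants. Function spaces are complex-valued; primes and $^{(k)}$ denote (weak) derivatives in $x$. Spaces: $H^2_{l_0}:=\{u\in H^2(I_1):u(l_0)=u'(l_0)=0\}$ with inner product $\langle u,\tilde u\rangle_{H^2_{l_0}}:=\langle u'',\tilde u''\rangle_{L^2(I_1)}$; $H^2_{l_3}:=\{w\in H^2(I_3):w(l_3)=w'(l_3)=0\}$ with $\langle w,\tilde w\rangle_{H^2_{l_3}}:=\langle w'',\tilde w''\rangle_{L^2(I_3)}$. $\mathbb{H}:=\{(u,v,w)\in H^2_{l_0}\times H^1(I_2)\times H^2_{l_3}: u(l_1)=v(l_1),\ v(l_2)=w(l_2)\}$ with inner product $\langle u,\tilde u\rangle_{H^2_{l_0}}+\langle v',\tilde v'\rangle_{L^2(I_2)}+\langle w,\tilde w\rangle_{H^2_{l_3}}$; $\mathbb{L}:=L^2(I_1)\times L^2(I_2)\times L^2(I_3)$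 with the sum of the $L^2$ inner products. $\mathcal{H}:=\mathbb{H}\times\mathbb{L}$ with the sum inner product; it is a Hilbert space. Elements are written $U=(u_1,v_1,w_1,u_2,v_2,w_2)$ with $(u_1,v_1,w_1)\in\mathbb{H}$, $(u_2,v_2,w_2)\in\mathbb{L}$. Formal operator: $AU:=\big(u_2,\ v_2,\ w_2,\ -u_1^{(4)}+\rho_1u_2'',\ v_1''-\beta v_2,\ -w_1^{(4)}+\rho_2w_2''\big)$. For $U,\tilde U\in\mathbb{H}\times\mathbb{H}$ put $$a(U,\tilde U):=\langle u_2,\tilde u_1\rangle_{H^2_{l_0}}+\langle v_2',\tilde v_1'\rangle_{L^2(I_2)}+\langle w_2,\tilde w_1\rangle_{H^2_{l_3}}-\langle u_1'',\tilde u_2''\rangle_{L^2(I_1)}-\rho_1\langle u_2',\tilde u_2'\rangle_{L^2(I_1)}-\beta\langle v_2,\tilde v_2\rangle_{L^2(I_2)}-\langle v_1',\tilde v_2'\rangle_{L^2(I_2)}-\langle w_1'',\tilde w_2''\rangle_{L^2(I_3)}-\rho_2\langle w_2',\tilde w_2'\rangle_{L^2(I_3)}.$$ $U$ satisfies the transmission conditions in the weak sense if $\langle AU,\tilde U\rangle_{\mathcal{H}}=a(U,\tilde U)$ for all $\tilde U\in\mathbb{H}\times\mathbb{H}$. The operator $\mathcal{A}:D(\mathcal{A})\subset\mathcal{H}\to\mathcal{H}$ is $\mathcal{A}U:=AU$ with domain $D(\mathcal{A}):=\{U\in\mathbb{H}\times\mathbb{H}: u_1^{(4)}\in L^2(I_1),\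 v_1''\in L^2(I_2),\ w_1^{(4)}\in L^2(I_3),\ U \text{ satisfies the transmission conditions in the weak sense}\}$. A classical solution of the Cauchy problem is a function $U\in C^1([0,\infty),\mathcal{H})$ with $U(t)\in D(\mathcal{A})$ for all $t\ge0$ satisfying the equation and the initial condition. Continuous dependence means: if $U_{0,n}\to U_0$ in $\mathcal{H}$ with $U_{0,n},U_0\in D(\mathcal{A})$, then the corresponding solutions converge in $\mathcal{H}$, uniformly for $t$ in compact intervals. *)

(* Defs.v *)
From HB Require Import structures.
From mathcomp Require Import all_boot all_order all_algebra ring_quotient.
From mathcomp Require Import all_classical all_reals all_analysis measurable_realfun.
From mathcomp Require Import complex.

Set Implicit Arguments.
Unset Strict Implicit.
Unset Printing Implicit Defensive.

Import Order.TTheory GRing.Theory Num.Theory.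
Import numFieldNormedType.Exports.

Local Open Scope quotient_scope.
Local Open Scope classical_set_scope.
Local Open Scope complex_scope.
Local Open Scope ring_scope.

Local Notation Re := complex.Re.
Local Notation Im := complex.Im.

Section L2.
Context {R : realType}.
Local Notation C := R[i].

(* Lebesgue measure restricted to the open interval (a, b); functions are total
   on R, and their values outside (a, b) are immaterial. *)
Definition leb (a b : R) : {measure set (measurableTypeR R) -> \bar R} :=
  mrestr (@lebesgue_measure R) (measurable_itv `]a, b[).

Definition L2pred (a b : R) : {pred R -> C^o} :=
  [pred f : R -> C^o | ((fun x => Re (f x)) \in Lfun (leb a b) 2%:E) &&
     ((fun x => Im (f x)) \in Lfun (leb a b) 2%:E)].

Let Lfun2_lin a b (c d : R) (f g h : R -> R) :
  f \in Lfun (leb a b) 2%:E -> g \in Lfun (leb a b) 2%:E ->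
  h \in Lfun (leb a b) 2%:E ->
  (fun x => c * f x + d * g x + h x) \in Lfun (leb a b) 2%:E.
Proof.
have p1 : (1 <= 2%:E :> \bar R)%E by rewrite lee_fin ler1n.
have S := Lfun_submod_closed (leb a b) p1.
move=> fL gL hL.
rewrite [X in X \in _](_ : _ = c *: f + (d *: g + h)); last first.
  by apply/funext => x; rewrite addrA.
by apply: S.2 => //; exact: S.2.
Qed.

Let L2predE a b (f : R -> C^o) : (f \in L2pred a b) =
  ((fun x => Re (f x)) \in Lfun (leb a b) 2%:E) &&
  ((fun x => Im (f x)) \in Lfun (leb a b) 2%:E).
Proof. by []. Qed.

Lemma L2pred_submod_closed a b : submod_closed (L2pred a b).
Proof.
have p1 : (1 <= 2%:E :> \bar R)%E by rewrite lee_fin ler1n.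
split.
  by rewrite L2predE; apply/andP; split; exact: (Lfun_submod_closed (leb a b) p1).1.
move=> c f g; rewrite !L2predE => /andP[f1 f2] /andP[g1 g2].
apply/andP; split.
- rewrite [X in X \in _](_ : _ =
     (fun x => Re c * Re (f x) + - Im c * Im (f x) + Re (g x))).
    exact: Lfun2_lin.
  apply/funext => x; rewrite !fctE.
  by case: (f x) (g x) c => ? ? [? ?] [? ?] /=; rewrite mulNr.
- rewrite [X in X \in _](_ : _ =
     (fun x => Im c * Re (f x) + Re c * Im (f x) + Im (g x))).
    exact: Lfun2_lin.
  apply/funext => x; rewrite !fctE.
  by case: (f x) (g x) c => ? ? [? ?] [? ?] /=; rewrite [X in _ = X + _]addrC.
Qed.

HB.instance Definition _ a b :=
  GRing.isSubmodClosed.Build C (R -> C^o) (L2pred a b) (L2pred_submod_closed a b).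

Record L2fun (a b : R) := MkL2fun {
  L2fun_val :> R -> C^o ; _ : L2fun_val \in L2pred a b }.

HB.instance Definition _ a b := [isSub for @L2fun_val a b].
HB.instance Definition _ a b := [Choice of L2fun a b by <:].
HB.instance Definition _ a b := [SubChoice_isSubLmodule of L2fun a b by <:].

Lemma L2fun_valP a b c (f g : L2fun a b) x : (c *: f + g) x = c * f x + g x.
Proof. by []. Qed.

Definition null (a b : R) : {pred L2fun a b} :=
  [pred f : L2fun a b | `[< {ae leb a b, forall x, f x = 0} >]].

Lemma null_submod_closed a b : submod_closed (@null a b).
Proof.
have F := ae_filter_ringOfSetsType (leb a b).
split=> [|c f g]; first by apply/asboolP; exact: nearW.
move=> /asboolP f0 /asboolP g0; apply/asboolP.
by apply: filterS2 f0 g0 => x fx0 gx0; rewrite L2fun_valP fx0 gx0 mulr0 addr0.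
Qed.

HB.instance Definition _ a b :=
  GRing.isSubmodClosed.Build C (L2fun a b) (@null a b) (null_submod_closed a b).

(* L^2((a, b); C): classes of square-integrable functions modulo equality
   almost everywhere on (a, b). *)
Definition L2 (a b : R) : Type := Quotient.quot (@null a b).


HB.instance Definition _ a b := EqQuotient.on (L2 a b).
HB.instance Definition _ a b := GRing.Zmodule.on (L2 a b).

Lemma L2_eqP a b (f g : L2fun a b) :
  \pi_(L2 a b) f = \pi_(L2 a b) g <-> {ae leb a b, forall x, f x = g x}.
Proof.
have F := ae_filter_ringOfSetsType (leb a b).
have fgE x : (f - g) x = f x - g x.
  by rewrite -[g in LHS]scale1r -scaleNr addrC L2fun_valP mulN1r addrC.
rewrite (rwP eqP) -[_ == _]Quotient.idealrBE; split.
  by move=> /asboolP; apply: filterS => x; rewrite fgE => /subr0_eq.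
by move=> fg; apply/asboolP; apply: filterS fg => x fg; rewrite fgE fg subrr.
Qed.

Definition L2_scale a b (c : C) (f : L2 a b) : L2 a b :=
  \pi_(L2 a b) (c *: repr f).

Let pi_scale a b c (f : L2fun a b) : L2_scale c (\pi_(L2 a b) f) = \pi_(L2 a b) (c *: f).
Proof.
have F := ae_filter_ringOfSetsType (leb a b).
have cE (h : L2fun a b) x : (c *: h) x = c * h x.
  by rewrite -[c *: h]addr0 L2fun_valP addr0.
have /L2_eqP fE := reprK (\pi_(L2 a b) f).
by apply/L2_eqP; apply: filterS fE => x fx; rewrite !cE fx.
Qed.

Let L2_scalerA a b c d (x : L2 a b) : L2_scale c (L2_scale d x) = L2_scale (c * d) x.
Proof. by elim/quotW: x => x; rewrite (pi_scale d) !pi_scale scalerA. Qed.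

Let L2_scale1r a b : left_id 1 (@L2_scale a b).
Proof. by elim/quotW => x; rewrite pi_scale scale1r. Qed.

Let L2_scalerDr a b : right_distributive (@L2_scale a b) +%R.
Proof.
move=> c x y; elim/quotW: x => x; elim/quotW: y => y.
by rewrite -raddfD !pi_scale scalerDr raddfD.
Qed.

Let L2_scalerDl a b x : {morph (@L2_scale a b)^~ x : c d / c + d}.
Proof. by move=> c d; elim/quotW: x => x; rewrite !pi_scale scalerDl raddfD. Qed.

HB.instance Definition _ a b := GRing.Zmodule_isLmodule.Build C (L2 a b)
  (@L2_scalerA a b) (@L2_scale1r a b) (@L2_scalerDr a b) (@L2_scalerDl a b).

Lemma L2_reprP a b c (f g : L2 a b) :
  {ae leb a b, forall x, repr (c *: f + g) x = c * repr f x + repr g x}.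
Proof.
have F := ae_filter_ringOfSetsType (leb a b).
have /L2_eqP : \pi_(L2 a b) (repr (c *: f + g)) =
    \pi_(L2 a b) (c *: repr f + repr g).
  by rewrite reprK -[f in LHS]reprK -[g in LHS]reprK raddfD/= -pi_scale.
by apply: filterS => x ->; rewrite L2fun_valP.
Qed.

End L2.

Section Sobolev.
Context {R : realType}.
Local Notation C := R[i].

Definition cint (a b : R) (f : R -> C) : C :=
  (\int[leb a b]_x Re (f x)) +i* (\int[leb a b]_x Im (f x)).

Definition dotL2 (a b : R) (f g : L2 a b) : C :=
  cint a b (fun x => repr f x * conjc (repr g x)).

Definition test_fun (a b : R) (phi : R -> R) : Prop :=
  (forall k x, derivable (derive1n k phi) x 1) /\
  exists c d : R, [/\ a < c, d < b & forall x, x \notin `[c, d] -> phi x = 0].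

(* g is the k-th weak derivative of f on (a, b). Real-valued test functions
   suffice by linearity. *)
Definition is_wderiv (a b : R) (k : nat) (f g : L2 a b) : Prop :=
  forall phi, test_fun a b phi ->
    cint a b (fun x => repr f x * (derive1n k phi x)%:C) =
    (-1) ^+ k * cint a b (fun x => repr g x * (phi x)%:C).

Definition has_wderiv (a b : R) (k : nat) (f : L2 a b) : Prop :=
  exists g, is_wderiv k f g.

(* The k-th weak derivative; 0 when there is none in L^2. *)
Definition wderiv (a b : R) (k : nat) (f : L2 a b) : L2 a b :=
  xget 0 [set g | is_wderiv k f g].

Definition sobolev (a b : R) (k : nat) (f : L2 a b) : Prop :=
  forall j, (j <= k)%N -> has_wderiv j f.

(* The representative of f that is continuous on [a, b] takes the value c
   at p. *)
Definition is_trace (a b p : R) (f : L2 a b) (c : C) : Prop :=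
  exists g : R -> C^o, [/\ {within `[a, b], continuous g},
    {ae leb a b, forall x, repr f x = g x} & g p = c].

(* u is in H^2(a, b) with u(p) = u'(p) = 0. *)
Definition H2_vanishing (a b p : R) (u : L2 a b) : Prop :=
  [/\ sobolev 2 u, is_trace p u 0 &
      exists2 u', is_wderiv 1 u u' & is_trace p u' 0].

Section Closure.
Variables a b : R.

Let intw (f : L2 a b) (psi : R -> R) : C :=
  cint a b (fun x => repr f x * (psi x)%:C).

Let good (psi : R -> R) := measurable_fun setT psi /\ [bounded psi x | x in setT].

Let leb_fin : leb a b setT \is a fin_num.
Proof.
have -> : leb a b setT = lebesgue_measure `]a, b[ by rewrite /leb /= /mrestr setTI.
rewrite ge0_fin_numE ?measure_ge0// lebesgue_measure_itv/=.
by case: ifP => _; rewrite ?ltry// -EFinB ltry.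
Qed.

Let L2fun_Re (f : L2fun a b) : (fun x => Re (f x)) \in Lfun (leb a b) 2%:E.
Proof. by have /andP[] := valP f. Qed.

Let L2fun_Im (f : L2fun a b) : (fun x => Im (f x)) \in Lfun (leb a b) 2%:E.
Proof. by have /andP[] := valP f. Qed.

Let Lfun2_int (h psi : R -> R) : h \in Lfun (leb a b) 2%:E -> good psi ->
  (leb a b).-integrable setT (EFin \o (fun x => h x * psi x)).
Proof.
move=> hL [mpsi bpsi].
have hi : (leb a b).-integrable setT (EFin \o h).
  by apply/Lfun1_integrable; exact: Lfun_subset12 hL.
have := integrableMl measurableT hi mpsi bpsi.
by apply: eq_integrable.
Qed.

Let intwE (f : R -> C) psi : cint a b (fun x => f x * (psi x)%:C) =
  (\int[leb a b]_x (Re (f x) * psi x)) +i* (\int[leb a b]_x (Im (f x) * psi x)).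
Proof.
congr (_ +i* _); apply: eq_Rintegral => x _; case: (f x) => r s /=.
  by rewrite mulr0 subr0.
by rewrite mulr0 add0r.
Qed.

Let Rint_lin (c1 c2 : R) (h1 h2 h3 : R -> R) :
  (leb a b).-integrable setT (EFin \o h1) ->
  (leb a b).-integrable setT (EFin \o h2) ->
  (leb a b).-integrable setT (EFin \o h3) ->
  \int[leb a b]_x (c1 * h1 x + c2 * h2 x + h3 x) =
  c1 * \int[leb a b]_x h1 x + c2 * \int[leb a b]_x h2 x + \int[leb a b]_x h3 x.
Proof.
move=> i1 i2 i3.
have z (c : R) (h : R -> R) : (leb a b).-integrable setT (EFin \o h) ->
    (leb a b).-integrable setT (EFin \o (fun x => c * h x)).
  by move=> hi; have := integrableZl measurableT c hi; exact: eq_integrable.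
rewrite RintegralD ?RintegralD ?RintegralZl//; try exact: z.
have := integrableD measurableT (z c1 _ i1) (z c2 _ i2).
exact: eq_integrable.
Qed.

Let Rint_ae (h k : R -> R) :
  measurable_fun setT h -> measurable_fun setT k ->
  {ae leb a b, forall x, h x = k x} ->
  \int[leb a b]_x h x = \int[leb a b]_x k x.
Proof.
move=> mh mk hk; congr fine; apply: ae_eq_integral => //.
- exact/measurable_EFinP.
- exact/measurable_EFinP.
have F := ae_filter_ringOfSetsType (leb a b).
by apply: filterS hk => x -> _.
Qed.

Let Lfun_meas (h : R -> R) : h \in Lfun (leb a b) 2%:E ->
  measurable_fun setT h.
Proof. by move=> /sub_Lfun_mfun; rewrite inE. Qed.

Lemma cint_repr_lin psi (c : C) (f g : L2 a b) : good psi ->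
  intw (c *: f + g) psi = c * intw f psi + intw g psi.
Proof.
move=> gp; have [mpsi _] := gp.
have F := ae_filter_ringOfSetsType (leb a b).
rewrite /intw !intwE.
have fgE := L2_reprP c f g.
have mRe (h : L2fun a b) := Lfun_meas (L2fun_Re h).
have mIm (h : L2fun a b) := Lfun_meas (L2fun_Im h).
case: c fgE => c1 c2 fgE.
have -> : \int[leb a b]_x (Re (repr ((c1 +i* c2) *: f + g) x) * psi x) =
    \int[leb a b]_x (c1 * (Re (repr f x) * psi x) +
      (- c2) * (Im (repr f x) * psi x) + Re (repr g x) * psi x).
  apply: Rint_ae; first by apply: measurable_funM => //; exact: mRe.
    by repeat (apply: measurable_funD || apply: measurable_funM) => //;
      (exact: mRe || exact: mIm).
  apply: filterS fgE => x ->.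
  case: (repr f x) (repr g x) => ? ? [? ?] /=.
  by rewrite !mulrDl !mulrA !mulNr.
have -> : \int[leb a b]_x (Im (repr ((c1 +i* c2) *: f + g) x) * psi x) =
    \int[leb a b]_x (c2 * (Re (repr f x) * psi x) +
      c1 * (Im (repr f x) * psi x) + Im (repr g x) * psi x).
  apply: Rint_ae; first by apply: measurable_funM => //; exact: mIm.
    by repeat (apply: measurable_funD || apply: measurable_funM) => //;
      (exact: mRe || exact: mIm).
  apply: filterS fgE => x ->.
  case: (repr f x) (repr g x) => ? ? [? ?] /=.
  by rewrite !mulrDl !mulrA [in LHS](addrC (c1 * _ * _)).
rewrite !Rint_lin; try by apply: Lfun2_int => //;
  (exact: L2fun_Re || exact: L2fun_Im).
by congr (_ +i* _); rewrite /= ?mulNr// [in LHS](addrC (c2 * _)).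
Qed.

Lemma test_fun_zero k phi : test_fun a b phi ->
  exists c d : R, forall x, x \notin `[c, d] -> derive1n k phi x = 0.
Proof.
move=> [_ [c [d [_ _ phi0]]]]; exists c, d; elim: k => [//|k ih] x xcd.
rewrite /derive1n iterS -/(derive1n k phi) derive1E.
rewrite (@near_eq_derive _ _ _ _ (cst 0)) ?derive_cst//.
have : open (~` [set` `[c, d]]) by apply: closed_openC; exact: interval_closed.
rewrite openE => /(_ x); rewrite /interior /= => h.
have {}h : nbhs x (~` [set` `[c, d]]) by apply: h; exact/negP.
by apply: filterS h => y /negP; exact: ih.
Qed.

Lemma test_fun_good k phi : test_fun a b phi -> good (derive1n k phi).
Proof.
move=> tphi; have [dphi _] := tphi.
have cphi : continuous (derive1n k phi).
  by move=> x; apply: differentiable_continuous; apply/derivable1_diffP.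
split; first exact: continuous_measurable_fun.
have [c [d zero]] := test_fun_zero k tphi.
have [M bM] : exists M, forall x, `|derive1n k phi x| <= M.
  have [cd|dc] := leP c d; last first.
    exists 0 => x; rewrite zero ?normr0// in_itv/=; apply/negP => /andP[cx xd].
    by have := le_lt_trans (le_trans cx xd) dc; rewrite ltxx.
  have nphi : {within `[c, d], continuous (fun x => `|derive1n k phi x|)}.
    apply: continuous_subspaceT => x.
    by apply: (@continuous_comp _ _ _ (derive1n k phi) Num.norm);
      [exact: cphi|exact: norm_continuous].
  have [m _ mM] := EVT_max cd nphi.
  exists `|derive1n k phi m| => x.
  have [xcd|xcd] := boolP (x \in `[c, d]); first exact: mM.
  by rewrite zero// normr0.
exists M; split; first exact: num_real.
by move=> y My x _ /=; rewrite (le_trans (bM x))// ltW.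
Qed.

Lemma is_wderiv_lin k c (f g f' g' : L2 a b) :
  is_wderiv k f f' -> is_wderiv k g g' ->
  is_wderiv k (c *: f + g) (c *: f' + g').
Proof.
move=> ff' gg' phi tphi; rewrite -!/(intw _ _).
rewrite !cint_repr_lin; [|exact: (test_fun_good 0 tphi)|exact: (test_fun_good k)].
by rewrite /intw ff'// gg'// mulrDr !mulrA [c * _]mulrC.
Qed.

Lemma is_wderiv0 k : is_wderiv k (0 : L2 a b) 0.
Proof.
move=> phi tphi; rewrite -!/(intw _ _).
have h psi : good psi -> intw 0 psi = 0.
  move=> gp; have := cint_repr_lin (-1) 0 0 gp.
  by rewrite scaler0 addr0 mulN1r addNr.
by rewrite !h ?mulr0//; [exact: (test_fun_good 0 tphi)|exact: (test_fun_good k)].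
Qed.

Lemma has_wderiv_lin k c (f g : L2 a b) :
  has_wderiv k f -> has_wderiv k g -> has_wderiv k (c *: f + g).
Proof.
by move=> [f' ff'] [g' gg']; exists (c *: f' + g'); exact: is_wderiv_lin.
Qed.

Lemma is_trace_lin p c (f g : L2 a b) x y :
  is_trace p f x -> is_trace p g y -> is_trace p (c *: f + g) (c * x + y).
Proof.
have F := ae_filter_ringOfSetsType (leb a b).
move=> [f' [cf ff' <-]] [g' [cg gg' <-]].
exists (fun z => c * f' z + g' z); split=> //.
  by move=> z; apply: cvgD; [apply: cvgMr; exact: cf|exact: cg].
have := L2_reprP c f g; move: ff' gg'; apply: filterS3 => z fz gz ->.
by rewrite fz gz.
Qed.

Lemma is_trace0 p : is_trace p (0 : L2 a b) 0.
Proof.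
have F := ae_filter_ringOfSetsType (leb a b).
exists (cst 0); split=> //; first by move=> z; exact: cvg_cst.
have : \pi_(L2 a b) (repr (0 : L2 a b)) = \pi_(L2 a b) 0.
  by rewrite reprK raddf0.
by move=> /L2_eqP; apply: filterS.
Qed.

Lemma H2_vanishing_lin p c (f g : L2 a b) :
  H2_vanishing p f -> H2_vanishing p g -> H2_vanishing p (c *: f + g).
Proof.
move=> [fS f0 [f' ff' f'0]] [gS g0 [g' gg' g'0]].
have t0 (h k : L2 a b) : is_trace p h 0 -> is_trace p k 0 -> is_trace p (c *: h + k) 0.
  by move=> h0 k0; have := is_trace_lin c h0 k0; rewrite mulr0 addr0.
split; first by move=> j j2; apply: has_wderiv_lin; [exact: fS|exact: gS].
  exact: t0.
by exists (c *: f' + g'); [exact: is_wderiv_lin|exact: t0].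
Qed.

Lemma H2_vanishing0 p : H2_vanishing p (0 : L2 a b).
Proof.
split; [|exact: is_trace0|by exists 0; [exact: is_wderiv0|exact: is_trace0]].
by move=> j _; exists 0; exact: is_wderiv0.
Qed.

End Closure.
End Sobolev.

Section Spaces.
Context {R : realType} (l0 l1 l2 l3 : R).
Local Notation C := R[i].

Definition bbL : Type := (L2 l0 l1 * L2 l1 l2 * L2 l2 l3)%type.
HB.instance Definition _ := GRing.Lmodule.on bbL.

Definition in_bbH (x : bbL) : Prop :=
  let: (u, v, w) := x in
  [/\ H2_vanishing l0 u, sobolev 1 v, H2_vanishing l3 w,
      exists2 c, is_trace l1 u c & is_trace l1 v c &
      exists2 c, is_trace l2 v c & is_trace l2 w c].

Definition bbH_pred : {pred bbL} := [pred x | `[< in_bbH x >]].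

Lemma bbH_submod_closed : submod_closed bbH_pred.
Proof.
split.
  apply/asboolP; split.
  - exact: H2_vanishing0.
  - by move=> j _; exists 0; exact: is_wderiv0.
  - exact: H2_vanishing0.
  - by exists 0; exact: is_trace0.
  - by exists 0; exact: is_trace0.
move=> c [[u v] w] [[u' v'] w'] /asboolP[Hu Hv Hw [s us vs] [t vt wt]].
move=> /asboolP[Hu' Hv' Hw' [s' us' vs'] [t' vt' wt']].
apply/asboolP; split.
- exact: H2_vanishing_lin.
- by move=> j j1; apply: has_wderiv_lin; [exact: Hv|exact: Hv'].
- exact: H2_vanishing_lin.
- by exists (c * s + s'); exact: is_trace_lin.
- by exists (c * t + t'); exact: is_trace_lin.
Qed.

HB.instance Definition _ :=
  GRing.isSubmodClosed.Build C bbL bbH_pred bbH_submod_closed.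

Record bbH := MkbbH { bbH_val : bbL ; _ : bbH_val \in bbH_pred }.

HB.instance Definition _ := [isSub for bbH_val].
HB.instance Definition _ := [Choice of bbH by <:].
HB.instance Definition _ := [SubChoice_isSubLmodule of bbH by <:].

Definition dot_bbL (x y : bbL) : C :=
  let: (u, v, w) := x in let: (u', v', w') := y in
  dotL2 u u' + dotL2 v v' + dotL2 w w'.

Definition dot_bbH (x y : bbH) : C :=
  let: (u, v, w) := bbH_val x in let: (u', v', w') := bbH_val y in
  dotL2 (wderiv 2 u) (wderiv 2 u') + dotL2 (wderiv 1 v) (wderiv 1 v')
  + dotL2 (wderiv 2 w) (wderiv 2 w').

Definition calH : Type := (bbH * bbL)%type.
HB.instance Definition _ := GRing.Lmodule.on calH.

Definition dot_calH (U V : calH) : C := dot_bbH U.1 V.1 + dot_bbL U.2 V.2.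

Definition norm_calH (U : calH) : R := Num.sqrt (Re (dot_calH U U)).

Section Operator.
Variables rho1 rho2 beta : R.


(* Used only for U.2 and V.2 in bbH. *)
Definition formA (U V : calH) : C :=
  let: (u1, v1, w1) := bbH_val U.1 in let: (u2, v2, w2) := U.2 in
  let: (s1, t1, r1) := bbH_val V.1 in let: (s2, t2, r2) := V.2 in
  dotL2 (wderiv 2 u2) (wderiv 2 s1)
  + dotL2 (wderiv 1 v2) (wderiv 1 t1)
  + dotL2 (wderiv 2 w2) (wderiv 2 r1)
  - dotL2 (wderiv 2 u1) (wderiv 2 s2)
  - rho1%:C * dotL2 (wderiv 1 u2) (wderiv 1 s2)
  - beta%:C * dotL2 v2 t2
  - dotL2 (wderiv 1 v1) (wderiv 1 t2)
  - dotL2 (wderiv 2 w1) (wderiv 2 r2)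
  - rho2%:C * dotL2 (wderiv 1 w2) (wderiv 1 r2).

(* When U.2 is in bbH, as for U in domA, the first component is U.2 itself;
   insubd only makes the expression total. *)
Definition opA (U : calH) : calH :=
  let: (u1, v1, w1) := bbH_val U.1 in let: (u2, v2, w2) := U.2 in
  (insubd 0 U.2,
   (- wderiv 4 u1 + rho1%:C *: wderiv 2 u2,
    wderiv 2 v1 - beta%:C *: v2,
    - wderiv 4 w1 + rho2%:C *: wderiv 2 w2)).

Definition transmission (U : calH) : Prop :=
  forall V : calH, in_bbH V.2 -> dot_calH (opA U) V = formA U V.

Definition domA : set calH :=
  [set U | let: (u1, v1, w1) := bbH_val U.1 in
    [/\ in_bbH U.2, has_wderiv 4 u1, has_wderiv 2 v1, has_wderiv 4 w1 &
        transmission U]].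

End Operator.
End Spaces.

Section Semigroups.
Context {R : realType} {H : lmodType R[i]} (nrm : H -> R).

(* Convergence in norm. *)
Definition ncvg {T : Type} (F : set_system T) (f : T -> H) (l : H) : Prop :=
  nrm (f x - l) @[x --> F] --> (0 : R).

Record contraction_semigroup (S : R -> H -> H) : Prop := {
  semigroup_linear : forall t, 0 <= t -> linear (S t) ;
  semigroup0 : forall x, S 0 x = x ;
  semigroupD : forall s t, 0 <= s -> 0 <= t ->
    forall x, S (s + t) x = S s (S t x) ;
  semigroup_strong_cvg : forall x, ncvg 0^'+ (fun t => S t x) x ;
  semigroup_contraction : forall t, 0 <= t -> forall x, nrm (S t x) <= nrm x }.

(* D is the set of x at which t |-> S t x has a right derivative at 0, and
   A x is that derivative; values of A outside D are irrelevant. *)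
Definition is_generator (D : set H) (A : H -> H) (S : R -> H -> H) : Prop :=
  forall x y, (D x /\ A x = y) <->
    ncvg 0^'+ (fun t => (t^-1)%:C *: (S t x - x)) y.

(* U is continuously differentiable on [0, +oo[ with derivative U' (one-sided
   at 0); values at negative times are irrelevant. *)
Definition is_C1 (U U' : R -> H) : Prop :=
  forall t : R, 0 <= t ->
    ncvg (within [set s : R | 0 <= s] t^')
      (fun s => ((s - t)^-1)%:C *: (U s - U t)) (U' t) /\
    ncvg (within [set s : R | 0 <= s] (nbhs t)) U' (U' t).

Definition classical_solution (D : set H) (A : H -> H) (U0 : H) (U : R -> H) :=
  [/\ forall t : R, 0 <= t -> D (U t),
      exists2 U', is_C1 U U' & forall t : R, 0 < t -> U' t = A (U t) &
      U 0 = U0].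

End Semigroups.

(* Main.v *)
From mathcomp Require Import all_boot all_order all_algebra ring_quotient.
From mathcomp Require Import all_classical all_reals all_analysis measurable_realfun.
From mathcomp Require Import complex lra ring.
Require Import Defs.

Set Implicit Arguments.
Unset Strict Implicit.

Import Order.TTheory GRing.Theory Num.Theory.
Import numFieldNormedType.Exports.

Local Open Scope quotient_scope.
Local Open Scope classical_set_scope.
Local Open Scope complex_scope.
Local Open Scope ring_scope.

(** Eliminating the position from U - h A U = F leaves, for the velocity, a
    variational problem whose form is an inner product equivalent to that of
    the energy space; the Riesz theorem solves it for every h > 0.  Testing the
    transmission identity with U itself, the elastic terms cancel and
    Re <A U, U> is minus the damping, hence nonpositive.  So A is m-dissipative
    in a Hilbert space, which also makes its domain dense, and the theorem is
    the Lumer-Phillips theorem with its consequences for the Cauchy problem.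

    The abstract half ends with [m_dissipative_well_posed].  The resolvents are
    contractions, the implicit Euler schemes with dyadic steps form a Cauchy
    sequence on the domain of A^2, and their limit is the semigroup.  Uniqueness
    and continuous dependence hold because the norm of a solution does not
    increase, which follows from dissipativity and left difference quotients.
    [hilbert_m_dissipative] reduces the hypotheses to nonpositivity of <A x, x>
    and surjectivity; both it and the solution of the variational problem rest
    on the minimisation in [riesz_subspace].

    The concrete half replaces A by its graph in variational form, [graph].
    There, closure under linear combinations, dissipativity and surjectivity are
    short computations with inner products.  [graphP] identifies this graph with
    that of A: elements of the energy space supported in one piece, given by test
    functions, turn the variational identity into the differential equations.

    The energy space is complete ([hilbert_bbH]) because an element is
    recovered from its highest derivatives by integrating from the clamped ends
    inwards, and the only constraint on these derivatives is that a bounded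
    functional, the mismatch of the pieces at l2, vanishes.  This uses that a
    function with an L2 weak derivative is, up to a constant, an indefinite
    integral ([weak_derivative_prim]), which in turn comes from the fundamental
    lemma of the calculus of variations and the du Bois-Reymond lemma. *)

(** * Norms and convergence *)

Lemma subrACA (V : zmodType) (a b c d : V) : (a - b) - (c - d) = (a - c) - (b - d).
Proof. by rewrite !opprD !opprK addrACA. Qed.

Section BanachNorm.
Context {R : realType} {H : lmodType R[i]} (nrm : H -> R).

Definition ncauchy (x : nat -> H) := forall e : R, 0 < e ->
  exists N, forall m n, (N <= m)%N -> (N <= n)%N -> nrm (x m - x n) < e.

(** A norm is a bare function, because the spaces at hand have a module
    structure and a formula for the norm but carry no topology. *)
Record banach_norm : Prop := {
  nrmD : forall x y, nrm (x + y) <= nrm x + nrm y;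
  nrmZ : forall (c : R[i]) x, nrm (c *: x) = complex.Re `|c| * nrm x;
  nrm_eq0 : forall x, nrm x = 0 -> x = 0;
  nrm_complete : forall x, ncauchy x -> exists l, ncvg nrm \oo x l }.

Hypothesis bn : banach_norm.

Lemma nrmZr (a : R) x : nrm (a%:C *: x) = `|a| * nrm x.
Proof. by rewrite (nrmZ bn) normc_def /= expr0n/= addr0 sqrtr_sqr. Qed.

Lemma nrm0 : nrm 0 = 0.
Proof. by have := nrmZr 0 0; rewrite scaler0 normr0 mul0r. Qed.

Lemma nrmN x : nrm (- x) = nrm x.
Proof.
by have := nrmZr (-1) x; rewrite rmorphN1 scaleN1r normrN1 mul1r.
Qed.

Lemma nrmB x y : nrm (x - y) = nrm (y - x).
Proof. by rewrite -nrmN opprB. Qed.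

Lemma nrm_ge0 x : 0 <= nrm x.
Proof. by have := nrmD bn x (- x); rewrite subrr nrm0 nrmN; lra. Qed.

Lemma nrm_tri z x y : nrm (x - y) <= nrm (x - z) + nrm (z - y).
Proof. by have := nrmD bn (x - z) (z - y); rewrite addrA subrK. Qed.

Lemma nrm_le_sub x y : nrm x - nrm y <= nrm (x - y).
Proof. by have := nrmD bn (x - y) y; rewrite subrK; lra. Qed.

Lemma ncvgP {T} (F : set_system T) {FF : Filter F} (f : T -> H) l :
  ncvg nrm F f l <-> forall e, 0 < e -> \forall x \near F, nrm (f x - l) < e.
Proof.
split=> [/cvgrPdist_lt fl e e0|fl].
  have := fl e e0; apply: filterS => x; rewrite sub0r normrN ger0_norm//.
  exact: nrm_ge0.
apply/cvgrPdist_lt => e e0; have := fl e e0; apply: filterS => x.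
by rewrite sub0r normrN ger0_norm// nrm_ge0.
Qed.

Lemma ncvg_le {T} (F : set_system T) {FF : ProperFilter F} (f : T -> H) l y c :
  ncvg nrm F f l -> (\forall x \near F, nrm (f x - y) <= c) -> nrm (l - y) <= c.
Proof.
move=> /ncvgP fl fy; apply/ler_addgt0Pr => e e0.
have [x [xl xy]] : exists x, nrm (f x - l) < e /\ nrm (f x - y) <= c.
  have /filter_ex : \forall x \near F, nrm (f x - l) < e /\ nrm (f x - y) <= c.
    by apply: filterS2 (fl e e0) fy.
  by [].
by have := nrm_tri (f x) l y; rewrite (nrmB l (f x)); lra.
Qed.

Lemma nrm_le0 x : nrm x <= 0 -> x = 0.
Proof. by move=> x0; apply: (nrm_eq0 bn); have := nrm_ge0 x; lra. Qed.

Lemma nrm_inj x y : (forall e, 0 < e -> nrm (x - y) <= e) -> x = y.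
Proof.
move=> xy; apply/eqP; rewrite -subr_eq0; apply/eqP/nrm_le0.
by apply/ler_addgt0Pr => e e0; rewrite add0r xy.
Qed.

Lemma ncvg_uniq {T} (F : set_system T) {FF : ProperFilter F} (f : T -> H) l l' :
  ncvg nrm F f l -> ncvg nrm F f l' -> l = l'.
Proof.
move=> fl /ncvgP fl'; apply: nrm_inj => e e0.
by apply: (ncvg_le fl); apply: filterS (fl' e e0) => x /ltW.
Qed.

Lemma ncvg_lin {T} (F : set_system T) {FF : Filter F} (f g : T -> H) l l' c :
  ncvg nrm F f l -> ncvg nrm F g l' ->
  ncvg nrm F (fun x => c *: f x + g x) (c *: l + l').
Proof.
rewrite /ncvg => fl gl.
have h : complex.Re `|c| * nrm (f x - l) + nrm (g x - l') @[x --> F] --> (0 : R).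
  rewrite -[X in _ --> X]addr0 -[X in _ --> X + _](mulr0 (complex.Re `|c|)).
  by apply: cvgD => //; apply: cvgMr.
apply: (squeeze_cvgr _ (cvg_cst 0) h); apply: nearW => x.
rewrite nrm_ge0/= -(nrmZ bn) -[X in nrm X <= _](_ : c *: (f x - l) + (g x - l') = _).
  exact: nrmD.
by rewrite scalerBr opprD addrACA.
Qed.

Lemma ncvgB {T} (F : set_system T) {FF : Filter F} (f g : T -> H) l l' :
  ncvg nrm F f l -> ncvg nrm F g l' -> ncvg nrm F (fun x => f x - g x) (l - l').
Proof.
move=> fl gl; rewrite addrC -scaleN1r.
rewrite [X in ncvg _ _ X _](_ : _ = fun x => (-1) *: g x + f x).
  exact: ncvg_lin.
by apply/funext => x; rewrite scaleN1r addrC.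
Qed.

Lemma ncvg_cst {T} (F : set_system T) {FF : Filter F} l : ncvg nrm F (fun=> l) l.
Proof. by rewrite /ncvg subrr nrm0; exact: cvg_cst. Qed.

End BanachNorm.

(** * Generation by the implicit Euler scheme *)

Section Resolvent.
Context {R : realType} {H : lmodType R[i]} (nrm : H -> R).
Hypothesis bn : banach_norm nrm.
Variables (D : set H) (A : H -> H).

(** Dissipativity is stated through the norm, so that resolvents are
    contractions at once, and surjectivity is asked for every step h > 0. *)
Record m_dissipative : Prop := {
  domain0 : D 0;
  domain_lin : forall c x y, D x -> D y -> D (c *: x + y);
  operator_lin : forall c x y, D x -> D y -> A (c *: x + y) = c *: A x + A y;
  dissipative : forall h x, 0 <= h -> D x -> nrm x <= nrm (x - h%:C *: A x);
  resolvent_onto : forall h f, 0 < h -> exists2 x, D x & x - h%:C *: A x = f;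
  domain_dense : forall x e, 0 < e -> exists2 z, D z & nrm (z - x) < e }.

Hypothesis md : m_dissipative.

Lemma domainZ c x : D x -> D (c *: x).
Proof. by move=> Dx; have := domain_lin md c Dx (domain0 md); rewrite addr0. Qed.

Lemma domainB x y : D x -> D y -> D (x - y).
Proof.
by move=> Dx Dy; have := domain_lin md (-1) Dy Dx; rewrite scaleN1r addrC.
Qed.

Lemma operatorZ c x : D x -> A (c *: x) = c *: A x.
Proof.
move=> Dx; have A0 : A 0 = 0.
  have := operator_lin md 1 (domain0 md) (domain0 md).
  by rewrite !scale1r addr0 => /esym/eqP; rewrite -subr_eq0 addrK => /eqP.
by have := operator_lin md c Dx (domain0 md); rewrite addr0 A0 addr0.
Qed.

Lemma operatorB x y : D x -> D y -> A (x - y) = A x - A y.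
Proof.
move=> Dx Dy; have := operator_lin md (-1) Dy Dx.
by rewrite !scaleN1r addrC => ->; rewrite addrC.
Qed.

Definition res (h : R) (f : H) : H := xget 0 [set x | D x /\ x - h%:C *: A x = f].

Lemma resP h f : 0 < h -> D (res h f) /\ res h f - h%:C *: A (res h f) = f.
Proof.
move=> h0; have [x Dx xf] := resolvent_onto md f h0.
rewrite /res; case: xgetP => [y _ //|/(_ x)]; by case.
Qed.

Lemma res_uniq h f x : 0 < h -> D x -> x - h%:C *: A x = f -> x = res h f.
Proof.
move=> h0 Dx xf; have [Dr rf] := resP f h0.
apply/eqP; rewrite -subr_eq0; apply/eqP/(nrm_le0 bn).
have := dissipative md (ltW h0) (domainB Dx Dr).
by rewrite operatorB// scalerBr subrACA xf rf subrr nrm0.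
Qed.

Lemma res_lin h c f g : 0 < h -> res h (c *: f + g) = c *: res h f + res h g.
Proof.
move=> h0; have [Df ff] := resP f h0; have [Dg gg] := resP g h0.
apply/esym/res_uniq => //; first exact: domain_lin.
rewrite (operator_lin md)// scalerDr opprD addrACA scalerA mulrC -scalerA.
by rewrite -scalerBr ff gg.
Qed.

Lemma resB h f g : 0 < h -> res h (f - g) = res h f - res h g.
Proof.
by move=> h0; rewrite addrC -scaleN1r res_lin// scaleN1r addrC.
Qed.

Lemma res_contr h f : 0 < h -> nrm (res h f) <= nrm f.
Proof.
move=> h0; have [Df ff] := resP f h0.
by have := dissipative md (ltW h0) Df; rewrite ff.
Qed.

(** The resolvent equation writes A (res h x) as a difference quotient of
    elements of D, so that A can be applied a second time. *)
Lemma operator_res h x : 0 < h -> D x ->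
  [/\ D (res h x), D (A (res h x)) & A (res h x) = res h (A x)].
Proof.
move=> h0 Dx; have [Dr rx] := resP x h0.
have E : A (res h x) = (h^-1)%:C *: (res h x - x).
  rewrite -[in X in _ - X]rx opprB addrC subrK scalerA.
  by rewrite -rmorphM/= mulVf ?gt_eqF// scale1r.
have DA : D (A (res h x)) by rewrite E; exact/domainZ/domainB.
split=> //; apply: res_uniq => //.
by rewrite -[in RHS]rx operatorB ?operatorZ//; exact: domainZ.
Qed.

Lemma res_sub h x : 0 < h -> D x -> nrm (res h x - x) <= h * nrm (A x).
Proof.
move=> h0 Dx; have [Dr rx] := resP x h0; have [_ _ E] := operator_res h0 Dx.
rewrite -[in X in _ - X]rx opprB addrC subrK nrmZr// E gtr0_norm//.
by rewrite ler_pM2l// res_contr.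
Qed.

Lemma iter_res_lin h n c f g : 0 < h ->
  iter n (res h) (c *: f + g) = c *: iter n (res h) f + iter n (res h) g.
Proof. by move=> h0; elim: n => // n IH; rewrite !iterS IH res_lin. Qed.

Lemma iter_resB h n f g : 0 < h ->
  iter n (res h) (f - g) = iter n (res h) f - iter n (res h) g.
Proof. by move=> h0; elim: n => // n IH; rewrite !iterS IH resB. Qed.

Lemma iter_res_contr h n f : 0 < h -> nrm (iter n (res h) f) <= nrm f.
Proof.
by move=> h0; elim: n => // n; apply: le_trans; rewrite iterS res_contr.
Qed.

Lemma operator_iter_res h n x : 0 < h -> D x ->
  D (iter n (res h) x) /\ A (iter n (res h) x) = iter n (res h) (A x).
Proof.
move=> h0 Dx; elim: n => //= n [Dn <-].
by have [? _ ?] := operator_res h0 Dn.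
Qed.

Lemma iter_res_sub h n x : 0 < h -> D x ->
  nrm (iter n (res h) x - x) <= n%:R * h * nrm (A x).
Proof.
move=> h0 Dx; elim: n => [|n IH]; first by rewrite subrr nrm0// !mul0r.
have [Dn An] := operator_iter_res n h0 Dx.
apply: le_trans (nrm_tri bn (iter n (res h) x) _ _) _.
rewrite iterS; have := res_sub h0 Dn; rewrite An => e.
have := iter_res_contr n (A x) h0; rewrite -(ler_pM2l h0) => e'.
by rewrite -natr1 !mulrDl mul1r; lra.
Qed.

Lemma iter_res_shift h m n x : 0 < h -> D x -> (m <= n <= m.+1)%N ->
  nrm (iter n (res h) x - iter m (res h) x) <= h * nrm (A x).
Proof.
move=> h0 Dx /andP[mn nm].
have /orP[/eqP->|/eqP->] : (n == m) || (n == m.+1) by rewrite eqn_leq mn andbT [n == _]eqn_leq nm; case: ltngtP mn.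
  by rewrite subrr nrm0// mulr_ge0 ?(ltW h0) ?nrm_ge0.
have [Dm Am] := operator_iter_res m h0 Dx.
apply: le_trans (res_sub h0 Dm) _.
by rewrite Am ler_pM2l// iter_res_contr.
Qed.

(** Local error of the scheme: two half steps and one full step agree up to
    the term h^2 A^2 of the expansion, and the resolvents do not enlarge it. *)
Lemma res_half h x : 0 < h -> D x -> D (A x) ->
  nrm (res h (res h x) - res (h *+ 2) x) <= h ^+ 2 * nrm (A (A x)).
Proof.
move=> h0 Dx DAx; have h20 : 0 < h *+ 2 by rewrite pmulrn_lgt0.
have [Dy yx] := resP x h20; have [_ DAy Ay] := operator_res h20 Dx.
have [_ _ AAy] := operator_res h20 DAx.
set y := res (h *+ 2) x in Dy yx DAy Ay *.
have Dz : D (y - h%:C *: A y) by apply: domainB => //; exact: domainZ.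
(* y is one full step; y - h A y is one half step from a perturbed point *)
have zE : y - h%:C *: A y = res h (x + (h ^+ 2)%:C *: A (A y)).
  apply: res_uniq => //; rewrite operatorB ?operatorZ//; last exact: domainZ.
  rewrite -yx scalerBr scalerA -rmorphM -expr2 rmorphMn/= mulr2n scalerDl.
  by rewrite !opprD !opprK !addrA.
have -> : y = res h (res h (x + (h ^+ 2)%:C *: A (A y))).
  by apply: res_uniq => //; rewrite zE.
rewrite -!resB// opprD addrA subrr add0r.
apply: le_trans (res_contr _ h0) _; apply: le_trans (res_contr _ h0) _.
rewrite nrmN// nrmZr// ger0_norm ?sqr_ge0// ler_wpM2l ?sqr_ge0//.
by rewrite Ay AAy res_contr.
Qed.

(** Contractivity of the resolvents makes the local errors add up instead of
    being amplified. *)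
Lemma iter_res_half h n x : 0 < h -> D x -> D (A x) ->
  nrm (iter n.*2 (res h) x - iter n (res (h *+ 2)) x) <=
  n%:R * h ^+ 2 * nrm (A (A x)).
Proof.
move=> h0 Dx DAx; have h20 : 0 < h *+ 2 by rewrite pmulrn_lgt0.
elim: n => [|n IH]; first by rewrite subrr nrm0// !mul0r.
have [D1 A1] := operator_iter_res n h20 Dx.
have [D2 A2] := operator_iter_res n h20 DAx.
rewrite doubleS !iterS; set y := iter n (res (h *+ 2)) x in IH D1 A1 *.
apply: le_trans (nrm_tri bn (res h (res h y)) _ _) _.
have e1 : nrm (res h (res h (iter n.*2 (res h) x)) - res h (res h y)) <=
    n%:R * h ^+ 2 * nrm (A (A x)).
  by rewrite -!resB//; do 2 apply: le_trans (res_contr _ h0) _.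
have e2 : nrm (res h (res h y) - res (h *+ 2) y) <= h ^+ 2 * nrm (A (A x)).
  apply: le_trans (res_half h0 D1 _) _; first by rewrite A1.
  by rewrite A1 A2 ler_wpM2l ?sqr_ge0// iter_res_contr.
by rewrite -natr1 !mulrDl mul1r; lra.
Qed.

(** Dyadic step sizes: each scheme refines the previous one. *)
Definition step (k : nat) : R := 2^-1 ^+ k.

Lemma step_gt0 k : 0 < step k.
Proof. by rewrite exprn_gt0// invr_gt0. Qed.

Lemma step_double k : step k = step k.+1 *+ 2.
Proof. by rewrite /step exprS; field. Qed.

Lemma step_small (c e : R) : 0 < e -> exists N, forall n, (N <= n)%N -> step n * c < e.
Proof.
move=> e0; have : step n * c @[n --> \oo] --> (0 : R).
  rewrite -[X in _ --> X](mul0r c); apply: cvgMl; apply: cvg_expr.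
  by rewrite ger0_norm ?invr_ge0// invf_lt1// ltr1n.
move=> /cvgrPdist_lt /(_ e e0) [N _ Ne]; exists N => n /Ne /=.
by rewrite sub0r normrN => /(le_lt_trans (ler_norm _)).
Qed.

Definition steps (k : nat) (t : R) : nat := Num.truncn (t / step k).

Lemma stepsP k t : 0 <= t ->
  (steps k t)%:R * step k <= t < (steps k t)%:R * step k + step k.
Proof.
move=> t0; have s0 := step_gt0 k.
have := truncn_itv (divr_ge0 t0 (ltW s0)).
by rewrite ler_pdivlMr// ltr_pdivrMr// -natr1 mulrDl mul1r.
Qed.

Lemma steps_double k t : 0 <= t ->
  ((steps k t).*2 <= steps k.+1 t <= (steps k t).*2.+1)%N.
Proof.
move=> t0; have /andP[a b] := stepsP k t0; have /andP[c d] := stepsP k.+1 t0.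
have s0 := step_gt0 k.+1; move: a b; rewrite step_double => a b.
apply/andP; split; rewrite -ltnS -(ltr_nat R) -(ltr_pM2r s0) -!natr1 -!mul2n ?natrM; lra.
Qed.

Lemma steps_add k s t : 0 <= s -> 0 <= t ->
  (steps k s + steps k t <= steps k (s + t) <= (steps k s + steps k t).+1)%N.
Proof.
move=> s0 t0; have /andP[a b] := stepsP k t0; have /andP[c d] := stepsP k s0.
have h0 := step_gt0 k; have /andP[e f] := stepsP k (addr_ge0 s0 t0).
by apply/andP; split; rewrite -ltnS -(ltr_nat R) -(ltr_pM2r h0) -!natr1 ?natrD; lra.
Qed.

Definition euler k t x := iter (steps k t) (res (step k)) x.

Lemma euler_lin k t c x y : euler k t (c *: x + y) = c *: euler k t x + euler k t y.
Proof. exact: iter_res_lin (step_gt0 k). Qed.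

Lemma eulerB k t x y : euler k t (x - y) = euler k t x - euler k t y.
Proof. exact: iter_resB (step_gt0 k). Qed.

Lemma euler_contr k t x : nrm (euler k t x) <= nrm x.
Proof. exact: iter_res_contr (step_gt0 k). Qed.

(** Halving the step size costs the accumulated local errors plus at most one
    extra step; the bound is summable in k. *)
Lemma euler_step k t x : 0 <= t -> D x -> D (A x) ->
  nrm (euler k.+1 t x - euler k t x) <=
  step k.+1 * (t * nrm (A (A x)) + nrm (A x)).
Proof.
move=> t0 Dx DAx; have h0 := step_gt0 k.+1.
have /andP[n1 _] := stepsP k t0.
have e1 := iter_res_shift h0 Dx (steps_double k t0).
have := iter_res_half (steps k t) h0 Dx DAx.
rewrite -step_double -/(euler k t x) => e2.
apply: le_trans (nrm_tri bn (iter (steps k t).*2 (res (step k.+1)) x) _ _) _.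
have M0 := nrm_ge0 bn (A (A x)).
have : step k.+1 * nrm (A (A x)) * ((steps k t)%:R * step k.+1) <= step k.+1 * nrm (A (A x)) * t.
  apply: ler_wpM2l; first by rewrite mulr_ge0// ltW.
  apply: le_trans n1; apply: ler_wpM2l; first exact: ler0n.
  by rewrite (step_double k) mulr2n lerDr ltW.
by rewrite expr2 in e2; lra.
Qed.

(** One resolvent step moves an element of D into the domain of A^2, where
    the error estimates apply. *)
Lemma domain2_dense x e : 0 < e -> exists z, [/\ D z, D (A z) & nrm (z - x) < e].
Proof.
move=> e0; have e2 : 0 < e / 2 by lra.
have [y Dy yx] := domain_dense md x e2.
have [N /(_ N (leqnn N)) Nh] := step_small (nrm (A y)) e2.
have [Dz DAz _] := operator_res (step_gt0 N) Dy.
exists (res (step N) y); split=> //.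
have := res_sub (step_gt0 N) Dy.
by have := nrm_tri bn y (res (step N) y) x; lra.
Qed.

(** The summable bound holds on the domain of A^2; density and contractivity
    extend the Cauchy property to all x. *)
Lemma euler_cauchy t x : 0 <= t -> ncauchy nrm (fun k => euler k t x).
Proof.
move=> t0 e e0; have e4 : 0 < e / 4 by lra.
have [z [Dz DAz zx]] := domain2_dense x e4.
pose c := t * nrm (A (A z)) + nrm (A z).
have c0 : 0 <= c by rewrite addr_ge0 ?mulr_ge0// nrm_ge0.
have zk k m : nrm (euler (k + m) t z - euler k t z) <= (step k - step (k + m)) * c.
  elim: m => [|m IH]; first by rewrite addn0 !subrr nrm0// mul0r.
  apply: le_trans (nrm_tri bn (euler (k + m) t z) _ _) _.
  have := euler_step (k + m) t0 Dz DAz; rewrite -/c addnS.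
  by rewrite (step_double (k + m)) in IH *; lra.
have [N Ne] := step_small c e4.
have xk k : (N <= k)%N -> nrm (euler k t x - euler N t z) < e / 2.
  move=> Nk; apply: le_lt_trans (nrm_tri bn (euler k t z) _ _) _.
  have := zk N (k - N)%N; rewrite subnKC// => h1.
  have := Ne N (leqnn N); have := mulr_ge0 (ltW (step_gt0 k)) c0.
  have := euler_contr k t (x - z); rewrite eulerB (nrmB bn x z) => h2.
  by rewrite mulrBl in h1; lra.
exists N => m n Nm Nn; apply: le_lt_trans (nrm_tri bn (euler N t z) _ _) _.
by have := xk m Nm; have := xk n Nn; rewrite (nrmB bn (euler N t z)); lra.
Qed.

Definition sgroup t x := xget 0 [set l | ncvg nrm \oo (fun k => euler k t x) l].

Lemma sgroupP t x : 0 <= t -> ncvg nrm \oo (fun k => euler k t x) (sgroup t x).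
Proof.
move=> t0; have [l xl] := nrm_complete bn (euler_cauchy x t0).
by rewrite /sgroup; case: xgetP => [//|/(_ l)].
Qed.

Lemma sgroup_lin t c x y : 0 <= t ->
  sgroup t (c *: x + y) = c *: sgroup t x + sgroup t y.
Proof.
move=> t0; apply: (ncvg_uniq bn (sgroupP _ t0)).
rewrite [X in ncvg _ _ X](_ : _ = fun k => c *: euler k t x + euler k t y).
  by apply: (ncvg_lin bn c); exact: sgroupP.
by apply/funext => k; rewrite euler_lin.
Qed.

Lemma sgroupB t x y : 0 <= t -> sgroup t (x - y) = sgroup t x - sgroup t y.
Proof. by move=> t0; rewrite addrC -scaleN1r sgroup_lin// scaleN1r addrC. Qed.

Lemma sgroup_le t x y c : 0 <= t -> (forall e, 0 < e ->
    exists N, forall k, (N <= k)%N -> nrm (euler k t x - y) <= c + e) ->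
  nrm (sgroup t x - y) <= c.
Proof.
move=> t0 h; apply/ler_addgt0Pr => e e0; have [N hN] := h e e0.
by apply: (ncvg_le bn (sgroupP x t0)); exists N.
Qed.

Lemma sgroup_contr t x : 0 <= t -> nrm (sgroup t x) <= nrm x.
Proof.
move=> t0; have := @sgroup_le t x 0 (nrm x) t0; rewrite subr0; apply=> e e0.
by exists 0%N => k _; rewrite subr0; have := euler_contr k t x; lra.
Qed.

Lemma sgroup0 x : sgroup 0 x = x.
Proof.
apply: (ncvg_uniq bn (sgroupP x (lexx 0))).
rewrite [X in ncvg _ _ X](_ : _ = fun=> x); first exact: ncvg_cst.
by apply/funext => k; rewrite /euler /steps mul0r truncn0.
Qed.

(** The number of steps up to s + t is the sum of those up to s and up to t,
    or one more, and one more step is negligible on D. *)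
Lemma sgroupD_dom s t x : 0 <= s -> 0 <= t -> D x ->
  sgroup (s + t) x = sgroup s (sgroup t x).
Proof.
move=> s0 t0 Dx; apply: (nrm_inj bn) => e e0.
apply: sgroup_le; first exact: addr_ge0.
move=> d d0; have e2 : 0 < e / 2 by lra.
have [N1 h1] := step_small (nrm (A x)) d0.
have /(ncvgP bn) /(_ _ e2) [N2 _ h2] := sgroupP x t0.
have /(ncvgP bn) /(_ _ e2) [N3 _ h3] := sgroupP (sgroup t x) s0.
exists (maxn N1 (maxn N2 N3)) => k; rewrite !geq_max => /and3P[k1 k2 k3].
apply: le_trans (nrm_tri bn (euler k s (euler k t x)) _ _) _.
have := iter_res_shift (step_gt0 k) Dx (steps_add k s0 t0).
rewrite iterD -/(euler k t x) -/(euler k s _) -/(euler k _ _) => H1.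
have := nrm_tri bn (euler k s (sgroup t x)) (euler k s (euler k t x)) (sgroup s (sgroup t x)).
have := euler_contr k s (euler k t x - sgroup t x); rewrite eulerB.
by have := h1 k k1; have := h2 k k2; have := h3 k k3; rewrite /=; lra.
Qed.

Lemma sgroupD s t x : 0 <= s -> 0 <= t ->
  sgroup (s + t) x = sgroup s (sgroup t x).
Proof.
move=> s0 t0; apply: (nrm_inj bn) => e e0.
have e2 : 0 < e / 2 by lra.
have [z Dz zx] := domain_dense md x e2; have st0 := addr_ge0 s0 t0.
apply: le_trans (nrm_tri bn (sgroup (s + t) z) _ _) _.
rewrite [in X in _ + X]sgroupD_dom// -!sgroupB//.
have := sgroup_contr (x - z) st0.
have := sgroup_contr (sgroup t (z - x)) s0.
by have := sgroup_contr (z - x) t0; rewrite (nrmB bn x z); lra.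
Qed.

Lemma sgroup_sub t x : 0 <= t -> D x -> nrm (sgroup t x - x) <= t * nrm (A x).
Proof.
move=> t0 Dx; apply: sgroup_le => // e e0; exists 0%N => k _.
have := iter_res_sub (steps k t) (step_gt0 k) Dx; have /andP[n1 _] := stepsP k t0.
have := ler_wpM2r (nrm_ge0 bn (A x)) n1.
by rewrite -/(euler k t x); lra.
Qed.

(** Discrete first-order Taylor estimate. As A x need not lie in D, its
    variation along the scheme is controlled through a nearby z in D. *)
Lemma iter_res_diff h n x z : 0 < h -> D x -> D z ->
  nrm (iter n (res h) x - x - (n%:R * h)%:C *: A x) <=
  n%:R * h * (2 * nrm (z - A x) + n%:R * h * nrm (A z)).
Proof.
move=> h0 Dx Dz; elim: n => [|n IH].
  by rewrite !mul0r scale0r subrr subr0 nrm0.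
set M := nrm (z - A x) in IH *; set K := nrm (A z) in IH *.
have [Dn An] := operator_iter_res n h0 Dx.
have [Dr rx] := resP (iter n (res h) x) h0.
have [_ _ E] := operator_res h0 Dn.
have -> : iter n.+1 (res h) x - x - (n.+1%:R * h)%:C *: A x =
    (iter n (res h) x - x - (n%:R * h)%:C *: A x) +
    h%:C *: (iter n.+1 (res h) (A x) - A x).
  rewrite !iterS -An -E -[in iter n (res h) x - x]rx scalerBr.
  rewrite -natr1 mulrDl mul1r rmorphD scalerDl.
  set a := res h _; set b := h%:C *: A a; set c := h%:C *: A x.
  rewrite [a - b - x]addrAC [X in X + (b - c)]addrAC [RHS]addrA subrK.
  by rewrite opprD addrA.
apply: le_trans (nrmD bn _ _) _.
rewrite nrmZr// gtr0_norm//.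
have e1 : nrm (iter n.+1 (res h) (A x) - A x) <= 2 * M + n.+1%:R * h * K.
  apply: le_trans (nrm_tri bn (iter n.+1 (res h) z) _ _) _.
  have := nrm_tri bn z (iter n.+1 (res h) z) (A x).
  have := iter_res_sub n.+1 h0 Dz.
  have := iter_res_contr n.+1 (A x - z) h0; rewrite iter_resB// (nrmB bn (A x) z).
  by rewrite -/M -/K; lra.
have := ler_wpM2l (ltW h0) e1; move=> e2.
apply: le_trans (lerD IH e2) _.
have K0 : 0 <= K by exact: nrm_ge0.
rewrite -natr1; have n0 : 0 <= n%:R :> R by [].
have := mulr_ge0 (mulr_ge0 (mulr_ge0 n0 (ltW h0)) (ltW h0)) K0.
by lra.
Qed.

Lemma sgroup_diff t x z : 0 <= t -> D x -> D z ->
  nrm (sgroup t x - x - t%:C *: A x) <= t * (2 * nrm (z - A x) + t * nrm (A z)).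
Proof.
move=> t0 Dx Dz; rewrite -addrA -opprD; apply: sgroup_le => // e e0.
have [N h] := step_small (nrm (A x)) e0; exists N => k /h hk.
have := iter_res_diff (steps k t) (step_gt0 k) Dx Dz.
have /andP[n1 n2] := stepsP k t0.
set s : R := _ * step k in n1 n2 *; rewrite -/(euler k t x) => h1.
have s0 : 0 <= s by rewrite mulr_ge0 ?ler0n// ltW// step_gt0.
apply: le_trans (nrm_tri bn (x + s%:C *: A x) _ _) _.
rewrite -[_ - x - _]addrA -opprD in h1.
have -> : x + s%:C *: A x - (x + t%:C *: A x) = (s - t)%:C *: A x.
  by rewrite rmorphB scalerBl opprD addrACA subrr add0r.
rewrite nrmZr// ler0_norm; last lra.
have : s * (2 * nrm (z - A x) + s * nrm (A z)) <=
       t * (2 * nrm (z - A x) + t * nrm (A z)).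
  have Z0 := nrm_ge0 bn (A z); have M0 := nrm_ge0 bn (z - A x).
  apply: ler_pM => //; first by have := mulr_ge0 s0 Z0; lra.
  by rewrite lerD2l ler_wpM2r.
have : (t - s) * nrm (A x) <= step k * nrm (A x).
  by rewrite ler_wpM2r ?nrm_ge0//; lra.
by lra.
Qed.

Lemma sgroup_derive x : D x ->
  ncvg nrm 0^'+ (fun t => (t^-1)%:C *: (sgroup t x - x)) (A x).
Proof.
move=> Dx; apply/(ncvgP bn) => e e0; have e4 : 0 < e / 4 by lra.
have [z Dz zx] := domain_dense md (A x) e4.
have Z0 := nrm_ge0 bn (A z).
have d0 : 0 < e / 2 / (nrm (A z) + 1) by rewrite divr_gt0//; lra.
near=> t; have t0 : 0 < t by near: t; exact: nbhs_right_gt.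
have : t < e / 2 / (nrm (A z) + 1) by near: t; exact: nbhs_right_lt.
rewrite ltr_pdivlMr; last lra.
have -> : (t^-1)%:C *: (sgroup t x - x) - A x =
    (t^-1)%:C *: (sgroup t x - x - t%:C *: A x).
  by rewrite [RHS]scalerBr scalerA -rmorphM/= mulVf ?gt_eqF// scale1r.
move=> te; rewrite nrmZr// ger0_norm ?invr_ge0 ?ltW// mulrC ltr_pdivrMr//.
apply: le_lt_trans (sgroup_diff (ltW t0) Dx Dz) _.
by rewrite mulrC ltr_pM2r//; lra.
Unshelve. all: by end_near. Qed.

(** For the converse, choose z in D with z - A z = x - y. Then w = x - z
    satisfies S(t) w = (1 + t) w + o(t), which contractivity forbids unless w
    = 0. *)
Lemma sgroup_generator x y :
  (D x /\ A x = y) <-> ncvg nrm 0^'+ (fun t => (t^-1)%:C *: (sgroup t x - x)) y.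
Proof.
split=> [[Dx <-]|xy]; first exact: sgroup_derive.
have [z Dz zE] := resolvent_onto md (x - y) ltr01.
have zz := sgroup_derive Dz; rewrite scale1r in zE.
suff w0 : x - z = 0.
  have xz : x = z by apply/eqP; rewrite -subr_eq0 w0.
  by move: zE; rewrite xz => /addrI/oppr_inj ->.
have wE : y - A z = x - z.
  by rewrite -{1}(subKr x y) -zE opprB addrA addrAC addrAC [x + _ - z]addrAC addrK.
have xyz : ncvg nrm 0^'+ (fun t => (t^-1)%:C *: (sgroup t (x - z) - (x - z))) (x - z).
  rewrite -[X in ncvg _ _ _ X]wE -[y - A z]addrC -[- A z]scaleN1r.
  have xzP := (ncvgP bn _ _).1 (ncvg_lin bn (-1) zz xy).
  apply/(ncvgP bn) => e e0; apply: filterS2 (xzP _ _ e e0) (nbhs_right_gt 0) => t + t0.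
  apply: le_lt_trans; rewrite le_eqVlt; apply/orP; left; apply/eqP.
  congr (nrm (_ - _)); rewrite sgroupB ?ltW// -subrACA scalerBr addrC.
  by rewrite scaleN1r.
apply: (nrm_le0 bn); apply/ler_addgt0Pr => e e0; rewrite add0r.
have /(ncvgP bn) /(_ e e0) xn := xyz.
near (0 : R)^'+ => t.
have t0 : 0 < t by near: t; exact: nbhs_right_gt.
have : nrm ((t^-1)%:C *: (sgroup t (x - z) - (x - z)) - (x - z)) < e by near: t.
set w := x - z.
have -> : (t^-1)%:C *: (sgroup t w - w) - w = (t^-1)%:C *: (sgroup t w - (1 + t)%:C *: w).
  rewrite rmorphD scalerDl rmorph1 scale1r [in RHS]opprD [in RHS]addrA.
  by rewrite [RHS]scalerBr [in RHS]scalerA -rmorphM/= mulVf ?gt_eqF// scale1r.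
rewrite nrmZr// ger0_norm ?invr_ge0 ?(ltW t0)// mulrC ltr_pdivrMr//.
have := nrm_le_sub bn ((1 + t)%:C *: w) (sgroup t w).
rewrite (nrmB bn (_ *: w)) nrmZr// ger0_norm; last lra.
have := sgroup_contr w (ltW t0) => h1 h2 h3.
rewrite -(ler_pM2l t0); lra.
Unshelve. all: by end_near. Qed.

Lemma sgroup_contraction_semigroup : contraction_semigroup nrm sgroup.
Proof.
split.
- by move=> t t0 c x y; exact: sgroup_lin.
- exact: sgroup0.
- by move=> s t s0 t0 x; exact: sgroupD.
- move=> x; apply/(ncvgP bn) => e e0; have e3 : 0 < e / 3 by lra.
  have [z Dz zx] := domain_dense md x e3.
  have Z0 := nrm_ge0 bn (A z).
  have d0 : 0 < e / 3 / (nrm (A z) + 1) by rewrite divr_gt0//; lra.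
  near=> t; have t0 : 0 < t by near: t; exact: nbhs_right_gt.
  have : t < e / 3 / (nrm (A z) + 1) by near: t; exact: nbhs_right_lt.
  rewrite ltr_pdivlMr; last lra.
  have := sgroup_sub (ltW t0) Dz; have := sgroup_contr (x - z) (ltW t0).
  rewrite sgroupB ?(ltW t0)// (nrmB bn x z) => h1 h2.
  have := nrm_tri bn (sgroup t z) (sgroup t x) x.
  by have := nrm_tri bn z (sgroup t z) x; lra.
- by move=> t t0 x; exact: sgroup_contr.
Unshelve. all: by end_near. Qed.

End Resolvent.

(** * Classical solutions of the Cauchy problem *)

Section ClassicalSolutions.
Context {R : realType} {H : lmodType R[i]} (nrm : H -> R).
Hypothesis bn : banach_norm nrm.
Variables (D : set H) (A : H -> H).
Hypothesis md : m_dissipative nrm D A.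

Lemma near_dnbhs_nonneg (t : R) (P : set R) :
  within [set s : R | 0 <= s] t^' P <->
  exists2 d, 0 < d & forall s, 0 <= s -> s != t -> `|s - t| < d -> P s.
Proof.
split=> [|[d d0 h]].
  rewrite /within /dnbhs /= => /nbhs_ballP[d /= d0 h]; exists d => // s s0 st sd.
  by apply: h => //; rewrite /ball/= distrC.
rewrite /within /dnbhs /=; apply/nbhs_ballP; exists d => // s.
by rewrite /ball/= distrC => sd st s0; exact: h.
Qed.

Lemma near_nbhs_nonneg (t : R) (P : set R) :
  within [set s : R | 0 <= s] (nbhs t) P <->
  exists2 d, 0 < d & forall s, 0 <= s -> `|s - t| < d -> P s.
Proof.
split=> [|[d d0 h]].
  rewrite /within /= => /nbhs_ballP[d /= d0 h]; exists d => // s s0 sd.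
  by apply: h => //; rewrite /ball/= distrC.
rewrite /within /=; apply/nbhs_ballP; exists d => // s.
by rewrite /ball/= distrC => sd s0; exact: h.
Qed.

Lemma sgroup_shift s t x : 0 <= s -> s <= t ->
  sgroup nrm D A t x - sgroup nrm D A s x = sgroup nrm D A s (sgroup nrm D A (t - s) x - x).
Proof.
move=> s0 st; have ts : 0 <= t - s by lra.
by rewrite (sgroupB bn)// -(sgroupD bn)// [s + _]addrC subrK.
Qed.

Lemma sgroup_continuous (t e : R) x : 0 <= t -> 0 < e -> exists2 d, 0 < d &
  forall s, 0 <= s -> `|s - t| < d ->
    nrm (sgroup nrm D A s x - sgroup nrm D A t x) < e.
Proof.
move=> t0 e0.
have /(ncvgP bn) /(_ _ e0) := semigroup_strong_cvg (sgroup_contraction_semigroup bn md) x.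
move=> /nbhs_ballP[d /= d0 h]; exists d => // s s0 st.
have h' r : 0 <= r -> r < d -> nrm (sgroup nrm D A r x - x) < e.
  rewrite le_eqVlt => /predU1P[<- _|r0 rd]; first by rewrite (sgroup0 bn)// subrr nrm0.
  by apply: h => //; rewrite /ball/= sub0r normrN gtr0_norm.
have [ts|ts] := leP t s.
  rewrite sgroup_shift//; have ts0 : 0 <= s - t by lra.
  apply: le_lt_trans (sgroup_contr bn md _ t0) _.
  by apply: h' => //; move: st; rewrite ger0_norm.
rewrite (nrmB bn) sgroup_shift ?(ltW ts)//; have ts0 : 0 <= t - s by lra.
apply: le_lt_trans (sgroup_contr bn md _ s0) _.
by apply: h' => //; move: st; rewrite distrC ger0_norm.
Qed.

(** The semigroup commutes with its own difference quotients at 0. *)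
Lemma sgroup_dom (t : R) x : 0 <= t -> D x ->
  D (sgroup nrm D A t x) /\ A (sgroup nrm D A t x) = sgroup nrm D A t (A x).
Proof.
move=> t0 Dx; apply/(sgroup_generator bn md)/(ncvgP bn) => e e0.
have /(ncvgP bn) /(_ _ e0) h := sgroup_derive bn md Dx.
apply: filterS2 h (nbhs_right_gt 0) => s + s0; apply: le_lt_trans.
rewrite -(sgroupD bn) ?(ltW s0)// [s + _]addrC (sgroupD bn) ?(ltW s0)// -(sgroupB bn)//.
have lin0 c y : sgroup nrm D A t (c *: y) = c *: sgroup nrm D A t y.
  have z : sgroup nrm D A t 0 = 0 by have := sgroupB bn md 0 0 t0; rewrite !subrr.
  by have := sgroup_lin bn md c y 0 t0; rewrite z !addr0.
by rewrite -lin0 -(sgroupB bn)//; exact: sgroup_contr.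
Qed.

Lemma sgroup_classical U0 : D U0 ->
  classical_solution nrm D A U0 (fun t => sgroup nrm D A t U0).
Proof.
move=> D0; split; last exact: (sgroup0 bn).
  by move=> t t0; have [] := sgroup_dom t0 D0.
exists (fun t => sgroup nrm D A t (A U0)); last first.
  by move=> t /ltW t0; have [_ ->] := sgroup_dom t0 D0.
move=> t t0; split; last first.
  apply/(ncvgP bn) => e e0; apply/near_nbhs_nonneg.
  exact: sgroup_continuous.
apply/(ncvgP bn) => e e0; apply/near_dnbhs_nonneg.
have e2 : 0 < e / 2 by lra.
have /(ncvgP bn) /(_ _ e2) /nbhs_ballP[d /= d0 h] := sgroup_derive bn md D0.
have [d' d'0 h'] := sgroup_continuous (A U0) t0 e2.
exists (Num.min d d'); first by rewrite lt_min d0.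
have lin0 u c y : 0 <= u -> sgroup nrm D A u (c *: y) = c *: sgroup nrm D A u y.
  move=> u0.
  have z : sgroup nrm D A u 0 = 0 by have := sgroupB bn md 0 0 u0; rewrite !subrr.
  by have := sgroup_lin bn md c y 0 u0; rewrite z !addr0.
have key u v : 0 <= u -> u < v -> v - u < d ->
    nrm (((v - u)^-1)%:C *: (sgroup nrm D A v U0 - sgroup nrm D A u U0) -
      sgroup nrm D A u (A U0)) < e / 2.
  move=> u0 uv vu; rewrite sgroup_shift// ?(ltW uv)// -lin0// -(sgroupB bn)//.
  apply: le_lt_trans (sgroup_contr bn md _ u0) _.
  by apply: h; [rewrite /ball/= sub0r normrN gtr0_norm//; lra|lra].
move=> s s0 st; rewrite lt_min => /andP[sd sd'].
have [ts|ts] := ltP t s.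
  apply: lt_trans (key t s t0 ts _) _; last lra.
  by move: sd; rewrite gtr0_norm//; lra.
have {}ts : s < t by rewrite lt_neqAle st.
have -> : ((s - t)^-1)%:C *: (sgroup nrm D A s U0 - sgroup nrm D A t U0) =
   ((t - s)^-1)%:C *: (sgroup nrm D A t U0 - sgroup nrm D A s U0).
  by rewrite -(opprB t s) -[X in _ *: X = _]opprB scalerN invrN rmorphN scaleNr opprK.
apply: le_lt_trans (nrm_tri bn (sgroup nrm D A s (A U0)) _ _) _.
have := h' s s0 sd'; have := key s t s0 ts; rewrite distrC gtr0_norm in sd; last lra.
by move=> /(_ sd); lra.
Qed.

(** The infimum of the points s with f t <= f s + e (t - s) belongs to this
    set by continuity and could be moved further left if it were positive. *)
Lemma decay (f : R -> R) (t : R) : 0 <= t ->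
  (forall s e, 0 <= s -> 0 < e -> exists2 d, 0 < d &
     forall r, 0 <= r -> `|r - s| < d -> `|f r - f s| < e) ->
  (forall s e, 0 < s -> 0 < e -> exists2 d, 0 < d &
     forall r, 0 <= r -> r < s -> s - r < d -> f s - f r <= e * (s - r)) ->
  f t <= f 0.
Proof.
move=> t0 fc fd; apply/ler_addgt0Pr => e0 e00.
(* so that the total error e t stays below e0 *)
pose e := e0 / (t + 1); have e_gt0 : 0 < e by rewrite divr_gt0//; lra.
suff : f t <= f 0 + e * t.
  have -> : e0 = e * t + e by rewrite -[X in _ + X]mulr1 -mulrDr divfK// gt_eqF//; lra.
  by lra.
pose E := [set s | 0 <= s <= t /\ f t <= f s + e * (t - s)].
have Et : E t by split; [rewrite t0 lexx|rewrite subrr mulr0 addr0].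
have E0 : E !=set0 by exists t.
have lE : has_lbound E by exists 0 => s [/andP[]].
have m0 : 0 <= inf E by apply: lb_le_inf => // s [/andP[]].
have mt : inf E <= t by apply: ge_inf.
have Em : E (inf E).
  split; first by rewrite m0.
  apply/ler_addgt0Pr => c c0; have c2 : 0 < c / 2 by lra.
  have [d d0 h] := fc (inf E) _ m0 c2.
  have [r [/andP[r0 rt] Er]] := inf_adherent d0 (conj E0 lE).
  have mr : 0 <= r - inf E by rewrite subr_ge0; apply: ge_inf => //; split; rewrite ?r0.
  rewrite -ltrBlDl => rd; have := mulr_ge0 (ltW e_gt0) mr.
  have := h r r0; rewrite ger0_norm// => /(_ rd).
  by rewrite ltr_norml => /andP[_]; lra.
have := m0; rewrite le_eqVlt => /predU1P[m0E|mp].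
  by case: Em => _; rewrite -m0E subr0.
have [d d0 h] := fd (inf E) e mp e_gt0.
pose q := Num.min (inf E) (d / 2).
have q0 : 0 < q by rewrite lt_min mp/=; lra.
have qm : q <= inf E by rewrite ge_min lexx.
have qd : q <= d / 2 by rewrite ge_min lexx orbT.
have := h (inf E - q) _ _ _; rewrite subKr.
have : E (inf E - q) -> False by move=> /(ge_inf lE); lra.
case: Em => _ Em nE hq; exfalso; apply: nE; split; first by apply/andP; split; lra.
by have := hq _ _ _; lra.
Qed.

(** Dissipativity gives |U s| <= |U s - (s - r) A (U s)|, and the right-hand
    side is |U r| up to o(s - r). Only left difference quotients of the norm
    occur, so its differentiability is not an issue. *)
Lemma solution_decay U U' (t : R) : 0 <= t -> (forall t, 0 <= t -> D (U t)) ->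
  is_C1 nrm U U' -> (forall t, 0 < t -> U' t = A (U t)) -> nrm (U t) <= nrm (U 0).
Proof.
move=> t0 DU cU UA.
have key s e : 0 <= s -> 0 < e -> exists2 d, 0 < d & forall r, 0 <= r -> r != s ->
    `|r - s| < d -> nrm (U r - U s - (r - s)%:C *: U' s) <= e * `|r - s|.
  move=> s0 e0; have /(ncvgP bn) /(_ _ e0) /near_dnbhs_nonneg[d d0 h] := (cU s s0).1.
  exists d => // r r0 rs rd; have := h r r0 rs rd.
  have rs0 : r - s != 0 by rewrite subr_eq0.
  have -> : U r - U s - (r - s)%:C *: U' s =
      (r - s)%:C *: (((r - s)^-1)%:C *: (U r - U s) - U' s).
    by rewrite scalerBr scalerA -rmorphM/= mulfV// scale1r.
  by rewrite nrmZr// mulrC => /ltW; apply: ler_wpM2r.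
apply: (decay (f := fun s => nrm (U s))) => // s e s0 e0.
  have [d d0 h] := key s 1 s0 ltr01; have K0 := nrm_ge0 bn (U' s).
  exists (Num.min d (e / (1 + nrm (U' s)))).
    by rewrite lt_min d0 divr_gt0//; lra.
  move=> r r0; rewrite lt_min ltr_pdivlMr => [/andP[rd re]|]; last lra.
  have [->|rs] := eqVneq r s; first by rewrite subrr normr0.
  have h1 := h r r0 rs rd.
  have : nrm (U r - U s) <= `|r - s| * (1 + nrm (U' s)).
    have := nrmD bn (U r - U s - (r - s)%:C *: U' s) ((r - s)%:C *: U' s).
    by rewrite subrK nrmZr//; lra.
  have := nrm_le_sub bn (U r) (U s); have := nrm_le_sub bn (U s) (U r).
  by rewrite (nrmB bn (U s)) ltr_norml => ? ? ?; apply/andP; split; lra.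
have [d d0 h] := key s e (ltW s0) e0; exists d => // r r0 rs sr.
have rsd : `|r - s| < d by rewrite distrC gtr0_norm//; lra.
have := h r r0 (negbT (lt_eqF rs)) rsd; rewrite distrC gtr0_norm; last lra.
have sr0 : 0 <= s - r by lra.
have := dissipative md sr0 (DU s (ltW s0)); rewrite -UA// => h1 h2.
have := nrm_tri bn (U r) (U s - (s - r)%:C *: U' s) 0; rewrite !subr0.
have -> : U s - (s - r)%:C *: U' s - U r = - (U r - U s - (r - s)%:C *: U' s).
  by rewrite -(opprB s r) rmorphN scaleNr opprK opprD opprB addrAC.
by rewrite nrmN//; lra.
Qed.

(** The difference of two solutions is again a solution, so the decay of its
    norm yields uniqueness and continuous dependence together. *)
Lemma solution_stable U0 V0 U V (t : R) : 0 <= t ->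
  classical_solution nrm D A U0 U -> classical_solution nrm D A V0 V ->
  nrm (U t - V t) <= nrm (U0 - V0).
Proof.
move=> t0 [DU [U' cU UA] <-] [DV [V' cV VA] <-].
apply: (@solution_decay (fun s => U s - V s) (fun s => U' s - V' s)) => //.
- by move=> s s0; apply: (domainB md); [exact: DU|exact: DV].
- move=> s s0; split.
    rewrite [X in ncvg _ _ X _](_ : _ = fun r => ((r - s)^-1)%:C *: (U r - U s) -
        ((r - s)^-1)%:C *: (V r - V s)); last first.
      by apply/funext => r; rewrite -scalerBr subrACA.
    by apply: (ncvgB bn); [exact: (cU s s0).1|exact: (cV s s0).1].
  by apply: (ncvgB bn); [exact: (cU s s0).2|exact: (cV s s0).2].
- by move=> s s0; rewrite UA// VA// (operatorB md)//; [exact/DU/ltW|exact/DV/ltW].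
Qed.

(** The Hille-Yosida theorem with its consequences for the Cauchy problem. *)
Theorem m_dissipative_well_posed :
  [/\ exists2 S : R -> H -> H,
        contraction_semigroup nrm S & is_generator nrm D A S,
      forall U0, D U0 -> exists2 U, classical_solution nrm D A U0 U &
        forall V, classical_solution nrm D A U0 V ->
          forall t, 0 <= t -> V t = U t
    & forall (U0 : H) (U0_ : nat -> H) (U : R -> H) (U_ : nat -> R -> H),
        D U0 -> (forall n, D (U0_ n)) ->
        classical_solution nrm D A U0 U ->
        (forall n, classical_solution nrm D A (U0_ n) (U_ n)) ->
        ncvg nrm \oo U0_ U0 ->
        forall a b, 0 <= a -> a <= b -> forall eps, 0 < eps ->
          \forall n \near \oo, forall t, a <= t <= b ->
            nrm (U_ n t - U t) < eps].
Proof.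
split.
- exists (sgroup nrm D A); first exact: sgroup_contraction_semigroup.
  by move=> x y; exact: sgroup_generator.
- move=> U0 D0; exists (fun t => sgroup nrm D A t U0); first exact: sgroup_classical.
  move=> V cV t t0; apply: (nrm_inj bn) => e e0.
  apply: le_trans (solution_stable t0 cV (sgroup_classical D0)) _.
  by rewrite subrr nrm0 ?ltW.
- move=> U0 U0_ U U_ _ _ cU cU_ /(ncvgP bn) UU a b a0 ab e e0.
  apply: filterS (UU e e0) => n Un t /andP[at_ tb].
  by apply: le_lt_trans (solution_stable (le_trans a0 at_) (cU_ n) cU) Un.
Qed.

End ClassicalSolutions.

(** * Inner products and the Riesz theorem *)

Section InnerProduct.
Context {R : realType} {V : lmodType R[i]} (ip : V -> V -> R).

(** A complex inner product is recorded by its real part alone: invariance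
    under multiplication by i makes ip x (i y) its imaginary part. *)
Record is_inner : Prop := {
  ipC : forall x y, ip x y = ip y x;
  ipP : forall (a : R) x y z, ip (a%:C *: x + y) z = a * ip x z + ip y z;
  ipI : forall x y, ip ('i *: x) ('i *: y) = ip x y;
  ip_ge0 : forall x, 0 <= ip x x;
  ip_eq0 : forall x, ip x x = 0 -> x = 0 }.

Definition inorm (x : V) : R := Num.sqrt (ip x x).

Hypothesis iV : is_inner.

Lemma ipDl x y z : ip (x + y) z = ip x z + ip y z.
Proof. by have := ipP iV 1 x y z; rewrite rmorph1 scale1r mul1r. Qed.

Lemma ip0l z : ip 0 z = 0.
Proof. by have := ipDl 0 0 z; rewrite addr0; lra. Qed.

Lemma ipZl a x z : ip (a%:C *: x) z = a * ip x z.
Proof. by have := ipP iV a x 0 z; rewrite !addr0 ip0l addr0. Qed.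

Lemma ipNl x z : ip (- x) z = - ip x z.
Proof. by have := ipZl (-1) x z; rewrite rmorphN1 scaleN1r mulN1r. Qed.

Lemma ipBl x y z : ip (x - y) z = ip x z - ip y z.
Proof. by rewrite ipDl ipNl. Qed.

Lemma ipDr x y z : ip z (x + y) = ip z x + ip z y.
Proof. by rewrite !(ipC iV z) ipDl. Qed.

Lemma ipZr a x z : ip z (a%:C *: x) = a * ip z x.
Proof. by rewrite !(ipC iV z) ipZl. Qed.

Lemma ipBr x y z : ip z (x - y) = ip z x - ip z y.
Proof. by rewrite !(ipC iV z) ipBl. Qed.

Lemma inorm_ge0 x : 0 <= inorm x.
Proof. exact: sqrtr_ge0. Qed.

Lemma inorm_sqr x : inorm x ^+ 2 = ip x x.
Proof. by rewrite sqr_sqrtr// ip_ge0. Qed.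

Lemma discriminant_le (a b c : R) : 0 <= c ->
  (forall s, 0 <= a + s * (b *+ 2) + s ^+ 2 * c) -> b ^+ 2 <= a * c.
Proof.
rewrite le_eqVlt => /predU1P[<- h|c0 h].
  have [->|b0] := eqVneq b 0; first by rewrite expr0n mulr0.
  have := h (- (a + 1) / (b *+ 2)); rewrite divfK ?mulrn_eq0//.
  by rewrite mulr0; lra.
have := h (- b / c); rewrite -(ler_pM2r c0) mul0r.
have -> : (a + - b / c * (b *+ 2) + (- b / c) ^+ 2 * c) * c = a * c - b ^+ 2.
  by field; rewrite gt_eqF.
by rewrite subr_ge0.
Qed.

Lemma cauchy_schwarz x y : `|ip x y| <= inorm x * inorm y.
Proof.
rewrite -(@ler_pXn2r _ 2)// ?nnegrE ?mulr_ge0 ?inorm_ge0//.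
rewrite exprMn !inorm_sqr real_normK ?num_real//.
apply: discriminant_le => [|s]; first exact: ip_ge0.
have := ip_ge0 iV (x + s%:C *: y).
by rewrite ipDl !ipDr !ipZl !ipZr (ipC iV y x); lra.
Qed.

Lemma inormD x y : inorm (x + y) <= inorm x + inorm y.
Proof.
rewrite -(@ler_pXn2r _ 2)// ?nnegrE ?addr_ge0 ?inorm_ge0//.
rewrite sqrrD !inorm_sqr ipDl !ipDr (ipC iV y x).
by have := le_trans (ler_norm _) (cauchy_schwarz x y); lra.
Qed.

Lemma inorm_banach :
  (forall x, ncauchy inorm x -> exists l, ncvg inorm \oo x l) ->
  banach_norm inorm.
Proof.
move=> cV; split => //; first exact: inormD.
  move=> c x; have ix : ip ('i *: x) x = 0.
    have := ipI iV ('i *: x) x; rewrite scalerA.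
    have -> : 'i * 'i = -1 :> R[i] by have := sqr_i R; rewrite expr2.
    by rewrite scaleN1r ipNl (ipC iV x); lra.
  have -> : c *: x = (complex.Re c)%:C *: x + (complex.Im c)%:C *: ('i *: x).
    rewrite scalerA -scalerDl; congr (_ *: _); case: c => a b /=; simpc.
    by [].
  rewrite normc_def /= -sqrtrM ?addr_ge0 ?sqr_ge0//; congr Num.sqrt.
  by rewrite ipDl !ipDr !ipZl !ipZr ipI// (ipC iV x) ix; ring.
move=> x /eqP; rewrite /inorm sqrtr_eq0 => x0; apply: (ip_eq0 iV).
by apply/eqP; rewrite eq_le x0 ip_ge0.
Qed.

Hypothesis cV : banach_norm inorm.

(** Minimise ip z z - 2 L z over D: minimising sequences are Cauchy by the
    parallelogram identity, and their limit satisfies the Euler equation.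
    With D the whole space this represents L; with L = ip y it projects y to
    the closure of D. *)
Lemma riesz_subspace (D : set V) (L : V -> R) (K : R) :
  D 0 -> (forall (a : R) x y, D x -> D y -> D (a%:C *: x + y)) ->
  (forall (a : R) x y, D x -> D y -> L (a%:C *: x + y) = a * L x + L y) ->
  (forall x, D x -> `|L x| <= K * inorm x) ->
  exists x, (forall e, 0 < e -> exists2 z, D z & inorm (z - x) < e) /\
            forall y, D y -> ip x y = L y.
Proof.
move=> D0 Dlin Llin LK.
have L0 : L 0 = 0.
  by have := Llin 1 0 0 D0 D0; rewrite rmorph1 scale1r addr0 mul1r; lra.
have LZ a x : D x -> L (a%:C *: x) = a * L x.
  by move=> Dx; have := Llin a x 0 Dx D0; rewrite !addr0 L0 addr0.
have DZ a x : D x -> D (a%:C *: x).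
  by move=> Dx; have := Dlin a x 0 Dx D0; rewrite addr0.
pose J z := ip z z - 2 * L z.
have J_ge z : D z -> - K ^+ 2 <= J z.
  move=> Dz; rewrite /J -inorm_sqr.
  have := le_trans (ler_norm _) (LK z Dz); have := sqr_ge0 (inorm z - K).
  by rewrite sqrrB; lra.
pose E := [set J z | z in D].
have lE : has_lbound E by exists (- K ^+ 2) => _ [z Dz <-]; exact: J_ge.
have E0 : E !=set0 by exists (J 0), 0.
have mJ z : D z -> inf E <= J z by move=> Dz; apply: ge_inf => //; exists z.
have /choice[z zP] : forall n : nat, exists z, D z /\ J z < inf E + n.+1%:R^-1.
  move=> n; have n0 : 0 < n.+1%:R^-1 :> R by rewrite invr_gt0.
  by have [_ [z Dz <-] zE] := inf_adherent n0 (conj E0 lE); exists z.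
(* parallelogram identity at the midpoint of two almost minimisers *)
have half x y : D x -> D y -> inorm (x - y) ^+ 2 <= 2 * (J x - inf E) + 2 * (J y - inf E).
  move=> Dx Dy; have := mJ _ (DZ 2^-1 _ (Dlin 1 x y Dx Dy)).
  rewrite /J inorm_sqr LZ ?Llin//; last exact: Dlin.
  rewrite rmorph1 scale1r ipBl !ipBr ipZl ipZr ipDl !ipDr (ipC iV y x).
  by lra.
have inv_small (e : R) : 0 < e -> exists N, forall n, (N <= n)%N -> n.+1%:R^-1 < e.
  move=> e0; exists (Num.truncn (e^-1)) => n Nn.
  rewrite invf_plt ?posrE//; apply: lt_le_trans (truncnS_gt _) _.
  by rewrite ler_nat.
have zc : ncauchy inorm z.
  move=> e e0; have e4 : 0 < e ^+ 2 / 4 by rewrite divr_gt0// exprn_gt0.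
  have [N hN] := inv_small _ e4; exists N => m n Nm Nn.
  rewrite -(@ltr_pXn2r _ 2)// ?nnegrE ?inorm_ge0 ?ltW//.
  apply: le_lt_trans (half _ _ (zP m).1 (zP n).1) _.
  have JN k : (N <= k)%N -> J (z k) - inf E < e ^+ 2 / 4.
    by move=> Nk; rewrite ltrBlDl; apply: lt_trans (zP k).2 _; rewrite ltrD2l hN.
  by have := JN m Nm; have := JN n Nn; lra.
have [x zx] := nrm_complete cV zc; exists x.
have xz e N : 0 < e -> exists2 n, (N <= n)%N & inorm (z n - x) < e.
  move=> e0; have [M _ hM] := (ncvgP cV _ _).1 zx e e0.
  by exists (maxn N M); rewrite ?leq_maxl//; apply: hM; rewrite /= leq_maxr.
split=> [e e0|y Dy].
  by have [n _ h] := xz e 0%N e0; exists (z n) => //; exact: (zP n).1.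
(* first-order condition for almost minimisers, read as a discriminant *)
have key n : (ip (z n) y - L y) ^+ 2 <= n.+1%:R^-1 * ip y y.
  apply: discriminant_le => [|s]; first exact: ip_ge0.
  have [Dz Jz] := zP n; have := mJ _ (Dlin s y (z n) Dy Dz).
  move: Jz; rewrite /J Llin// ipDl !ipDr !ipZl !ipZr (ipC iV y (z n)).
  move: (_^-1) => k.
  by lra.
apply/eqP; rewrite -subr_eq0 -normr_le0; apply/ler_addgt0Pr => e e0; rewrite add0r.
have y0 := inorm_ge0 y.
have [d d0 dy] : exists2 d, 0 < d & d * (inorm y + 1) = e / 2.
  exists (e / 2 / (inorm y + 1)); first by rewrite divr_gt0//; lra.
  by rewrite divfK// gt_eqF//; lra.
have [N hN] := inv_small (d ^+ 2) (exprn_gt0 _ d0).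
have [n Nn nx] := xz d N d0.
have h1 : `|ip (z n) y - L y| <= d * inorm y.
  rewrite -(@ler_pXn2r _ 2)// ?nnegrE ?mulr_ge0 ?(ltW d0)//.
  rewrite real_normK ?num_real// exprMn inorm_sqr.
  by apply: le_trans (key n) _; rewrite ler_wpM2r ?ip_ge0// ltW// hN.
have h2 : `|ip (x - z n) y| <= d * inorm y.
  apply: le_trans (cauchy_schwarz _ _) _; rewrite ler_wpM2r//.
  by rewrite (nrmB cV) ltW.
have -> : ip x y - L y = ip (x - z n) y + (ip (z n) y - L y) by rewrite ipBl; lra.
by apply: le_trans (ler_normD _ _) _; lra.
Qed.

(** Density of the domain is automatic. If x is the projection of y to the
    closure of D, write x - y = z - A z with z in D; orthogonality of x - y
    to z gives ip z z = ip (A z) z <= 0, so z = 0 and x = y. *)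
Lemma hilbert_m_dissipative (D : set V) (A : V -> V) :
  D 0 -> (forall c x y, D x -> D y -> D (c *: x + y)) ->
  (forall c x y, D x -> D y -> A (c *: x + y) = c *: A x + A y) ->
  (forall x, D x -> ip (A x) x <= 0) ->
  (forall h f, 0 < h -> exists2 x, D x & x - h%:C *: A x = f) ->
  m_dissipative inorm D A.
Proof.
move=> D0 Dlin Alin Adis Aonto; split => //.
  move=> h x h0 Dx; rewrite -(@ler_pXn2r _ 2)// ?nnegrE ?inorm_ge0//.
  rewrite !inorm_sqr ipBl !ipBr !ipZl !ipZr (ipC iV x).
  have := ip_ge0 iV (A x); have := Adis x Dx => h1 h2.
  have := mulr_ge0 h0 (mulr_ge0 h0 h2); have := mulr_ge0_le0 h0 h1; lra.
move=> y e e0.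
have [||||x [xD xy]] := @riesz_subspace D (ip y) (inorm y).
- exact: D0.
- by move=> a; exact: Dlin.
- by move=> a u v _ _; rewrite ipDr ipZr.
- by move=> u _; exact: cauchy_schwarz.
suff <- : x = y by exact: xD.
have [z Dz zE] := Aonto 1 (x - y) ltr01.
apply/eqP; rewrite -subr_eq0; apply/eqP.
have : ip (x - y) z = 0 by rewrite ipBl xy// subrr.
rewrite -{1}zE scale1r ipBl => h.
have z0 : z = 0.
  by apply: (ip_eq0 iV); have := Adis z Dz; have := ip_ge0 iV z; lra.
have A0 : A 0 = 0.
  have := Alin (-1) 0 0 D0 D0; rewrite scaler0 addr0 scaleN1r addNr.
  by [].
by rewrite -zE z0 A0 scaler0 subrr.
Qed.

End InnerProduct.

(** * Hilbert spaces built from Hilbert spaces *)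

Section SemiInner.
Context {R : realType}.
Local Notation C := R[i].

(** Definiteness is split off because it is lost when an inner product is
    pulled back along a map that is not injective. *)
Record semi_inner (V : lmodType C) (ip : V -> V -> R) : Prop := {
  semiC : forall x y, ip x y = ip y x;
  semiP : forall (a : R) x y z, ip (a%:C *: x + y) z = a * ip x z + ip y z;
  semiI : forall x y, ip ('i *: x) ('i *: y) = ip x y;
  semi_ge0 : forall x, 0 <= ip x x }.

Lemma inner_semi (V : lmodType C) (ip : V -> V -> R) : is_inner ip -> semi_inner ip.
Proof. by case=> *; split. Qed.

Lemma semi_is_inner (V : lmodType C) (ip : V -> V -> R) : semi_inner ip ->
  (forall x, ip x x = 0 -> x = 0) -> is_inner ip.
Proof. by case=> *; split. Qed.

Definition clinear (V W : lmodType C) (J : V -> W) :=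
  forall (c : C) x y, J (c *: x + y) = c *: J x + J y.

Lemma clinear0 (V W : lmodType C) (J : V -> W) : clinear J -> J 0 = 0.
Proof.
by move=> lJ; have := lJ (-1) 0 0; rewrite scaler0 addr0 scaleN1r addNr.
Qed.

Lemma clinearZ (V W : lmodType C) (J : V -> W) c x : clinear J -> J (c *: x) = c *: J x.
Proof. by move=> lJ; have := lJ c x 0; rewrite !addr0 (clinear0 lJ) addr0. Qed.

Lemma clinearB (V W : lmodType C) (J : V -> W) x y : clinear J -> J (x - y) = J x - J y.
Proof. by move=> lJ; have := lJ (-1) y x; rewrite !scaleN1r addrC => ->; rewrite addrC. Qed.

Lemma semi_pull (V W : lmodType C) (ip : W -> W -> R) (J : V -> W) :
  clinear J -> semi_inner ip -> semi_inner (fun x y => ip (J x) (J y)).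
Proof.
move=> lJ si; split=> *.
- exact: semiC si _ _.
- by rewrite lJ semiP.
- by rewrite !(clinearZ _ _ lJ) semiI.
- exact: semi_ge0.
Qed.

Lemma semi_add (V : lmodType C) (ip ip' : V -> V -> R) :
  semi_inner ip -> semi_inner ip' -> semi_inner (fun x y => ip x y + ip' x y).
Proof.
move=> si si'; split=> *.
- by rewrite (semiC si) (semiC si').
- by rewrite (semiP si) (semiP si'); ring.
- by rewrite (semiI si) (semiI si').
- by rewrite addr_ge0 ?(semi_ge0 si) ?(semi_ge0 si').
Qed.

Lemma semi_scale (V : lmodType C) (ip : V -> V -> R) (c : R) :
  0 <= c -> semi_inner ip -> semi_inner (fun x y => c * ip x y).
Proof.
move=> c0 si; split=> *.
- by rewrite (semiC si).
- by rewrite (semiP si); ring.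
- by rewrite (semiI si).
- by rewrite mulr_ge0 ?(semi_ge0 si).
Qed.

Section Complete.
Variables (V : lmodType C) (ip : V -> V -> R).

(** Squared norms avoid square roots when inner products are added. *)
Definition sq_complete := forall x : nat -> V,
  (forall e, 0 < e -> exists N, forall m n, (N <= m)%N -> (N <= n)%N ->
     ip (x m - x n) (x m - x n) < e) ->
  exists l, forall e, 0 < e -> exists N, forall n, (N <= n)%N ->
     ip (x n - l) (x n - l) < e.

Definition hilbert := is_inner ip /\ sq_complete.

Let inorm_lt x (e : R) : 0 < e -> (inorm ip x < e) = (ip x x < e ^+ 2).
Proof.
by move=> e0; rewrite -{1}(ger0_norm (ltW e0)) -sqrtr_sqr ltr_sqrt ?exprn_gt0.
Qed.

Lemma hilbert_banach : hilbert -> banach_norm (inorm ip).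
Proof.
move=> [iV cV]; apply: inorm_banach => // x xC; have [|l hl] := cV x.
  move=> e e0; have := e0; rewrite -sqrtr_gt0 => s0; have [N hN] := xC _ s0.
  exists N => m n Nm Nn; have := hN m n Nm Nn; rewrite inorm_lt// sqr_sqrtr//.
  exact: ltW.
exists l; apply/cvgrPdist_lt => e e0.
have [|N hN] := hl (e ^+ 2); first by rewrite exprn_gt0.
exists N => // n /= /hN h; rewrite sub0r normrN ger0_norm ?inorm_ge0//.
by rewrite inorm_lt.
Qed.

Lemma banach_hilbert : is_inner ip -> banach_norm (inorm ip) -> hilbert.
Proof.
move=> iV bV; split=> // x xC; have [|l /(ncvgP bV) hl] := nrm_complete bV (x := x).
  move=> e e0; have [|N hN] := xC (e ^+ 2); first by rewrite exprn_gt0.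
  by exists N => m n Nm Nn; rewrite inorm_lt//; exact: hN.
exists l => e e0; have := e0; rewrite -sqrtr_gt0 => s0; have [N _ hN] := hl _ s0.
exists N => n Nn; have := hN n Nn; rewrite /= inorm_lt// sqr_sqrtr//.
exact: ltW.
Qed.

Lemma riesz (L : V -> R) (K : R) : hilbert ->
  (forall (a : R) x y, L (a%:C *: x + y) = a * L x + L y) ->
  (forall x, `|L x| <= K * inorm ip x) -> exists x, forall y, ip x y = L y.
Proof.
move=> hV Llin LK; have [iV _] := hV.
have [||||x [_ xP]] := @riesz_subspace _ _ _ iV (hilbert_banach hV) setT L K => //.
by exists x => y; exact: xP.
Qed.

End Complete.

Definition prod_ip (V W : lmodType C) (ip : V -> V -> R) (ip' : W -> W -> R)
  (x y : V * W) : R := ip x.1 y.1 + ip' x.2 y.2.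

Lemma hilbert_prod (V W : lmodType C) (ip : V -> V -> R) (ip' : W -> W -> R) :
  hilbert ip -> hilbert ip' -> hilbert (prod_ip ip ip').
Proof.
move=> [iV cV] [iW cW].
have iVW : is_inner (prod_ip ip ip').
  apply: semi_is_inner.
    apply: semi_add; apply: semi_pull (inner_semi _) => //.
  move=> [x y] /eqP; rewrite paddr_eq0 ?(ip_ge0 iV) ?(ip_ge0 iW)//=.
  by move=> /andP[/eqP/(ip_eq0 iV)-> /eqP/(ip_eq0 iW)->].
split=> // x xC.
have [|l hl] := cV (fun n => (x n).1).
  move=> e /xC[N hN]; exists N => m n Nm Nn; apply: le_lt_trans (hN m n Nm Nn).
  by rewrite /prod_ip /= lerDl (ip_ge0 iW).
have [|l' hl'] := cW (fun n => (x n).2).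
  move=> e /xC[N hN]; exists N => m n Nm Nn; apply: le_lt_trans (hN m n Nm Nn).
  by rewrite /prod_ip /= lerDr (ip_ge0 iV).
exists (l, l') => e e0; have e2 : 0 < e / 2 by rewrite divr_gt0.
have [N hN] := hl _ e2; have [N' hN'] := hl' _ e2.
exists (maxn N N') => n; rewrite geq_max => /andP[/hN h /hN' h'].
by rewrite /prod_ip /= [ltRHS]splitr ltrD.
Qed.

(** Cauchy sequences are transported to the complete space, and the closed
    range brings their limit back. *)
Lemma hilbert_embed (V W : lmodType C) (ip : W -> W -> R) (J : V -> W) :
  clinear J -> (forall x, J x = 0 -> x = 0) -> hilbert ip ->
  (forall (x : nat -> V) l, (forall e, 0 < e -> exists N, forall n, (N <= n)%N ->
     ip (J (x n) - l) (J (x n) - l) < e) -> exists y, J y = l) ->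
  hilbert (fun x y => ip (J x) (J y)).
Proof.
move=> lJ J0 [iW cW] cl; split.
  apply: semi_is_inner; first exact: semi_pull lJ (inner_semi iW).
  by move=> x /(ip_eq0 iW)/J0.
move=> x xC; have [|l hl] := cW (fun n => J (x n)).
  by move=> e /xC[N hN]; exists N => m n Nm Nn; rewrite -clinearB//; exact: hN.
have [y yl] := cl _ _ hl; exists y => e /hl[N hN]; exists N => n /hN.
by rewrite clinearB// yl.
Qed.

Lemma hilbert_equiv (V : lmodType C) (ip ip' : V -> V -> R) (c K : R) :
  hilbert ip -> semi_inner ip' -> 0 < c -> 0 < K ->
  (forall x, c * ip x x <= ip' x x) -> (forall x, ip' x x <= K * ip x x) -> hilbert ip'.
Proof.
move=> [iV cV] si c0 K0 lo up; split.
  apply: semi_is_inner => // x x0; apply: (ip_eq0 iV); apply/eqP.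
  rewrite eq_le (ip_ge0 iV) andbT -(ler_pM2l c0) mulr0 -x0; exact: lo.
move=> x xC; have [|l hl] := cV x.
  move=> e e0; have [|N hN] := xC (c * e); first exact: mulr_gt0.
  exists N => m n Nm Nn; rewrite -(ltr_pM2l c0).
  exact: le_lt_trans (lo _) (hN m n Nm Nn).
exists l => e e0; have [|N hN] := hl (K^-1 * e); first by rewrite mulr_gt0 ?invr_gt0.
exists N => n Nn; apply: le_lt_trans (up _) _.
by rewrite mulrC -ltr_pdivlMr// mulrC; exact: hN.
Qed.

Definition bounded_by (V W : zmodType) (n : V -> R) (m : W -> R) (J : V -> W) :=
  exists2 M, 0 <= M & forall x, m (J x) <= M * n x.

Lemma bounded_by_comp (U V W : zmodType) (n : U -> R) (m : V -> R) (k : W -> R) J J' :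
  bounded_by n m J -> bounded_by m k J' -> bounded_by n k (fun x => J' (J x)).
Proof.
move=> [M M0 hM] [M' M'0 hM']; exists (M' * M) => [|x]; first exact: mulr_ge0.
by apply: le_trans (hM' _) _; rewrite -mulrA ler_wpM2l.
Qed.

Lemma bounded_by_add (V W : zmodType) (n : V -> R) (m : W -> R) J J' :
  (forall x y, m (x + y) <= m x + m y) ->
  bounded_by n m J -> bounded_by n m J' -> bounded_by n m (fun x => J x + J' x).
Proof.
move=> mD [M M0 hM] [M' M'0 hM']; exists (M + M') => [|x]; first exact: addr_ge0.
by apply: le_trans (mD _ _) _; rewrite mulrDl lerD.
Qed.

Lemma bounded_by_opp (V W : zmodType) (n : V -> R) (m : W -> R) J :
  (forall x, m (- x) = m x) -> bounded_by n m J -> bounded_by n m (fun x => - J x).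
Proof. by move=> mN [M M0 hM]; exists M => // x; rewrite mN. Qed.

Lemma bounded_by_sqr (V W : lmodType C) (ip : V -> V -> R) (ip' : W -> W -> R) J :
  semi_inner ip -> semi_inner ip' -> bounded_by (inorm ip) (inorm ip') J ->
  exists2 M, 0 <= M & forall x, ip' (J x) (J x) <= M * ip x x.
Proof.
move=> si si' [M M0 hM]; exists (M ^+ 2) => [|x]; first exact: sqr_ge0.
have := hM x; rewrite -(@ler_pXn2r _ 2)// ?nnegrE ?mulr_ge0 ?sqrtr_ge0//.
by rewrite exprMn !sqr_sqrtr ?(semi_ge0 si) ?(semi_ge0 si').
Qed.

Lemma bounded_by_prod (U : zmodType) (V W : lmodType C) (n : U -> R)
    (ip : V -> V -> R) (ip' : W -> W -> R) (J : U -> V * W) :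
  semi_inner ip -> semi_inner ip' ->
  bounded_by n (inorm ip) (fun x => (J x).1) ->
  bounded_by n (inorm ip') (fun x => (J x).2) ->
  bounded_by n (inorm (prod_ip ip ip')) J.
Proof.
move=> si si' [M M0 hM] [N N0 hN]; exists (M + N) => [|x]; first exact: addr_ge0.
rewrite mulrDl; apply: le_trans (lerD (hM x) (hN x)).
have a0 := semi_ge0 si (J x).1; have b0 := semi_ge0 si' (J x).2.
rewrite /inorm /prod_ip; move: (ip _ _) (ip' _ _) a0 b0 => a b a0 b0.
have p0 := sqrtr_ge0 a; have q0 := sqrtr_ge0 b.
rewrite -(@ler_pXn2r _ 2)// ?nnegrE ?sqrtr_ge0 ?addr_ge0//.
rewrite sqrrD !sqr_sqrtr ?addr_ge0//.
by have := mulr_ge0 p0 q0; lra.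
Qed.

Definition abs (z : C) : R := complex.Re `|z|.

Lemma absD x y : abs (x + y) <= abs x + abs y.
Proof.
have := ler_normD x y; rewrite /abs !normc_def -rmorphD lecE /=.
by move=> /andP[].
Qed.

Lemma absN x : abs (- x) = abs x.
Proof. by rewrite /abs normrN. Qed.

Lemma abs_eq0 x : abs x <= 0 -> x = 0.
Proof.
case: x => r s; rewrite /abs normc_def /= leNgt sqrtr_gt0 -leNgt => h.
have := sqr_ge0 r; have := sqr_ge0 s => s0 r0.
have /eqP -> : r == 0 by rewrite -sqrf_eq0 eq_le r0 andbT; lra.
by have /eqP -> : s == 0 by rewrite -sqrf_eq0 eq_le s0 andbT; lra.
Qed.

(** The imaginary part of an antilinear form is its real part at a multiple
    of x by i, up to sign. *)
Lemma complex_form_eq (V : lmodType C) (P : V -> C) (Q : V -> C) :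
  (forall x, P ('i *: x) = - 'i * P x) -> (forall x, Q ('i *: x) = - 'i * Q x) ->
  (forall x, complex.Re (P x) = complex.Re (Q x)) -> forall x, P x = Q x.
Proof.
move=> Pi Qi PQ x; have := PQ ('i *: x); rewrite Pi Qi.
have := PQ x; case: (P x) (Q x) => p p' [q q'] /= -> .
by rewrite !mulNr !mul0r !mul1r !oppr0 !sub0r !opprK /= => E; congr (_ +i* _).
Qed.

End SemiInner.

(** * Smooth bump functions *)

Section Smooth.
Context {R : realType}.
Implicit Types f g : R -> R.

Definition smooth f := forall k x, derivable (derive1n k f) x 1.

(** n-fold differentiability by recursion on the derivative: the shape that
    suits induction for products and compositions. *)
Fixpoint diffn (n : nat) f : Prop :=
  (forall x, derivable f x 1) /\ (if n is m.+1 then diffn m (derive1 f) else True).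

Lemma smoothP f : smooth f <-> forall n, diffn n f.
Proof.
split=> [sf n|sf k x].
  elim: n f sf => [|n IH] f sf /=; first by split=> // x; exact: (sf 0%N x).
  split=> [x|]; first exact: (sf 0%N x).
  by apply: IH => k x; rewrite -derive1Sn; exact: sf.
elim: k f sf => [|k IH] f sf; first by case: (sf 0%N) => + _; exact.
by rewrite derive1Sn; apply: IH => n; case: (sf n.+1).
Qed.

Lemma diffn_derivable n f (x : R) : diffn n f -> derivable f x 1.
Proof. by case: n => [|n] [+ _]; exact. Qed.

Arguments diffn_derivable [n f] x _.

Lemma diffnW n f : diffn n.+1 f -> diffn n f.
Proof.
elim: n f => [|n IH] f [df d2f]; split=> //.
by apply: IH; exact: d2f.
Qed.

Lemma diffn_intro (n : nat) f (f' : R -> R) : (forall x : R, is_derive x 1 f (f' x)) -> diffn n f' ->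
  diffn n.+1 f.
Proof.
move=> ff' nf'; split=> [x|]; first by have [] := ff' x.
suff -> : derive1 f = f' by [].
by apply/funext => x; rewrite derive1E; exact: derive_val.
Qed.

Lemma derive1_is_derive f (x : R) : derivable f x 1 -> is_derive x 1 f (derive1 f x).
Proof. by move=> df; apply: DeriveDef => //; rewrite derive1E. Qed.

Lemma diffn_lin n (c : R) f g : diffn n f -> diffn n g ->
  diffn n (fun x => c * f x + g x).
Proof.
elim: n f g => [|n IH] f g fn gn.
  split=> // x.
  exact: (derivableD (derivableZ (k := c) (diffn_derivable x fn))
                     (diffn_derivable x gn)).
have df x := derive1_is_derive (diffn_derivable x fn).
have dg x := derive1_is_derive (diffn_derivable x gn).
apply: (@diffn_intro _ _ (fun x => c * derive1 f x + derive1 g x)).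
by apply: IH; [case: fn|case: gn].
Qed.

Lemma diffnM n f g : diffn n f -> diffn n g -> diffn n (fun x => f x * g x).
Proof.
elim: n f g => [|n IH] f g fn gn.
  split=> // x.
  exact: (derivableM (diffn_derivable x fn) (diffn_derivable x gn)).
have df x := derive1_is_derive (diffn_derivable x fn).
have dg x := derive1_is_derive (diffn_derivable x gn).
apply: (@diffn_intro _ _ (fun x => 1 * (f x * derive1 g x) + g x * derive1 f x)).
  by move=> x; rewrite mul1r; exact: (is_deriveM (df x) (dg x)).
apply: diffn_lin; apply: IH; do ?exact: diffnW.
- by case: gn.
- by case: fn.
Qed.

Lemma is_derive_affine (c d x : R) : is_derive x 1 (fun y => c * y + d) c.
Proof.
have := is_deriveD (is_deriveZ c (is_derive_id x 1)) (is_derive_cst d x 1).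
by rewrite addr0 /GRing.scale/= mulr1.
Qed.

Lemma diffn_affine n f (c d : R) : diffn n f -> diffn n (fun x => f (c * x + d)).
Proof.
elim: n f => [|n IH] f fn.
  split=> // x; have [] // := @is_derive1_comp _ f (fun y => c * y + d) x _ c
    (derive1_is_derive (diffn_derivable (c * x + d) fn)) (is_derive_affine c d x).
have df x := derive1_is_derive (diffn_derivable x fn).
apply: (@diffn_intro _ _ (fun x => c * derive1 f (c * x + d) + 0)).
  move=> x; rewrite addr0 mulrC.
  exact: (@is_derive1_comp _ f (fun y => c * y + d) x _ c (df _) (is_derive_affine c d x)).
have cst0 m : diffn m (fun=> 0 : R).
  elim: m => [|m IHm]; first by split=> // x; exact: derivable_cst.
  by apply: (@diffn_intro _ _ (fun=> 0)) => // x; exact: is_derive_cst.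
by apply: diffn_lin => //; apply: IH; case: fn.
Qed.

(** The family x^-m exp(-1/x), extended by 0 to the left, is closed under
    differentiation up to linear combinations. *)
Definition flat (m : nat) (x : R) : R :=
  if x <= 0 then 0 else x^-1 ^+ m * expR (- x^-1).

Lemma flat_ge0 m x : 0 <= flat m x.
Proof.
rewrite /flat; case: (leP x 0) => // x0.
by rewrite mulr_ge0 ?expR_ge0// exprn_ge0// invr_ge0 ltW.
Qed.

(** The factor x^2, responsible for the vanishing derivative at 0, comes from
    one term of the exponential series at 1/x. *)
Lemma flat_le m x : flat m x <= m.+2`!%:R * x ^+ 2.
Proof.
rewrite /flat; case: (leP x 0) => x0; first by rewrite mulr_ge0// sqr_ge0.
have xi0 : 0 < x^-1 by rewrite invr_gt0.
have := expR_ge1Dxn m.+1 (ltW xi0) => h.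
have F0 : 0 < m.+2`!%:R :> R by rewrite ltr0n fact_gt0.
have : (x^-1) ^+ m.+2 <= m.+2`!%:R * expR x^-1.
  by rewrite mulrC -ler_pdivrMr//; lra.
move=> {}h; rewrite expRN ler_pdivrMr ?expR_gt0//.
have xx : x^-1 ^+ 2 * x ^+ 2 = 1 by rewrite -exprMn mulVf ?gt_eqF// expr1n.
have -> : x^-1 ^+ m = x^-1 ^+ m.+2 * x ^+ 2 by rewrite -addn2 exprD -mulrA xx mulr1.
by rewrite [leRHS]mulrAC ler_wpM2r ?sqr_ge0.
Qed.

Lemma is_derive_flat m (x : R) :
  is_derive x 1 (flat m) (- m%:R * flat m.+1 x + flat m.+2 x).
Proof.
have [x0|x0|->] := ltgtP x 0.
- have -> : - m%:R * flat m.+1 x + flat m.+2 x = 0.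
    by rewrite /flat ltW// mulr0 addr0.
  apply: (near_eq_is_derive _ (is_derive_cst (0 : R) x 1)).
  near=> y; rewrite /flat ltW//; near: y; exact: lt_nbhsl.
- pose h (y : R) := (y^-1) ^+ m * expR (- y^-1).
  have hE : \forall y \near x, h y = flat m y.
    near=> y; rewrite /flat leNgt; suff -> : 0 < y by [].
    by near: y; exact: lt_nbhsr.
  apply: (near_eq_is_derive hE).
  have dV : is_derive x 1 (fun y : R => y^-1) (- x ^- 2).
    have := is_deriveV (lt0r_neq0 x0) (is_derive_id x 1).
    by rewrite /GRing.scale/= mulr1.
  have := is_deriveM (is_deriveX m dV) (is_derive1_comp (is_derive_expR _) (is_deriveN dV)).
  rewrite (_ : _ ^+ m * _ = h); last by apply/funext => y; rewrite /h !fctE.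
  move=> H; apply: (is_derive_eq H); rewrite !fctE /flat leNgt x0/= /GRing.scale/=.
  rewrite -exprVn; case: m {h hE H} => [|m] /=; rewrite !exprS ?expr0; by ring.
- have -> : - m%:R * flat m.+1 0 + flat m.+2 0 = 0.
    by rewrite /flat lexx mulr0 addr0.
  have h : h^-1 *: ((flat m \o shift 0) (h *: (1 : R)) - flat m 0) @[h --> (0:R)^'] --> (0 : R).
    apply/cvgrPdist_lt => e e0.
    have F0 : 0 < m.+2`!%:R :> R by rewrite ltr0n fact_gt0.
    have d0 : 0 < e / m.+2`!%:R by rewrite divr_gt0.
    near=> h; have h0 : h != 0 by near: h; exact: nbhs_dnbhs_neq.
    have hd : `|h| < e / m.+2`!%:R.
      by near: h; apply: dnbhs0_lt.
    rewrite /= [_ *: 1]mulr1 sub0r normrN addr0 /flat lexx subr0 -/(flat m h) normrM normfV.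
    rewrite (ger0_norm (flat_ge0 m h)) mulrC ltr_pdivrMr ?normr_gt0//.
    apply: le_lt_trans (flat_le m h) _.
    by rewrite -(real_normK (num_real h)) expr2 mulrA ltr_pM2r ?normr_gt0// mulrC -ltr_pdivlMr.
  apply: DeriveDef; first by apply/cvg_ex; exists 0.
  exact/cvg_lim.
Unshelve. all: by end_near. Qed.

Lemma smooth_flat m : smooth (flat m).
Proof.
apply/smoothP => n; elim: n m => [|n IH] m.
  by split=> // x; have [] := is_derive_flat m x.
apply: diffn_intro (is_derive_flat m) _.
by apply: diffn_lin; exact: IH.
Qed.

Lemma smooth_derive1n f k : smooth f -> smooth (derive1n k f).
Proof.
by move=> sf j x; rewrite /derive1n -iterD; exact: (sf (j + k)%N x).
Qed.

Lemma smooth_derivable f x : smooth f -> derivable f x 1.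
Proof. by move=> sf; exact: (sf 0%N x). Qed.

Lemma smooth_continuous f : smooth f -> continuous f.
Proof.
by move=> sf x; apply/differentiable_continuous/derivable1_diffP/smooth_derivable.
Qed.

Lemma smooth_intro f (f' : R -> R) : (forall x : R, is_derive x 1 f (f' x)) -> smooth f' -> smooth f.
Proof.
move=> ff' /smoothP sf'; apply/smoothP => n; apply: diffnW.
exact: diffn_intro ff' (sf' n).
Qed.

Lemma smooth_lin c f g : smooth f -> smooth g -> smooth (fun x => c * f x + g x).
Proof. by move=> /smoothP sf /smoothP sg; apply/smoothP => n; exact: diffn_lin. Qed.

(** The dilation by n + 1 makes these functions tend pointwise to the
    indicator of the open interval. *)
Definition bump (c d : R) (n : nat) (x : R) : R :=
  flat 0 (n.+1%:R * (x - c)) * flat 0 (n.+1%:R * (d - x)).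

Lemma smooth_bump c d n : smooth (bump c d n).
Proof.
have -> : bump c d n = fun x => flat 0 (n.+1%:R * x + - (n.+1%:R * c)) *
    flat 0 (- n.+1%:R * x + n.+1%:R * d).
  by apply/funext => x; rewrite /bump; congr (flat 0 _ * flat 0 _); ring.
apply/smoothP => k; have F0 := (smoothP _).1 (@smooth_flat 0) k.
exact: diffnM (diffn_affine n.+1%:R (- (n.+1%:R * c)) F0)
  (diffn_affine (- n.+1%:R) (n.+1%:R * d) F0).
Qed.

Lemma flat_le0 m x : x <= 0 -> flat m x = 0.
Proof. by rewrite /flat => ->. Qed.

Lemma flat0_le1 x : flat 0 x <= 1.
Proof.
rewrite /flat; case: (leP x 0) => // x0; rewrite expr0 mul1r -expR0 ler_expR.
by rewrite oppr_le0 invr_ge0 ltW.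
Qed.

Lemma bump_ge0 c d n x : 0 <= bump c d n x.
Proof. by rewrite mulr_ge0 ?flat_ge0. Qed.

Lemma bump_le1 c d n x : bump c d n x <= 1.
Proof. by rewrite mulr_ile1 ?flat_ge0 ?flat0_le1. Qed.

Lemma bump_out c d n x : ~~ (c < x < d) -> bump c d n x = 0.
Proof.
rewrite negb_and -!leNgt /bump => /orP[xc|dx].
  by rewrite flat_le0 ?mul0r// pmulr_rle0// subr_le0.
by rewrite [X in _ * X]flat_le0 ?mulr0// pmulr_rle0// subr_le0.
Qed.

Lemma bump_cvg c d x :
  bump c d n x @[n --> \oo] --> (((c < x < d)%R)%:R : R).
Proof.
have [|xcd] := boolP (c < x < d); last first.
  by under eq_fun do rewrite bump_out//; exact: cvg_cst.
move=> /andP[cx xd].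
have flat_cvg (y : R) : 0 < y -> flat 0 (n.+1%:R * y) @[n --> \oo] --> (1 : R).
  move=> y0; rewrite /flat.
  have -> : (fun n => if n.+1%:R * y <= 0 then 0 else (n.+1%:R * y)^-1 ^+ 0 * expR (- (n.+1%:R * y)^-1)) =
      (fun n => expR (- (harmonic n * y^-1))).
    apply/funext => n; rewrite leNgt pmulr_rgt0// y0/= expr0 mul1r.
    by rewrite invfM.
  rewrite -[X in _ --> X](@expR0 R) -[X in expR X]oppr0 -(mul0r (y^-1)).
  apply: continuous_cvg; first exact: continuous_expR.
  by apply: cvgN; apply: cvgMl; exact: cvg_harmonic.
rewrite -[X in _ --> X](mulr1 (1 : R)).
by apply: cvgM; apply: flat_cvg; rewrite subr_gt0.
Qed.

Lemma test_fun_bump a b c d n : a < c -> d < b -> test_fun a b (bump c d n).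
Proof.
move=> ac db; split; first exact: smooth_bump.
exists c, d; split=> // x; rewrite in_itv/= => xcd; apply: bump_out.
by apply: contra xcd => /andP[/ltW -> /ltW ->].
Qed.

End Smooth.

(** * Real square-integrable functions *)

Section SquareIntegrable.
Context {d : measure_display} {T : measurableType d} {R : realType}.
Variable mu : {measure set T -> \bar R}.
Hypothesis mufin : mu setT \is a fin_num.
Implicit Types f g h : T -> R.

Definition sqi f := f \in Lfun mu 2%:E.
Local Notation I h := (\int[mu]_x h x).
Local Notation integr h := (mu.-integrable setT (EFin \o h)).

Lemma sqi_meas f : sqi f -> measurable_fun setT f.
Proof. by move=> /sub_Lfun_mfun; rewrite inE. Qed.

Lemma sqiM f g : sqi f -> sqi g -> integr (fun x => f x * g x).
Proof. by move=> sf sg; apply/Lfun1_integrable; exact: Lfun2_mul_Lfun1. Qed.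

Lemma sqi_integr f : sqi f -> integr f.
Proof. by move=> sf; apply/Lfun1_integrable; exact: Lfun_subset12. Qed.

Lemma sqi_lin c f g : sqi f -> sqi g -> sqi (fun x => c * f x + g x).
Proof.
have p1 : (1 <= 2%:E :> \bar R)%E by rewrite lee_fin ler1n.
by move=> sf sg; exact: (Lfun_submod_closed mu p1).2.
Qed.

Lemma sqiP f : measurable_fun setT f -> integr (fun x => f x ^+ 2) -> sqi f.
Proof.
move=> mf i2; rewrite /sqi inE; apply/andP; split; rewrite inE//=.
rewrite /finite_norm unlock /= poweR_lty//.
have /integrableP[_] := i2; congr (_ < _)%E; apply: eq_integral => x _ /=.
by rewrite powR_mulrn// real_normK ?num_real// ger0_norm ?sqr_ge0.
Qed.

Lemma sqi_bounded f g M : sqi f -> measurable_fun setT g ->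
  (forall x, `|g x| <= M) -> sqi (fun x => f x * g x).
Proof.
move=> sf mg gM; apply: sqiP.
  by apply: measurable_funM => //; exact: sqi_meas.
have i2 := integrableZl measurableT (M ^+ 2) (sqiM sf sf).
apply: le_integrable i2 => //.
  apply/measurable_EFinP; apply: measurable_funX; apply: measurable_funM => //.
  exact: sqi_meas.
move=> x _; rewrite /= lee_fin -(expr2 (f x)).
rewrite exprMn !ger0_norm ?(mulr_ge0 (sqr_ge0 _) (sqr_ge0 _))// mulrC ler_wpM2r ?sqr_ge0// -[g x ^+ 2]real_normK ?num_real//.
by rewrite ler_pXn2r ?nnegrE// (le_trans _ (gM x)).
Qed.

Lemma sqi_bounded1 g M : measurable_fun setT g -> (forall x, `|g x| <= M) -> sqi g.
Proof.
move=> mg gM; apply: sqiP => //.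
apply: measurable_bounded_integrable => //.
- by rewrite ltey_eq mufin.
- exact: measurable_funX.
exists (M ^+ 2); split; first exact: num_real.
move=> y My x _ /=; apply: le_trans (ltW My).
by rewrite normrX ler_pXn2r ?nnegrE// (le_trans _ (gM x)).
Qed.

Lemma integr_lin c f g : integr f -> integr g -> integr (fun x => c * f x + g x).
Proof.
move=> fi gi; have := integrableD measurableT (integrableZl measurableT c fi) gi.
exact: eq_integrable.
Qed.

Lemma I_lin c f g : integr f -> integr g ->
  I (fun x => c * f x + g x) = c * I f + I g.
Proof.
move=> fi gi; rewrite RintegralD ?RintegralZl//.
by have := integrableZl measurableT c fi; exact: eq_integrable.
Qed.

Lemma I_ge0 f : (forall x, 0 <= f x) -> 0 <= I f.
Proof. by move=> f0; apply: Rintegral_ge0. Qed.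

Lemma I_ae f g : measurable_fun setT f -> measurable_fun setT g ->
  {ae mu, forall x, f x = g x} -> I f = I g.
Proof.
move=> mf mg fg; congr fine; apply: ae_eq_integral => //.
- exact/measurable_EFinP.
- exact/measurable_EFinP.
have F := ae_filter_ringOfSetsType mu.
by apply: filterS fg => x -> _.
Qed.

Lemma I_cs f g : sqi f -> sqi g ->
  I (fun x => f x * g x) ^+ 2 <= I (fun x => f x ^+ 2) * I (fun x => g x ^+ 2).
Proof.
move=> sf sg; apply: discriminant_le => [|s]; first by apply: I_ge0 => x; rewrite sqr_ge0.
have fg := sqiM sf sg; have ff := sqiM sf sf; have gg := sqiM sg sg.
have : 0 <= I (fun x => (f x + s * g x) ^+ 2) by apply: I_ge0 => x; rewrite sqr_ge0.
have -> : (fun x => (f x + s * g x) ^+ 2) =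
    (fun x => s ^+ 2 * (g x * g x) + ((s *+ 2) * (f x * g x) + f x * f x)).
  by apply/funext => x; ring.
rewrite I_lin// ?I_lin//; last exact: integr_lin.
have sqE h : (fun x => h x * h x) = (fun x => h x ^+ 2).
  by apply/funext => x; rewrite expr2.
by rewrite !sqE; lra.
Qed.

Lemma I_sq_eq0 f : sqi f -> I (fun x => f x ^+ 2) = 0 -> {ae mu, forall x, f x = 0}.
Proof.
move=> sf f0; have mf := sqi_meas sf.
have F := ae_filter_ringOfSetsType mu.
have m2 : measurable_fun setT (fun x => f x ^+ 2) by exact: measurable_funX.
have i2 : integr (fun x => f x ^+ 2).
  by have := sqiM sf sf; apply: eq_integrable => // x _ /=; rewrite expr2.
have : ae_eq mu setT (EFin \o (fun x => f x ^+ 2)) (cst 0%E).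
  apply/(ae_eq_integral_abs _ measurableT); first exact/measurable_EFinP.
  have <- : (\int[mu]_x ((f x ^+ 2)%:E) = 0)%E.
    by rewrite -[LHS]fineK; [congr EFin|exact: integrable_fin_num i2].
  by apply: eq_integral => x _ /=; rewrite ger0_norm ?sqr_ge0.
apply: filterS => x /(_ Logic.I) /= [] /eqP.
by rewrite sqrf_eq0 => /eqP.
Qed.

(** The crude constant I 1 + 1 avoids a square root. *)
Lemma I_norm_le f (c : R) : sqi f -> 0 <= c -> I (fun x => f x ^+ 2) <= c ^+ 2 ->
  I (fun x => `|f x|) <= c * (I (cst 1) + 1).
Proof.
move=> sf c0 fc.
have sn : sqi (fun x => `|f x|).
  apply: sqiP; first by apply: measurableT_comp => //; exact: sqi_meas.
  have := sqiM sf sf; apply: eq_integrable => // x _ /=.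
  by rewrite real_normK ?num_real.
have s1 : sqi (cst (1 : R)) by apply: (@sqi_bounded1 _ 1) => // x /=; rewrite normr1.
have := I_cs sn s1.
have -> : (fun x => `|f x| * cst 1 x) = (fun x => `|f x|) by apply/funext => x; rewrite mulr1.
have -> : (fun x => `|f x| ^+ 2) = (fun x => f x ^+ 2).
  by apply/funext => x; rewrite real_normK ?num_real.
have -> : (fun x => cst 1 x ^+ 2) = (cst 1 : T -> R) by apply/funext => x; rewrite /= expr1n.
have m0 : 0 <= I (cst 1) by apply: I_ge0 => x /=.
have f0 : 0 <= I (fun x => `|f x|) by apply: I_ge0.
move=> h; rewrite -(@ler_pXn2r _ 2)// ?nnegrE; last by rewrite mulr_ge0//; lra.
apply: le_trans h _; rewrite exprMn; apply: ler_pM => //.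
  by apply: I_ge0 => x; rewrite sqr_ge0.
by rewrite sqrrD expr1n; have := sqr_ge0 (I (cst 1)); lra.
Qed.

Lemma limn_einf_le (u : (\bar R)^nat) (c : \bar R) :
  (forall n, (u n <= c)%E) -> (limn_einf u <= c)%E.
Proof.
move=> uc; rewrite limn_einf_lim; apply: lime_le; first exact: is_cvg_einfs.
apply: nearW => n; apply: le_trans (uc n).
by apply: ereal_inf_lbound; exists n => //=.
Qed.

Lemma cvg_of_series (u : R^nat) :
  (\sum_(0 <= k <oo) (`|u k.+1 - u k|)%:E)%E \is a fin_num -> cvgn u.
Proof.
move=> fin; have : cvgn (series (telescope u)).
  apply: normed_cvg; apply: nondecreasing_is_cvgn.
    by apply: nondecreasing_series => n _ _; exact: normr_ge0.
  exists (fine (\sum_(0 <= k <oo) (`|u k.+1 - u k|)%:E)%E) => _ [n _ <-].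
  rewrite -lee_fin fineK// /series/= -sumEFin.
  by apply: nneseries_lim_ge => k _ _; rewrite lee_fin.
rewrite telescopeK => cu.
have -> : u = (fun n => (u n - u 0%N) + u 0%N) by apply/funext => n; rewrite subrK.
by apply: is_cvgD => //; exact: is_cvg_cst.
Qed.

(** Riesz-Fischer: a subsequence with geometrically small increments
    converges almost everywhere, because the sum of the increments is
    integrable, and the Fatou lemma turns this into convergence in mean
    square. *)
Lemma sqi_complete (f : nat -> T -> R) : (forall n, sqi (f n)) ->
  (forall e, 0 < e -> exists N, forall m n, (N <= m)%N -> (N <= n)%N ->
     I (fun x => (f m x - f n x) ^+ 2) < e) ->
  exists g, sqi g /\ forall e, 0 < e -> exists N, forall n, (N <= n)%N ->
     I (fun x => (f n x - g x) ^+ 2) <= e.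
Proof.
move=> sf fC.
have sB u v : sqi u -> sqi v -> sqi (fun x => u x - v x).
  move=> su sv; have := sqi_lin (-1) sv su; congr sqi; apply/funext => x.
  by rewrite mulN1r addrC.
pose r k : R := 1 / (2 ^ (k + 1))%:R.
have r0 k : 0 < r k by rewrite divr_gt0// ltr0n expn_gt0.
have /choice[M MP] : forall k, exists N, forall m n, (N <= m)%N -> (N <= n)%N ->
     I (fun x => (f m x - f n x) ^+ 2) < r k ^+ 2.
  by move=> k; apply: fC; rewrite exprn_gt0.
pose s := fix s k := if k is j.+1 then maxn (s j) (M k) else M 0%N.
have sM k : (M k <= s k)%N by case: k => // k /=; rewrite leq_maxr.
have sS k : (s k <= s k.+1)%N by rewrite leq_maxl.
have s_le j k : (s j <= s (k + j))%N.
  by elim: k => // k IH; apply: leq_trans IH (sS _).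
pose C := I (cst 1) + 1.
have hI k : (\int[mu]_x `|f (s k.+1) x - f (s k) x|%:E <= (C / (2 ^ (k + 1))%:R)%:E)%E.
  have sh := sB _ _ (sf (s k.+1)) (sf (s k)).
  have ni : integr (fun x => `|f (s k.+1) x - f (s k) x|).
    exact: integrable_norm (sqi_integr sh).
  rewrite -[leLHS]fineK; last exact: integrable_fin_num ni.
  have := @I_norm_le _ (r k) sh (ltW (r0 k)) _; rewrite /r mul1r mulrC lee_fin; apply.
  rewrite -[(_)^-1]mul1r; apply: ltW; apply: MP => //.
  by apply: leq_trans (sM k) (sS k).
pose G x := (\sum_(0 <= k <oo) (`|f (s k.+1) x - f (s k) x|)%:E)%E.
have mh k : measurable_fun setT (fun x => (`|f (s k.+1) x - f (s k) x|)%:E).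
  apply/measurable_EFinP; apply: measurableT_comp => //.
  by apply: measurable_funB; exact: sqi_meas.
have iG : mu.-integrable setT G.
  apply/integrableP; split.
    by apply: ge0_emeasurable_sum => // k x _ _; rewrite lee_fin.
  rewrite (eq_integral G); last first.
    by move=> x _; rewrite gee0_abs//; apply: nneseries_ge0 => k _ _; rewrite lee_fin.
  rewrite integral_nneseries//.
  have geo := @cvg_geometric_eseries_half _ C 0.
  apply: (@le_lt_trans _ _ (\sum_(0 <= k <oo) (C / (2 ^ (k + 1))%:R)%:E)%E).
    by apply: lee_nneseries => k *; [apply: integral_ge0 => x _; rewrite lee_fin|exact: hI].
  by rewrite (cvg_lim _ geo)//; exact: ltry.
(* the upper limit is measurable and equals the limit almost everywhere *)
pose g x := fine (limn_esup (fun k => (f (s k) x)%:E)).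
have mg : measurable_fun setT g.
  apply: measurableT_comp => //; apply: measurable_fun_limn_esup => k.
  exact/measurable_EFinP/sqi_meas.
have F := ae_filter_ringOfSetsType mu.
have fg : {ae mu, forall x, f (s k) x @[k --> \oo] --> g x}.
  apply: filterS (integrable_ae measurableT iG) => x /(_ Logic.I) Gx.
  have /cvg_ex[/= l fl] := cvg_of_series Gx.
  have Efl : (f (s k) x)%:E @[k --> \oo] --> l%:E by apply: cvg_EFin => //; exact: nearW.
  by rewrite /g (cvg_limn_einf_sup Efl).2.
have key j n : (M j <= n)%N ->
    (\int[mu]_x ((f n x - g x) ^+ 2)%:E <= (r j ^+ 2)%:E)%E.
  move=> jn.
  have mf2 k : measurable_fun setT (fun x => ((f n x - f (s (k + j)) x) ^+ 2)%:E).
    apply/measurable_EFinP; apply: measurable_funX; apply: measurable_funB; exact: sqi_meas.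
  have := fatou mu measurableT mf2 (fun k x _ => _).
  have -> : (\int[mu]_x limn_einf (fun k => ((f n x - f (s (k + j)) x) ^+ 2)%:E) =
      \int[mu]_x ((f n x - g x) ^+ 2)%:E)%E.
    apply: ae_eq_integral => //.
    - under [X in measurable_fun _ X]eq_fun do rewrite -[limn_einf _]oppeK -limn_esupN.
      apply: measurableT_comp => //; apply: measurable_fun_limn_esup => k.
      by apply: measurableT_comp => //; exact: mf2.
    - apply/measurable_EFinP; apply: measurable_funX; apply: measurable_funB => //; exact: sqi_meas.
    apply: filterS fg => x fx _.
    have cv : ((f n x - f (s (k + j)) x) ^+ 2)%:E @[k --> \oo] --> ((f n x - g x) ^+ 2)%:E.
      apply: cvg_EFin; first exact: nearW.
      have c1 : f (s (k + j)) x @[k --> \oo] --> g x.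
        by have := cvg_shiftn j (fun k => f (s k) x) (nbhs (g x)) => ->.
      have c2 : f n x - f (s (k + j)) x @[k --> \oo] --> f n x - g x.
        by apply: cvgB => //; exact: cvg_cst.
      exact: (cvgM c2 c2).
    by rewrite (cvg_limn_einf_sup cv).1.
  move=> h; apply: le_trans (h _) _; first by move=> *; rewrite lee_fin sqr_ge0.
  apply: limn_einf_le => k.
  have sh := sB _ _ (sf n) (sf (s (k + j))).
  rewrite -[leLHS]fineK.
    rewrite lee_fin; apply: ltW; apply: MP => //.
    exact: leq_trans (sM j) (s_le _ _).
  apply: integrable_fin_num => //.
  by have := sqiM sh sh; apply: eq_integrable => // x _ /=; rewrite expr2.
have sg : sqi g.
  have : sqi (fun x => f (M 0%N) x - g x).
    apply: sqiP; first by apply: measurable_funB => //; exact: sqi_meas.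
    apply/integrableP; split.
      apply/measurable_EFinP; apply: measurable_funX; apply: measurable_funB => //; exact: sqi_meas.
    apply: le_lt_trans (ltry (r 0%N ^+ 2)); apply: le_trans (key 0%N (M 0%N) (leqnn _)).
    by rewrite le_eqVlt; apply/orP; left; apply/eqP; apply: eq_integral => x _ /=; rewrite ger0_norm ?sqr_ge0.
  move=> h; have := sB _ _ (sf (M 0%N)) h; congr sqi; apply/funext => x.
  by rewrite subKr.
exists g; split=> // e e0.
have [j rj] : exists j, r j ^+ 2 <= e.
  have : r j ^+ 2 @[j --> \oo] --> (0 : R).
    have rE : r = fun j => geometric 2^-1 2^-1 j.
      by apply/funext => j; rewrite /r /geometric/= mul1r natrX exprD expr1 invfM exprVn mulrC.
    have r_0 : r j @[j --> \oo] --> (0 : R).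
      rewrite rE; apply: cvg_geometric; rewrite ger0_norm ?invr_ge0//.
      by rewrite invf_lt1// ltr1n.
    by have := cvgM r_0 r_0; rewrite mulr0; exact.
  move=> /cvgrPdist_le /(_ e e0) [j _ /(_ j)]; rewrite /= leqnn => /(_ isT).
  by rewrite sub0r normrN => h; exists j; apply: le_trans h; exact: ler_norm.
exists (M j) => n jn; apply: le_trans rj; rewrite -lee_fin fineK; first exact: key.
have sh := sB _ _ (sf n) sg.
apply: integrable_fin_num => //.
by have := sqiM sh sh; apply: eq_integrable => // x _ /=; rewrite expr2.
Qed.

End SquareIntegrable.

(** * Weak derivatives and primitives on an interval *)

Section Interval.
Context {R : realType}.
Variables a b : R.
Implicit Types (f g h phi : R -> R).
Local Notation mu := (leb a b).
Local Notation lam := (@lebesgue_measure R).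
Local Notation I h := (\int[mu]_x h x).

Lemma leb_setT_fin : mu setT \is a fin_num.
Proof.
have -> : mu setT = lam `]a, b[ by rewrite /leb /= /mrestr setTI.
rewrite ge0_fin_numE ?measure_ge0// lebesgue_measure_itv/=.
by case: ifP => _; rewrite ?ltry// -EFinB ltry.
Qed.

(** Gives access to the fundamental theorem of calculus, available for
    integrals over intervals. *)
Lemma leb_integral (f : R -> \bar R) : measurable_fun setT f ->
  (\int[mu]_x f x = \int[lam]_(x in `]a, b[) f x)%E.
Proof.
move=> mf.
have ge0 (h : R -> \bar R) : measurable_fun setT h -> (forall x, 0 <= h x)%E ->
    (\int[mu]_x h x = \int[lam]_(x in `]a, b[) h x)%E.
  move=> mh h0; rewrite (@ge0_negligible_integral _ _ _ mu setT (~` `]a, b[))//.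
  - rewrite setTD setCK; apply: eq_measure_integral => A mA Aab.
    by rewrite /leb/= /mrestr setIidl.
  - exact: measurableC.
  - by rewrite /leb/= /mrestr setICl measure0.
rewrite integralE [RHS]integralE !ge0//.
- exact: measurable_funeneg.
- exact: measurable_funepos.
Qed.

Lemma leb_Rintegral f : measurable_fun setT f ->
  I f = \int[lam]_(x in `]a, b[) f x.
Proof.
by move=> mf; congr fine; apply: leb_integral; exact/measurable_EFinP.
Qed.

Lemma leb_integrable f : measurable_fun setT f ->
  mu.-integrable setT (EFin \o f) <-> lam.-integrable `]a, b[ (EFin \o f).
Proof.
move=> mf; have mf' : measurable_fun setT (EFin \o f) by exact/measurable_EFinP.
have E : (\int[mu]_x `|(EFin \o f) x| = \int[lam]_(x in `]a, b[) `|(EFin \o f) x|)%E.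
  by apply: leb_integral; exact: measurableT_comp.
split=> /integrableP[_ fi]; apply/integrableP; split => //.
- by apply: measurable_funTS.
- by rewrite -E.
- by rewrite E.
Qed.

Lemma ae_leb (P : R -> Prop) :
  {ae mu, forall x, P x} <-> {ae lam, forall x, a < x < b -> P x}.
Proof.
split=> [[N [mN N0 PN]]|[N [mN N0 PN]]].
  exists (N `&` `]a, b[); split => //; first exact: measurableI.
  by move=> x /= /not_implyP[xab nP]; split; [exact: PN|rewrite /= in_itv].
exists (N `|` ~` `]a, b[); split.
- by apply: measurableU => //; exact: measurableC.
- rewrite /leb/= /mrestr setIUl setICl setU0; apply/eqP.
  by rewrite eq_le measure_ge0 andbT -N0 le_measure ?inE//; exact: measurableI.
- move=> x /= nP; have [xab|] := pselect (`]a, b[%classic x); last by right.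
  by move: xab; rewrite /= in_itv/= => xab; left; apply: PN => /= /(_ xab).
Qed.

Lemma leb_itv_le (c e : R) : c <= e -> (mu `[c, e[%classic <= (e - c)%:E)%E.
Proof.
move=> ce; have : (mu `[c, e[%classic <= lam `[c, e[%classic)%E.
  by rewrite /leb/= /mrestr le_measure ?inE//; exact: measurableI.
rewrite lebesgue_measure_itv/= lte_fin => h; apply: le_trans h _.
by case: ltP => // ec; rewrite lee_fin subr_ge0.
Qed.

Lemma smooth_measurable phi : smooth phi -> measurable_fun setT phi.
Proof. by move=> sp; apply: continuous_measurable_fun; exact: smooth_continuous. Qed.

Lemma smooth_derive1 phi : smooth phi -> smooth (derive1 phi).
Proof. exact: (@smooth_derive1n _ phi 1). Qed.

Lemma smooth_is_derive phi (x : R) : smooth phi -> is_derive x 1 phi (derive1 phi x).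
Proof. by move=> sp; apply: derive1_is_derive; exact: smooth_derivable. Qed.

Lemma smooth_LR phi (c e : R) : smooth phi -> derivable_oo_LRcontinuous phi c e.
Proof.
move=> sp; have cp := smooth_continuous sp; split.
- by move=> x _; exact: smooth_derivable.
- exact: cvg_at_right_filter (cp c).
- exact: cvg_at_left_filter (cp e).
Qed.

Lemma Rintegral_derive1 phi (c e : R) : smooth phi -> c <= e ->
  \int[lam]_(x in `]c, e[) derive1 phi x = phi e - phi c.
Proof.
move=> sp; rewrite le_eqVlt => /predU1P[<-|ce].
  by rewrite subrr set_itvoo0 Rintegral_set0.
have s1 := smooth_derive1 sp.
have cd : {within `[c, e], continuous (derive1 phi)}.
  by apply: continuous_subspaceT; exact: smooth_continuous.
have ii : lam.-integrable `[c, e] (EFin \o derive1 phi).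
  by apply: continuous_compact_integrable => //; exact: segment_compact.
rewrite Rintegral_itv_bndo_bndc ?Rintegral_itv_obnd_cbnd.
- by rewrite /Rintegral (continuous_FTC2 ce cd (smooth_LR _ _ sp)).
- by apply: integrableS ii => //; apply: subset_itvr; rewrite bnd_simp.
- by apply: integrableS ii => //; apply: subset_itvW.
Qed.

Lemma test_fun_out phi x : test_fun a b phi -> ~~ (a < x < b) -> phi x = 0.
Proof.
move=> [_ [c [e [ac eb phi0]]]] xab; apply: phi0; apply: contra xab.
by rewrite in_itv/= => /andP[cx xe]; rewrite (lt_le_trans ac cx) (le_lt_trans xe eb).
Qed.

Lemma test_fun_smooth phi : test_fun a b phi -> smooth phi.
Proof. by case. Qed.

Lemma test_fun_measurable phi : test_fun a b phi -> measurable_fun setT phi.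
Proof. by move=> tp; exact: smooth_measurable (test_fun_smooth tp). Qed.

Lemma test_fun_derive1n k phi : test_fun a b phi -> test_fun a b (derive1n k phi).
Proof.
move=> tp; split; first exact/smooth_derive1n/test_fun_smooth.
have [_ [c [e [ac eb phi0]]]] := tp; exists c, e; split=> //.
elim: k => [//|k ih] x xce.
rewrite derive1nS derive1E (@near_eq_derive _ _ _ _ (cst 0)) ?derive_cst//.
have : open (~` [set` `[c, e]]) by apply: closed_openC; exact: interval_closed.
rewrite openE => /(_ x); rewrite /interior /= => h.
have {}h : nbhs x (~` [set` `[c, e]]) by apply: h; exact/negP.
by apply: filterS h => y /negP; exact: ih.
Qed.

Lemma test_fun_derive1 phi : test_fun a b phi -> test_fun a b (derive1 phi).
Proof. exact: (@test_fun_derive1n 1). Qed.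

Lemma test_fun_lin c phi psi : test_fun a b phi -> test_fun a b psi ->
  test_fun a b (fun x => c * phi x + psi x).
Proof.
move=> [sp [c1 [e1 [a1 b1 z1]]]] [sq [c2 [e2 [a2 b2 z2]]]].
split; first exact: (smooth_lin (c := c) sp sq).
exists (Num.min c1 c2), (Num.max e1 e2); split.
- by rewrite lt_min a1.
- by rewrite gt_max b1.
move=> x; rewrite in_itv/= negb_and -!ltNge lt_min gt_max => out.
have o1 : x \notin `[c1, e1].
  by rewrite in_itv/= negb_and -!ltNge; case/orP: out => /andP[-> _]; rewrite ?orbT.
have o2 : x \notin `[c2, e2].
  by rewrite in_itv/= negb_and -!ltNge; case/orP: out => /andP[_ ->]; rewrite ?orbT.
by rewrite z1// z2// mulr0 addr0.
Qed.

Lemma test_funM phi psi : test_fun a b phi -> smooth psi ->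
  test_fun a b (fun x => phi x * psi x).
Proof.
move=> [sp [c [e [ac eb z]]]] sq; split.
  apply/smoothP => n.
  exact: diffnM ((smoothP _).1 sp n) ((smoothP _).1 sq n).
by exists c, e; split=> // x xce; rewrite z// mul0r.
Qed.

Lemma test_fun_bounded phi : test_fun a b phi -> exists M, forall x, `|phi x| <= M.
Proof.
move=> tp; have [_ [M [_ h]]] := test_fun_good 0 tp.
by exists (M + 1) => x; apply: h => //; rewrite ltrDl.
Qed.

Lemma test_fun_sqi phi : test_fun a b phi -> sqi mu phi.
Proof.
move=> tp; have [M hM] := test_fun_bounded tp.
apply: (sqi_bounded1 leb_setT_fin _ hM).
exact: test_fun_measurable tp.
Qed.

Lemma test_fun_sqiM f phi : sqi mu f -> test_fun a b phi -> sqi mu (fun x => f x * phi x).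
Proof.
move=> sf tp; have [M hM] := test_fun_bounded tp.
exact: sqi_bounded sf (test_fun_measurable tp) hM.
Qed.

Hypothesis ab : a < b.

Lemma I_test_derive1 phi : test_fun a b phi -> I (derive1 phi) = 0.
Proof.
move=> tp; rewrite leb_Rintegral; last first.
  exact: test_fun_measurable (test_fun_derive1 tp).
rewrite Rintegral_derive1 ?ltW//; last exact: test_fun_smooth tp.
by rewrite !(test_fun_out tp) ?subrr// ltxx ?andbF.
Qed.

Lemma I_parts phi psi : test_fun a b phi -> smooth psi ->
  I (fun x => phi x * derive1 psi x) = - I (fun x => derive1 phi x * psi x).
Proof.
move=> tp sq; have tpq := test_funM tp sq; have sp := test_fun_smooth tp.
have := I_test_derive1 tpq.
have -> : derive1 (fun x => phi x * psi x) =
    (fun x => 1 * (phi x * derive1 psi x) + derive1 phi x * psi x).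
  apply/funext => x; have := is_deriveM (smooth_is_derive x sp) (smooth_is_derive x sq).
  by move=> dpq; rewrite derive1E derive_val mul1r /GRing.scale/= [psi x * _]mulrC.
have t1 := test_funM tp (smooth_derive1 sq).
have t2 := test_funM (test_fun_derive1 tp) sq.
rewrite I_lin; first by rewrite mul1r => /eqP; rewrite addr_eq0 => /eqP.
- exact/(sqi_integr leb_setT_fin)/test_fun_sqi/t1.
- exact/(sqi_integr leb_setT_fin)/test_fun_sqi/t2.
Qed.

(** Fundamental theorem of calculus on (y, b), with phi b = 0. *)
Lemma I_test_tail phi y : test_fun a b phi -> a < y < b ->
  I (fun x => derive1 phi x * (y < x)%R%:R) = - phi y.
Proof.
move=> tp /andP[ay yb]; have sp := test_fun_smooth tp.
have m1 : measurable_fun setT (derive1 phi).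
  exact: test_fun_measurable (test_fun_derive1 tp).
have E : (fun x => derive1 phi x * (y < x)%R%:R) = derive1 phi \_ `]y, +oo[.
  apply/funext => x; rewrite patchE mem_setE in_itv/= andbT.
  by case: ifP; rewrite ?mulr1// mulr0.
rewrite E leb_Rintegral; last exact/(measurable_restrictT _ _).1/measurable_funTS.
rewrite /Rintegral.
have -> : (\int[lam]_(x in `]a, b[) ((derive1 phi \_ `]y, +oo[) x)%:E =
    \int[lam]_(x in `]a, b[) (((EFin \o derive1 phi) \_ `]y, +oo[) x))%E.
  by apply: eq_integral => x _; rewrite !patchE; case: ifP.
rewrite -integral_mkcondr.
have -> : `]a, b[ `&` `]y, +oo[ = `]y, b[%classic.
  apply/seteqP; split=> x /=; rewrite !in_itv/= andbT.
    by move=> [/andP[_ ->] ->].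
  by move=> /andP[yx ->]; rewrite yx (lt_trans ay yx).
have := Rintegral_derive1 sp (ltW yb); rewrite /Rintegral => ->.
by rewrite (test_fun_out tp) ?sub0r// ltxx andbF.
Qed.

Lemma I_bump_cvg f (c e : R) : sqi mu f -> a < c -> e < b ->
  I (fun x => f x * bump c e n x) @[n --> \oo] -->
  I (fun x => f x * ((c < x < e)%R)%:R).
Proof.
move=> sf ac eb; have fi := sqi_integr leb_setT_fin sf; have mf := sqi_meas sf.
have mc : measurable_fun setT (fun x : R => ((c < x < e)%R)%:R : R).
  have -> : (fun x : R => ((c < x < e)%R)%:R : R) = \1_`]c, e[.
    by apply/funext => x; rewrite indicE mem_setE in_itv.
  exact: measurable_indic.
pose fb n x := (f x * bump c e n x)%:E.
pose fl x := (f x * ((c < x < e)%R)%:R)%:E.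
have [fiI _ cv] : [/\ mu.-integrable setT fl,
    [sequence (\int[mu]_x `|fb n x - fl x|)%E]_n @ \oo --> 0%E
  & [sequence (\int[mu]_x fb n x)%E]_n @ \oo --> (\int[mu]_x fl x)%E ].
  apply: (@dominated_convergence _ _ _ mu setT measurableT
    fb _ (fun x => `|f x|%:E)).
  - move=> n; apply/measurable_EFinP; apply: measurable_funM => //.
    by apply: smooth_measurable; exact: smooth_bump.
  - by apply/measurable_EFinP; apply: measurable_funM.
  - apply: aeW => x _; apply: cvg_EFin; first exact: nearW.
    by apply: cvgMr; exact: bump_cvg.
  - exact: integrable_norm fi.
  - apply: aeW => x n _; rewrite /= lee_fin normrM ler_piMr//.
    by rewrite ger0_norm ?bump_ge0 ?bump_le1.
apply: (fine_cvg (a := I (fun x => f x * ((c < x < e)%R)%:R))).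
by rewrite fineK//; exact: integrable_fin_num fiI.
Qed.

Lemma leb_Rintegral_itv f (c e : R) : measurable_fun setT f -> a <= c -> e <= b ->
  I (fun x => f x * ((c < x < e)%R)%:R) = \int[lam]_(x in `]c, e[) f x.
Proof.
move=> mf ac eb.
have E : (fun x => f x * ((c < x < e)%R)%:R) = f \_ `]c, e[.
  apply/funext => x; rewrite patchE mem_setE in_itv/=.
  by case: ifP; rewrite ?mulr1// mulr0.
rewrite E leb_Rintegral; last exact/(measurable_restrictT _ _).1/measurable_funTS.
rewrite /Rintegral.
have -> : (\int[lam]_(x in `]a, b[) ((f \_ `]c, e[) x)%:E =
    \int[lam]_(x in `]a, b[) (((EFin \o f) \_ `]c, e[) x))%E.
  by apply: eq_integral => x _; rewrite !patchE; case: ifP.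
rewrite -integral_mkcondr; congr (fine (integral _ _ _)).
apply/seteqP; split=> x /=; rewrite !in_itv/=; first by case.
by move=> /andP[cx xe]; rewrite (le_lt_trans ac cx) (lt_le_trans xe eb) cx xe.
Qed.

Lemma I_itv_eq0 f (c e : R) : sqi mu f ->
  (forall phi, test_fun a b phi -> I (fun x => f x * phi x) = 0) ->
  a < c -> e < b -> I (fun x => f x * ((c < x < e)%R)%:R) = 0.
Proof.
move=> sf f0 ac eb; have h := I_bump_cvg sf ac eb.
rewrite -(cvg_lim (@Rhausdorff R) h).
have -> : (fun n => I (fun x => f x * bump c e n x)) = cst 0.
  by apply/funext => n; exact/f0/test_fun_bump.
by rewrite lim_cst//; exact: Rhausdorff.
Qed.

(** Bumps show that the integral of f vanishes over every subinterval, so its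
    indefinite integral is locally constant; by Lebesgue differentiation f is
    almost everywhere the derivative of that integral. *)
Lemma fundamental_lemma f : sqi mu f ->
  (forall phi, test_fun a b phi -> I (fun x => f x * phi x) = 0) ->
  {ae mu, forall x, f x = 0}.
Proof.
move=> sf f0; have mf := sqi_meas sf.
pose f1 := f \_ `]a, b[.
have fi : lam.-integrable `]a, b[ (EFin \o f).
  exact: (leb_integrable mf).1 (sqi_integr leb_setT_fin sf).
have f1i : lam.-integrable setT (EFin \o f1).
  have := (@integrable_mkcond _ _ _ lam _ (EFin \o f) (measurable_itv `]a, b[)).1 fi.
  by apply: eq_integrable => // x _ /=; rewrite /f1 !patchE; case: ifP.
have li : locally_integrable setT f1 by exact: integrable_locally_restrict.
have := @FTC1Ny _ f1 _ li.
have fy y : lam.-integrable `]-oo, y] (EFin \o f1) by exact: integrableS f1i.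
pose F x := \int[lam]_(t in `]-oo, x]) f1 t.
move=> /(_ fy) /=; rewrite -/F => FP.
apply/ae_leb.
have FF := ae_filter_ringOfSetsType lam.
apply: filterS FP => x [dF dFx] /andP[ax xb].
have <- : f1 x = f x by rewrite /f1 patchE mem_setE in_itv/= ax xb.
rewrite -dFx.
have [c [e [ac cx xe eb]]] : exists c e, [/\ a < c, c < x, x < e & e < b].
  by exists ((a + x) / 2), ((x + b) / 2); split; lra.
have Fc y z : c < y -> y <= z -> z < e -> F z = F y.
  move=> cy; rewrite le_eqVlt => /predU1P[-> //|yz] ze.
  apply/eqP; rewrite -subr_eq0 /F Rintegral_itvB ?bnd_simp ?(ltW yz)//.
  rewrite -Rintegral_itv_bndo_bndc; last exact: integrableS f1i.
  have -> : \int[lam]_(t in `]y, z[) f1 t = \int[lam]_(t in `]y, z[) f t.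
    apply: eq_Rintegral => t; rewrite inE/= in_itv/= => /andP[yt tz].
    rewrite /f1 patchE mem_setE in_itv/=.
    by rewrite (lt_trans ac (lt_trans cy yt)) (lt_trans tz (lt_trans ze eb)).
  rewrite -leb_Rintegral_itv ?I_itv_eq0 ?eqxx//.
  - exact: lt_trans ac cy.
  - exact: lt_trans ze eb.
  - by rewrite ltW// (lt_trans ac cy).
  - by rewrite ltW// (lt_trans ze eb).
rewrite -/F derive1E (@near_eq_derive _ _ _ _ (cst (F x))) ?derive_cst//.
near=> y.
have cy : c < y by near: y; exact: lt_nbhsr.
have ye : y < e by near: y; exact: lt_nbhsl.
by have [xy|/ltW yx] := leP x y; [exact: Fc|apply/esym; exact: Fc].
Unshelve. all: by end_near. Qed.

Lemma leb_cut f (P : R -> bool) : measurable_fun setT (fun x => (P x)%:R : R) ->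
  mu.-integrable setT (EFin \o f) ->
  mu.-integrable setT (EFin \o (fun x => f x * (P x)%:R)).
Proof.
move=> mP fi; have /integrableP[/measurable_EFinP mf _] := fi.
apply: le_integrable fi => //.
  by apply/measurable_EFinP; apply: measurable_funM.
move=> x _ /=; rewrite lee_fin normrM ler_piMr//.
by case: (P x); rewrite /= ?normr1 ?normr0.
Qed.

Lemma measurable_ltl (x : R) : measurable_fun setT (fun y : R => (y < x)%R%:R : R).
Proof.
have -> : (fun y : R => (y < x)%R%:R : R) = \1_`]-oo, x[.
  by apply/funext => y; rewrite indicE mem_setE in_itv.
exact: measurable_indic.
Qed.

Lemma measurable_ltr (y : R) : measurable_fun setT (fun x : R => (y < x)%R%:R : R).
Proof.
have -> : (fun x : R => (y < x)%R%:R : R) = \1_`]y, +oo[.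
  by apply/funext => x; rewrite indicE mem_setE in_itv/= andbT.
exact: measurable_indic.
Qed.

(** Exchange of the order of integration over the triangle y < x. *)
Lemma I_fubini (p g : R -> R) : mu.-integrable setT (EFin \o p) ->
  mu.-integrable setT (EFin \o g) ->
  I (fun x => p x * I (fun y => g y * (y < x)%R%:R)) =
  I (fun y => g y * I (fun x => p x * (y < x)%R%:R)).
Proof.
move=> pi gi.
have moo : (lam `]a, b[ < +oo)%E.
  by have := leb_setT_fin; rewrite /leb/= /mrestr setTI -ge0_fin_numE.
pose m : {sigma_finite_measure set (measurableTypeR R) -> \bar R} :=
  @mfrestr _ (measurableTypeR R) R _ lam (measurable_itv `]a, b[) moo.
have mE (h : R -> \bar R) : (\int[m]_x h x = \int[mu]_x h x)%E by [].
pose F (z : R * R) := (p z.1 * (g z.2 * (z.2 < z.1)%R%:R))%:E.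
have mp : measurable_fun setT p by have /integrableP[/measurable_EFinP] := pi.
have mg : measurable_fun setT g by have /integrableP[/measurable_EFinP] := gi.
have mF : measurable_fun setT F.
  apply/measurable_EFinP; apply: measurable_funM.
    exact: measurableT_comp mp measurable_fst.
  apply: measurable_funM; first exact: measurableT_comp mg measurable_snd.
  rewrite (_ : (fun _ => _) = (fun z : R * R => if (z.2 < z.1)%R then 1 else 0 : R)).
    apply: measurable_fun_ifT => //.
    exact: measurable_fun_ltr measurable_snd measurable_fst.
  by apply/funext => z; case: ifP.
have gci x : mu.-integrable setT (EFin \o (fun y => g y * (y < x)%R%:R)).
  by apply: leb_cut => //; exact: measurable_ltl.
have pci y : mu.-integrable setT (EFin \o (fun x => p x * (y < x)%R%:R)).
  by apply: leb_cut => //; exact: measurable_ltr.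
have inner x : (\int[m]_y F (x, y) = (p x * I (fun y => g y * (y < x)%R%:R))%:E)%E.
  rewrite -RintegralZl// /Rintegral fineK//.
  apply: integrable_fin_num => //.
  by have := integrableZl measurableT (p x) (gci x); apply: eq_integrable.
have outer y : (\int[m]_x F (x, y) = (g y * I (fun x => p x * (y < x)%R%:R))%:E)%E.
  rewrite -RintegralZl// /Rintegral fineK.
    by apply: eq_integral => x _; rewrite /F/= mulrCA.
  apply: integrable_fin_num => //.
  by have := integrableZl measurableT (g y) (pci y); apply: eq_integrable.
have iF : (m \x m)%E.-integrable setT F.
  apply/integrable21ltyP => //.
  have gp : (\int[mu]_x `|p x|%:E < +oo)%E by have /integrableP[] := pi.
  have bound y : (\int[m]_x `|F (x, y)| <= `|g y|%:E * \int[mu]_x `|p x|%:E)%E.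
    rewrite -ge0_integralZl//; first last.
    - by apply/measurable_EFinP; apply: measurableT_comp.
    apply: ge0_le_integral => //.
    - apply: measurableT_comp => //; exact: measurableT_comp mF (pair2_measurable y).
    - by apply: measurable_funeM; apply/measurable_EFinP; apply: measurableT_comp.
    move=> x _; rewrite lee_fin !normrM [leRHS]mulrC ler_wpM2l// ler_piMr//.
    by case: (y < x); rewrite ?normr1 ?normr0.
  have fp : (\int[mu]_x `|p x|%:E \is a fin_num)%E.
    by rewrite ge0_fin_numE//; apply: integral_ge0.
  apply: (@le_lt_trans _ _ (\int[m]_y (`|g y|%:E * (fine (\int[mu]_x `|p x|%:E))%:E))%E).
    apply: ge0_le_integral => //.
    - by move=> y _; apply: integral_ge0.
    - apply: (@measurable_fun_fubini_tonelli_G _ _ _ _ R m (abse \o F)) => //.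
        exact: measurableT_comp mF.
      by move=> z; exact: abse_ge0.
    - by apply: emeasurable_funM => //; apply/measurable_EFinP; apply: measurableT_comp.
    by move=> y _; rewrite fineK.
  rewrite mE ge0_integralZr//; first last.
  - by rewrite lee_fin fine_ge0//; apply: integral_ge0.
  - by apply/measurable_EFinP; apply: measurableT_comp.
  have fg : (\int[mu]_x `|g x|%:E \is a fin_num)%E.
    by rewrite ge0_fin_numE; [have /integrableP[] := gi|apply: integral_ge0].
  by rewrite -(fineK fg) -EFinM ltry.
have := Fubini iF.
under eq_integral do rewrite inner.
under [in RHS]eq_integral do rewrite outer.
by rewrite /Rintegral => ->.
Qed.

(** Indefinite integral from a. The indicator keeps the domain of integration
    fixed, as Fubini requires. *)
Definition prim g (x : R) : R := I (fun y => g y * (y < x)%R%:R).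

Lemma sqi_ltl (x : R) : sqi mu (fun y => (y < x)%R%:R).
Proof.
apply: (@sqi_bounded1 _ _ _ mu leb_setT_fin _ 1); first exact: measurable_ltl.
by move=> y; case: (y < x); rewrite ?normr1 ?normr0.
Qed.

Lemma sqi_cst (c : R) : sqi mu (cst c).
Proof. exact: (@sqi_bounded1 _ _ _ mu leb_setT_fin _ `|c|). Qed.

(** Cauchy-Schwarz against the indicator of [x, z[. *)
Lemma prim_hoelder g (x z : R) : sqi mu g -> x <= z ->
  (prim g z - prim g x) ^+ 2 <= I (fun y => g y ^+ 2) * (z - x).
Proof.
move=> sg xz; have gi := sqi_integr leb_setT_fin sg.
pose k y : R := (y \in `[x, z[)%:R.
have kE y : k y = (y < z)%R%:R - (y < x)%R%:R.
  rewrite /k in_itv/=; case: (ltP y x) => [yx|xy]/=.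
    by rewrite (lt_le_trans yx xz) subrr.
  by rewrite subr0.
have sk : sqi mu k.
  have := sqi_lin (-1) (sqi_ltl x) (sqi_ltl z); congr (sqi _ _).
  by apply/funext => y; rewrite kE mulN1r addrC.
have -> : prim g z - prim g x = I (fun y => g y * k y).
  have i1 := leb_cut (measurable_ltl x) gi; have i2 := leb_cut (measurable_ltl z) gi.
  have := I_lin (-1) i1 i2; rewrite mulN1r addrC -/(prim g z) -/(prim g x) => <-.
  by congr (Rintegral _ _ _); apply/funext => y; rewrite kE; ring.
apply: le_trans (I_cs sg sk) _; apply: ler_wpM2l.
  by apply: I_ge0 => y; rewrite sqr_ge0.
have -> : (fun y => k y ^+ 2) = (\1_(`[x, z[%classic) : R -> R).
  apply/funext => y; rewrite /k indicE mem_setE.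
  by case: (y \in _); rewrite ?expr1n ?expr0n.
rewrite /Rintegral integral_indic// setIT -lee_fin fineK ?leb_itv_le//.
by rewrite ge0_fin_numE//; apply: le_lt_trans (leb_itv_le xz) (ltry _).
Qed.

Lemma prim_sqr_le g x : sqi mu g ->
  prim g x ^+ 2 <= I (fun y => g y ^+ 2) * I (cst 1).
Proof.
move=> sg; apply: le_trans (I_cs sg (sqi_ltl x)) _; apply: ler_wpM2l.
  by apply: I_ge0 => y; rewrite sqr_ge0.
apply: le_Rintegral => //.
- exact: (sqiM (sqi_ltl x) (sqi_ltl x)).
- by apply: (sqi_integr leb_setT_fin); exact: (sqi_cst 1).
by move=> y _; case: (y < x); rewrite ?expr1n ?expr0n.
Qed.

Lemma prim_continuous g : sqi mu g -> continuous (prim g).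
Proof.
move=> sg x; apply/cvgrPdist_lt => e e0.
pose K := I (fun y => g y ^+ 2).
have K0 : 0 <= K by apply: I_ge0 => y; rewrite sqr_ge0.
have d0 : 0 < e ^+ 2 / (K + 1) by rewrite divr_gt0 ?exprn_gt0//; lra.
near=> z.
have xz : `|x - z| < e ^+ 2 / (K + 1).
  by near: z; exact: (nbhsx_ballx x _ d0).
rewrite -(@ltr_pXn2r _ 2)// ?nnegrE ?(ltW e0)// real_normK ?num_real//.
rewrite ltr_pdivlMr in xz; last lra.
have h : (prim g x - prim g z) ^+ 2 <= K * `|x - z|.
  have [xz'|/ltW zx] := leP x z.
    by rewrite -sqrrN opprB distrC ger0_norm ?subr_ge0//; exact: prim_hoelder.
  by rewrite ger0_norm ?subr_ge0//; exact: prim_hoelder.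
by apply: le_lt_trans h _; have := normr_ge0 (x - z); nra.
Unshelve. all: by end_near. Qed.

Lemma prim_sqi g : sqi mu g -> sqi mu (prim g).
Proof.
move=> sg; apply: (@sqi_bounded1 _ _ _ mu leb_setT_fin _
  (Num.sqrt (I (fun y => g y ^+ 2) * I (cst 1)))).
  by apply: continuous_measurable_fun; exact: prim_continuous.
by move=> x; rewrite -sqrtr_sqr ler_sqrt ?prim_sqr_le// mulr_ge0// I_ge0// => y; rewrite sqr_ge0.
Qed.

Lemma I_test_tail_all phi y : test_fun a b phi ->
  I (fun x => derive1 phi x * (y < x)%R%:R) = - phi y.
Proof.
move=> tp; have [/I_test_tail ->//|out] := boolP (a < y < b).
have m1 := test_fun_measurable (test_fun_derive1 tp).
rewrite (test_fun_out tp out) oppr0 leb_Rintegral; last first.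
  by apply: measurable_funM => //; exact: measurable_ltr.
move: out; rewrite negb_and -!leNgt => /orP[ya|by_].
  have := I_test_derive1 tp; rewrite leb_Rintegral// => <-.
  apply: eq_Rintegral => x; rewrite inE/= in_itv/= => /andP[ax _].
  by rewrite (le_lt_trans ya ax) mulr1.
rewrite (_ : 0 = \int[lam]_(x in `]a, b[) cst 0 x); last by rewrite Rintegral_cst// mul0r.
apply: eq_Rintegral => x; rewrite inE/= in_itv/= => /andP[_ xb].
by rewrite ltNge (ltW (lt_le_trans xb by_)) mulr0.
Qed.

(** Exchange the order of integration and use that phi y is minus the
    integral of its derivative over (y, b). *)
Lemma prim_parts g phi : sqi mu g -> test_fun a b phi ->
  I (fun x => prim g x * derive1 phi x) = - I (fun x => g x * phi x).
Proof.
move=> sg tp; have gi := sqi_integr leb_setT_fin sg.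
have pi := sqi_integr leb_setT_fin (test_fun_sqi (test_fun_derive1 tp)).
have := I_fubini pi gi.
under [X in X = _ -> _]eq_Rintegral do rewrite mulrC.
move=> ->; under eq_Rintegral do rewrite I_test_tail_all// mulrN.
have := RintegralZl (-1) measurableT (sqi_integr leb_setT_fin (test_fun_sqiM sg tp)).
by rewrite mulN1r => <-; apply: eq_Rintegral => x _; rewrite mulN1r.
Qed.

(** The indefinite integral of w is constant on both sides of the support,
    and the right-hand constant is the total integral. *)
Lemma test_fun_primitive w : test_fun a b w -> I w = 0 ->
  exists2 phi, test_fun a b phi & derive1 phi = w.
Proof.
move=> tw w0; have [sw [c [e [ac eb wout]]]] := tw.
have wE : w = w \_ `[c, e].
  apply/funext => x; rewrite patchE mem_setE.
  by case: ifPn => // /wout.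
have cw := smooth_continuous sw.
have wi : lam.-integrable setT (EFin \o w).
  have ii : lam.-integrable `[c, e] (EFin \o w).
    apply: continuous_compact_integrable; first exact: segment_compact.
    exact: continuous_subspaceT.
  have := (@integrable_mkcond _ _ _ lam _ (EFin \o w) (measurable_itv `[c, e])).1 ii.
  by apply: eq_integrable => // x _ /=; rewrite [in RHS]wE !patchE; case: ifP.
pose phi x := \int[lam]_(t in `]-oo, x]) w t.
have dphi (x : R) : is_derive x 1 phi (w x).
  have [] := @continuous_FTC1 R w -oo%O x (x + 1).
  - by rewrite ltrDl.
  - exact: integrableS wi.
  - exact: ltNyr.
  - exact: cw.
  by move=> d1 d2; apply: (DeriveDef d1); rewrite -derive1E; exact: d2.
have dE : derive1 phi = w by apply/funext => x; rewrite derive1E derive_val.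
have sphi : smooth phi := smooth_intro dphi sw.
exists phi => //; split; first exact: sphi.
exists c, e; split=> // x; rewrite in_itv/= negb_and -!ltNge => /orP[xc|ex].
  rewrite /phi (_ : 0 = \int[lam]_(x in `]-oo, x]) cst 0 x); last by rewrite Rintegral_cst// mul0r.
  apply: eq_Rintegral => t; rewrite inE/= in_itv/= => tx; apply: wout.
  by rewrite in_itv/= negb_and -ltNge (le_lt_trans tx xc).
rewrite -w0 leb_Rintegral; last exact: test_fun_measurable tw.
rewrite /phi Rintegral_mkcond [RHS]Rintegral_mkcond; congr (Rintegral _ _ _).
apply/funext => t; rewrite !patchE !mem_setE !in_itv/=.
have [tin|tout] := boolP (t \in `[c, e]); last by rewrite (wout _ tout) !if_same.
move: tin; rewrite in_itv/= => /andP[ct te].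
by rewrite (le_trans te (ltW ex)) (lt_le_trans ac ct) (le_lt_trans te eb).
Qed.

(** If every bump had integral 0, so would the indicator of an interval of
    positive length. *)
Lemma test_fun_mass : exists2 theta, test_fun a b theta & I theta != 0.
Proof.
have [c [e [ac ce eb]]] : exists c e, [/\ a < c, c < e & e < b].
  have ab' : 0 < b - a by rewrite subr_gt0.
  (* the middle third of the interval *)
  exists (a + (b - a) / 3), (b - (b - a) / 3); split; by lra.
apply: contrapT => nex.
have h := I_bump_cvg (sqi_cst 1) ac eb.
have /= := cvg_lim (@Rhausdorff R) h.
have -> : (fun n => I (fun x => cst 1 x * bump c e n x)) = cst 0.
  apply/funext => n; apply/eqP/negPn/negP => ne0; apply: nex.
  exists (bump c e n); first exact: test_fun_bump.
  by move: ne0; under eq_Rintegral do rewrite mul1r.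
rewrite lim_cst; last exact: Rhausdorff.
rewrite leb_Rintegral_itv ?(ltW ac) ?(ltW eb)// Rintegral_cst// mul1r.
move=> /(_ eventually_filter) z.
have lamE : lam [set` `]c, e[] = (e - c)%:E.
  by rewrite lebesgue_measure_itv/= lte_fin ce.
have : 0 = e - c by rewrite -[RHS]/(fine (e - c)%:E) -lamE.
by apply/eqP; rewrite eq_sym gt_eqF// subr_gt0.
Qed.

(** A multiple of theta makes psi a test function of integral 0, hence a
    derivative of a test function. So h minus a constant is orthogonal to
    every psi. *)
Lemma du_bois_reymond h : sqi mu h ->
  (forall phi, test_fun a b phi -> I (fun x => h x * derive1 phi x) = 0) ->
  exists c, {ae mu, forall x, h x = c}.
Proof.
move=> sh h0; have [theta tt t0] := test_fun_mass.
pose c := I (fun x => h x * theta x) / I theta; exists c.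
have shc : sqi mu (fun x => h x - c).
  by have := sqi_lin 1 sh (sqi_cst (- c)); congr (sqi _ _); apply/funext => x; rewrite mul1r.
have F := ae_filter_ringOfSetsType mu.
suff : {ae mu, forall x, h x - c = 0} by apply: filterS => x /eqP; rewrite subr_eq0 => /eqP.
apply: fundamental_lemma shc _ => psi tp.
(* k * theta + psi has integral 0 *)
pose k := - (I psi / I theta).
have tw := test_fun_lin k tt tp.
have sfi f : sqi mu f -> mu.-integrable setT (EFin \o f) by move=> sf'; exact: (sqi_integr leb_setT_fin sf').
have w0 : I (fun x => k * theta x + psi x) = 0.
  by rewrite I_lin ?sfi ?test_fun_sqi// /k mulNr divfK// addNr.
have [phi tphi phiw] := test_fun_primitive tw w0.
have := h0 phi tphi; rewrite phiw.
have -> : (fun x => h x * (k * theta x + psi x)) =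
   (fun x => k * (h x * theta x) + h x * psi x) by apply/funext => x; ring.
rewrite I_lin ?sfi ?test_fun_sqiM// => E.
have -> : (fun x => (h x - c) * psi x) = (fun x => (- c) * psi x + h x * psi x).
  by apply/funext => x; ring.
rewrite (I_lin (- c) (sfi _ (test_fun_sqi tp)) (sfi _ (test_fun_sqiM sh tp))).
by rewrite -[RHS]E; congr (_ + _); rewrite /c /k; field.
Qed.

(** The function f - prim g has weak derivative 0. *)
Lemma weak_derivative_prim f g : sqi mu f -> sqi mu g ->
  (forall phi, test_fun a b phi ->
     I (fun x => f x * derive1 phi x) = - I (fun x => g x * phi x)) ->
  exists c, {ae mu, forall x, f x = c + prim g x}.
Proof.
move=> sf sg fg.
have sfi f' : sqi mu f' -> mu.-integrable setT (EFin \o f') by move=> sf'; exact: (sqi_integr leb_setT_fin sf').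
have sh : sqi mu (fun x => (-1) * prim g x + f x) by apply: sqi_lin => //; exact: prim_sqi.
have [phi tp|c hc] := du_bois_reymond sh; last first.
  exists c; have F := ae_filter_ringOfSetsType mu.
  by apply: filterS hc => x <-; ring.
have td := test_fun_derive1 tp.
have -> : (fun x => (-1 * prim g x + f x) * derive1 phi x) =
    (fun x => (-1) * (prim g x * derive1 phi x) + f x * derive1 phi x).
  by apply/funext => x; ring.
rewrite I_lin ?sfi ?test_fun_sqiM//; last exact: prim_sqi.
by rewrite prim_parts// fg//; ring.
Qed.

End Interval.

(** * Complex square-integrable functions *)

Section ComplexL2.
Context {R : realType} {a b : R}.
Local Notation C := R[i].
Local Notation mu := (leb a b).
Local Notation I h := (\int[mu]_x h x).
Local Notation Re := complex.Re.
Local Notation Im := complex.Im.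
Implicit Types f g : L2 a b.

Definition reL f (x : R) : R := Re (repr f x).
Definition imL f (x : R) : R := Im (repr f x).

Lemma reL_sqi f : sqi mu (reL f).
Proof. by have /andP[] := valP (repr f). Qed.

Lemma imL_sqi f : sqi mu (imL f).
Proof. by have /andP[] := valP (repr f). Qed.

Lemma L2_ext f g : {ae mu, forall x, reL f x = reL g x} ->
  {ae mu, forall x, imL f x = imL g x} -> f = g.
Proof.
move=> fgr fgi; rewrite -[f]reprK -[g]reprK; apply/L2_eqP.
have F := ae_filter_ringOfSetsType mu.
apply: filterS2 fgr fgi => x; rewrite /reL /imL.
by case: (repr f x) (repr g x) => ? ? [? ?] /= -> ->.
Qed.

Lemma mkL2_subproof (p q : R -> R) : sqi mu p -> sqi mu q ->
  (fun x => p x +i* q x : C^o) \in @L2pred R a b.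
Proof. by move=> sp sq; apply/andP; split. Qed.

Definition mkL2 (p q : R -> R) (sp : sqi mu p) (sq : sqi mu q) : L2 a b :=
  \pi_(L2 a b) (MkL2fun (mkL2_subproof sp sq)).

Lemma mkL2E (p q : R -> R) (sp : sqi mu p) (sq : sqi mu q) :
  {ae mu, forall x, repr (mkL2 sp sq) x = p x +i* q x}.
Proof.
have /L2_eqP : \pi_(L2 a b) (repr (mkL2 sp sq)) = \pi_(L2 a b) (MkL2fun (mkL2_subproof sp sq)).
  by rewrite reprK.
by [].
Qed.

Lemma mkL2_re (p q : R -> R) (sp : sqi mu p) (sq : sqi mu q) :
  {ae mu, forall x, reL (mkL2 sp sq) x = p x}.
Proof.
have F := ae_filter_ringOfSetsType mu.
by apply: filterS (mkL2E sp sq) => x; rewrite /reL => ->.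
Qed.

Lemma mkL2_im (p q : R -> R) (sp : sqi mu p) (sq : sqi mu q) :
  {ae mu, forall x, imL (mkL2 sp sq) x = q x}.
Proof.
have F := ae_filter_ringOfSetsType mu.
by apply: filterS (mkL2E sp sq) => x; rewrite /imL => ->.
Qed.

Lemma reL_lin (c : C) f g :
  {ae mu, forall x, reL (c *: f + g) x = Re c * reL f x - Im c * imL f x + reL g x}.
Proof.
have F := ae_filter_ringOfSetsType mu.
apply: filterS (L2_reprP c f g) => x; rewrite /reL /imL => ->.
by case: (repr f x) (repr g x) c => ? ? [? ?] [? ?].
Qed.

Lemma imL_lin (c : C) f g :
  {ae mu, forall x, imL (c *: f + g) x = Im c * reL f x + Re c * imL f x + imL g x}.
Proof.
have F := ae_filter_ringOfSetsType mu.
apply: filterS (L2_reprP c f g) => x; rewrite /reL /imL => ->.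
by case: (repr f x) (repr g x) c => ? ? [? ?] [? ?] /=; ring.
Qed.

Definition ipL f g : R := Re (dotL2 f g).

Let sfi (h : R -> R) : sqi mu h -> mu.-integrable setT (EFin \o h).
Proof. by move=> sh; exact: (sqi_integr (leb_setT_fin a b) sh). Qed.

Lemma sqi_measM (p q : R -> R) : sqi mu p -> sqi mu q ->
  measurable_fun setT (fun x => p x * q x).
Proof. by move=> sp sq; exact: (measurable_funM (sqi_meas sp) (sqi_meas sq)). Qed.

Lemma ipLE f g : ipL f g = I (fun x => reL f x * reL g x) + I (fun x => imL f x * imL g x).
Proof.
have i1 := sqiM (reL_sqi f) (reL_sqi g); have i2 := sqiM (imL_sqi f) (imL_sqi g).
rewrite -[I (fun x => reL f x * reL g x)]mul1r -I_lin// /ipL /dotL2 /cint/=.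
apply: eq_Rintegral => x _; rewrite /reL /imL.
by case: (repr f x) (repr g x) => ? ? [? ?] /=; ring.
Qed.

Lemma dotL2E f g : dotL2 f g =
  ipL f g +i* (I (fun x => imL f x * reL g x) - I (fun x => reL f x * imL g x)).
Proof.
have i1 := sqiM (imL_sqi f) (reL_sqi g); have i2 := sqiM (reL_sqi f) (imL_sqi g).
have := I_lin (-1) i2 i1; rewrite mulN1r addrC => <-.
rewrite /ipL [LHS](_ : _ = Re (dotL2 f g) +i* Im (dotL2 f g)); last by case: (dotL2 f g).
congr (_ +i* _); rewrite /dotL2 /cint/=; apply: eq_Rintegral => x _; rewrite /reL /imL.
by case: (repr f x) (repr g x) => ? ? [? ?] /=; ring.
Qed.

Lemma I_lin_ae (c d : R) (h h1 h2 h3 k : R -> R) :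
  sqi mu h -> sqi mu h1 -> sqi mu h2 -> sqi mu h3 -> sqi mu k ->
  {ae mu, forall x, h x = c * h1 x + d * h2 x + h3 x} ->
  I (fun x => h x * k x) = c * I (fun x => h1 x * k x) +
    d * I (fun x => h2 x * k x) + I (fun x => h3 x * k x).
Proof.
move=> sh s1 s2 s3 sk hE; have F := ae_filter_ringOfSetsType mu.
have i1 := sqiM s1 sk; have i2 := sqiM s2 sk; have i3 := sqiM s3 sk.
rewrite -addrA -I_lin// -I_lin//; last exact: integr_lin.
apply: I_ae.
- exact: sqi_measM.
- by have /integrableP[/measurable_EFinP] := integr_lin c i1 (integr_lin d i2 i3).
- by apply: filterS hE => x ->; ring.
Qed.

Lemma ipL_lin (c : C) f g h :
  ipL (c *: f + g) h = Re c * ipL f h +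
    Im c * (I (fun x => reL f x * imL h x) - I (fun x => imL f x * reL h x)) + ipL g h.
Proof.
have F := ae_filter_ringOfSetsType mu.
have rE : {ae mu, forall x, reL (c *: f + g) x = Re c * reL f x + - Im c * imL f x + reL g x}.
  by apply: filterS (reL_lin c f g) => x ->; ring.
rewrite !ipLE.
rewrite (I_lin_ae (reL_sqi _) (reL_sqi f) (imL_sqi f) (reL_sqi g) (reL_sqi h) rE).
rewrite (I_lin_ae (imL_sqi _) (reL_sqi f) (imL_sqi f) (imL_sqi g) (imL_sqi h) (imL_lin c f g)).
by ring.
Qed.

Lemma ipL0 g : ipL 0 g = 0.
Proof. by have := ipL_lin (-1) 0 0 g; rewrite scaler0 addr0 /= => E; lra. Qed.

Lemma ipL_i f g : ipL ('i *: f) g =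
  I (fun x => reL f x * imL g x) - I (fun x => imL f x * reL g x).
Proof.
by have := ipL_lin 'i f 0 g; rewrite addr0 ipL0 => ->/=; ring.
Qed.

Lemma ipL_sym f g : ipL f g = ipL g f.
Proof.
by rewrite !ipLE; congr (_ + _); apply: eq_Rintegral => z _; rewrite mulrC.
Qed.

Lemma ipL_anti f g : ipL ('i *: f) g = - ipL ('i *: g) f.
Proof.
rewrite !ipL_i opprB; congr (_ - _); apply: eq_Rintegral => z _; exact: mulrC.
Qed.

(** The complex product is determined by its real part, so that only real
    products need to be computed. *)
Lemma dotL2_ip f g : dotL2 f g = ipL f g +i* ipL f ('i *: g).
Proof.
rewrite dotL2E ipL_sym [ipL f ('i *: g)]ipL_sym ipL_anti ipL_i opprB ipL_sym.
by [].
Qed.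

Lemma repr0 : {ae mu, forall x, repr (0 : L2 a b) x = 0}.
Proof.
have : \pi_(L2 a b) (repr (0 : L2 a b)) = \pi_(L2 a b) 0 by rewrite reprK raddf0.
by move=> /L2_eqP.
Qed.

Lemma ipL_inner : is_inner ipL.
Proof.
split.
- exact: ipL_sym.
- by move=> c x y z; rewrite ipL_lin /= mul0r addr0.
- move=> x y; rewrite ipL_anti scalerA.
  have -> : 'i * 'i = -1 :> C by have := sqr_i R; rewrite expr2.
  by rewrite -[-1 *: y]addr0 ipL_lin ipL0/= oppr0 mul0r !addr0 mulN1r opprK ipL_sym.
- by move=> x; rewrite ipLE addr_ge0// I_ge0// => z; rewrite -expr2 sqr_ge0.
- move=> x; rewrite ipLE => x0.
  have F := ae_filter_ringOfSetsType mu.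
  have r0 : 0 <= I (fun z => reL x z ^+ 2) by apply: I_ge0 => z; rewrite sqr_ge0.
  have i0 : 0 <= I (fun z => imL x z ^+ 2) by apply: I_ge0 => z; rewrite sqr_ge0.
  have sE (h : R -> R) : (fun z => h z * h z) = (fun z => h z ^+ 2).
    by apply/funext => z; rewrite expr2.
  rewrite !sE in x0.
  have rz : I (fun z => reL x z ^+ 2) = 0 by lra.
  have iz : I (fun z => imL x z ^+ 2) = 0 by lra.
  apply: L2_ext.
    by apply: filterS2 (I_sq_eq0 (reL_sqi x) rz) repr0 => z -> ; rewrite /reL => ->.
  by apply: filterS2 (I_sq_eq0 (imL_sqi x) iz) repr0 => z -> ; rewrite /imL => ->.
Qed.

(** Real and imaginary parts converge separately. *)
Lemma L2_complete (f : nat -> L2 a b) : ncauchy (inorm ipL) f ->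
  exists l, ncvg (inorm ipL) \oo f l.
Proof.
move=> fC; have F := ae_filter_ringOfSetsType mu.
have sqE x y : inorm ipL (x - y) ^+ 2 =
    I (fun z => (reL x z - reL y z) ^+ 2) + I (fun z => (imL x z - imL y z) ^+ 2).
  have sB (p q : R -> R) : sqi mu p -> sqi mu q -> measurable_fun setT (fun z => (p z - q z) ^+ 2).
    move=> sp sq; apply: measurable_funX.
    exact: (measurable_funB (sqi_meas sp) (sqi_meas sq)).
  rewrite (inorm_sqr ipL_inner) ipLE; congr (_ + _); apply: I_ae.
  - exact: sqi_measM (reL_sqi _) (reL_sqi _).
  - exact: sB (reL_sqi _) (reL_sqi _).
  - have := reL_lin (-1) y x; rewrite scaleN1r addrC.
    by apply: filterS => z ->/=; ring.
  - exact: sqi_measM (imL_sqi _) (imL_sqi _).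
  - exact: sB (imL_sqi _) (imL_sqi _).
  - have := imL_lin (-1) y x; rewrite scaleN1r addrC.
    by apply: filterS => z ->/=; ring.
have I0 (h : R -> R) : 0 <= I (fun z => h z ^+ 2) by apply: I_ge0 => z; rewrite sqr_ge0.
have C2 e : 0 < e -> exists N, forall m n, (N <= m)%N -> (N <= n)%N ->
    inorm ipL (f m - f n) ^+ 2 < e.
  move=> e0; have := e0; rewrite -sqrtr_gt0 => /fC[N hN]; exists N => m n Nm Nn.
  rewrite -[ltRHS]sqr_sqrtr ?(ltW e0)//.
  by rewrite ltr_pXn2r ?nnegrE ?sqrtr_ge0//; exact: hN.
have part (h : L2 a b -> R -> R) : (forall x, sqi mu (h x)) ->
    (forall x y, I (fun z => (h x z - h y z) ^+ 2) <= inorm ipL (x - y) ^+ 2) ->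
    exists p, sqi mu p /\ forall e, 0 < e -> exists N, forall n, (N <= n)%N ->
      I (fun z => (h (f n) z - p z) ^+ 2) <= e.
  move=> sh hle; apply: (sqi_complete (leb_setT_fin a b) (fun n => sh (f n))) => e e0.
  have [N hN] := C2 e e0; exists N => m n Nm Nn.
  exact: le_lt_trans (hle _ _) (hN m n Nm Nn).
have [|p [sp pP]] := part reL reL_sqi.
  by move=> x y; rewrite sqE lerDl.
have [|q [sq qP]] := part imL imL_sqi.
  by move=> x y; rewrite sqE lerDr.
exists (mkL2 sp sq); apply/cvgrPdist_lt => e e0.
have e4 : 0 < e ^+ 2 / 4 by rewrite divr_gt0 ?exprn_gt0.
have [N1 h1] := pP _ e4; have [N2 h2] := qP _ e4.
exists (maxn N1 N2) => // n /=; rewrite geq_max => /andP[/h1 {}h1 /h2 {}h2].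
rewrite sub0r normrN ger0_norm ?inorm_ge0//.
rewrite -(@ltr_pXn2r _ 2)// ?nnegrE ?inorm_ge0 ?(ltW e0)// sqE.
have E (h : L2 a b -> R -> R) p' : (forall x, sqi mu (h x)) -> sqi mu p' ->
    {ae mu, forall x, h (mkL2 sp sq) x = p' x} ->
    I (fun z => (h (f n) z - h (mkL2 sp sq) z) ^+ 2) = I (fun z => (h (f n) z - p' z) ^+ 2).
  move=> sh sp' hp; apply: I_ae.
  - apply: measurable_funX; exact: (measurable_funB (sqi_meas (sh _)) (sqi_meas (sh _))).
  - apply: measurable_funX; exact: (measurable_funB (sqi_meas (sh _)) (sqi_meas sp')).
  - by apply: filterS hp => z ->.
rewrite (E reL p reL_sqi sp (mkL2_re sp sq)) (E imL q imL_sqi sq (mkL2_im sp sq)).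
have : 0 < e ^+ 2 by rewrite exprn_gt0.
by lra.
Qed.

Lemma ipL_banach : banach_norm (inorm ipL).
Proof. exact: (inorm_banach ipL_inner L2_complete). Qed.

End ComplexL2.

(** * Antiderivatives and traces *)

Section WeakDerivative.
Context {R : realType} {a b : R}.
Local Notation C := R[i].
Local Notation mu := (leb a b).
Local Notation I h := (\int[mu]_x h x).
Local Notation Re := complex.Re.
Local Notation Im := complex.Im.
Implicit Types f g h : L2 a b.
Implicit Types phi : R -> R.

Hypothesis ab : a < b.

Lemma cint_test f phi : cint a b (fun x => repr f x * (phi x)%:C) =
  I (fun x => reL f x * phi x) +i* I (fun x => imL f x * phi x).
Proof.
congr (_ +i* _); apply: eq_Rintegral => x _; rewrite /reL /imL.
  by case: (repr f x) => r s /=; rewrite mulr0 subr0.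
by case: (repr f x) => r s /=; rewrite mulr0 add0r.
Qed.

Lemma is_wderiv1P f g : is_wderiv 1 f g <->
  forall phi, test_fun a b phi ->
    I (fun x => reL f x * derive1 phi x) = - I (fun x => reL g x * phi x) /\
    I (fun x => imL f x * derive1 phi x) = - I (fun x => imL g x * phi x).
Proof.
split=> fg phi tp; have := fg phi tp; rewrite !cint_test expr1 mulN1r.
  by move=> [].
by move=> [-> ->].
Qed.

Lemma L2_test_eq f g :
  (forall phi, test_fun a b phi -> cint a b (fun x => repr f x * (phi x)%:C) =
     cint a b (fun x => repr g x * (phi x)%:C)) -> f = g.
Proof.
move=> fg; apply/eqP; rewrite -subr_eq0; apply/eqP.
have key phi : test_fun a b phi ->
    cint a b (fun x => repr (f - g) x * (phi x)%:C) = 0.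
  move=> tp; have := cint_repr_lin (-1) g f (test_fun_good 0 tp).
  by rewrite scaleN1r addrC => ->; rewrite -fg// mulN1r addNr.
have F := ae_filter_ringOfSetsType mu.
apply: L2_ext.
  apply: filterS2 (fundamental_lemma (reL_sqi (f - g)) _) repr0 => [x ->|phi tp].
    by rewrite /reL => ->.
  by have := key phi tp; rewrite cint_test => -[].
apply: filterS2 (fundamental_lemma (imL_sqi (f - g)) _) repr0 => [x ->|phi tp].
  by rewrite /imL => ->.
by have := key phi tp; rewrite cint_test => -[].
Qed.

Lemma is_wderiv_unique k f g h : is_wderiv k f g -> is_wderiv k f h -> g = h.
Proof.
move=> fg fh; apply: L2_test_eq => phi tp.
have := fg phi tp; rewrite (fh phi tp) => /mulfI -> //.
by rewrite signr_eq0.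
Qed.

Lemma wderivE k f g : is_wderiv k f g -> wderiv k f = g.
Proof.
move=> fg; rewrite /wderiv; case: xgetP => [h _ /= fh|/(_ g)//].
exact: is_wderiv_unique fh fg.
Qed.

Lemma wderivP k f : has_wderiv k f -> is_wderiv k f (wderiv k f).
Proof. by move=> [g fg]; rewrite (wderivE fg). Qed.

Lemma wderiv_lin k (c : C) f g : has_wderiv k f -> has_wderiv k g ->
  wderiv k (c *: f + g) = c *: wderiv k f + wderiv k g.
Proof.
by move=> /wderivP df /wderivP dg; apply: wderivE; exact: is_wderiv_lin.
Qed.

Lemma has_wderiv0 f : has_wderiv 0 f.
Proof. by exists f => phi _; rewrite expr0 mul1r. Qed.

Lemma is_wderiv_comp k f g h : is_wderiv 1 f g -> is_wderiv k g h ->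
  is_wderiv k.+1 f h.
Proof.
move=> fg gh phi tp; have := fg _ (test_fun_derive1n k tp).
by rewrite (gh phi tp) mulrA -exprD; exact.
Qed.

(** Both hypotheses evaluate the integral of f against the derivative of phi
    of order k + 1. *)
Lemma is_wderiv_cancel k f g h : is_wderiv 1 f g -> is_wderiv k.+1 f h ->
  is_wderiv k g h.
Proof.
move=> fg fh phi tp; have := fg _ (test_fun_derive1n k tp).
have := fh phi tp; rewrite /derive1n/= => ->.
by rewrite -[k.+1]/(1 + k)%N exprD -mulrA => /mulfI ->//; rewrite signr_eq0.
Qed.

Lemma prim_affine_sqi (c : R) (g : R -> R) : sqi mu g -> sqi mu (fun x => c + prim a b g x).
Proof.
move=> sg; have := sqi_lin 1 (prim_sqi sg) (sqi_cst a b c); congr (sqi _ _).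
by apply/funext => x; rewrite mul1r addrC.
Qed.

Definition primC (g : L2 a b) (x : R) : C :=
  prim a b (reL g) x +i* prim a b (imL g) x.

Definition antideriv (q : R) (c : C) g : L2 a b :=
  mkL2 (prim_affine_sqi (Re (c - primC g q)) (reL_sqi g))
       (prim_affine_sqi (Im (c - primC g q)) (imL_sqi g)).

Lemma I_affine_parts (c : R) (g : R -> R) phi : sqi mu g -> test_fun a b phi ->
  I (fun x => (c + prim a b g x) * derive1 phi x) = - I (fun x => g x * phi x).
Proof.
move=> sg tp; have td := test_fun_derive1 tp.
have i1 := sqi_integr (leb_setT_fin a b) (test_fun_sqi td).
have i2 := sqi_integr (leb_setT_fin a b) (test_fun_sqiM (prim_sqi sg) td).
rewrite -prim_parts//; have := I_lin c i1 i2; rewrite I_test_derive1// mulr0 add0r => <-.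
by apply: eq_Rintegral => x _; ring.
Qed.

Lemma antideriv_wderiv q c g : is_wderiv 1 (antideriv q c g) g.
Proof.
have F := ae_filter_ringOfSetsType mu.
apply/is_wderiv1P => phi tp; have td := test_fun_derive1 tp.
have tds := test_fun_sqi td.
split.
  rewrite -(I_affine_parts (Re (c - primC g q)) (reL_sqi g) tp); apply: I_ae.
  - exact: sqi_measM (reL_sqi _) tds.
  - exact: sqi_measM (prim_affine_sqi _ (reL_sqi g)) tds.
  - by apply: filterS (mkL2_re (prim_affine_sqi (Re (c - primC g q)) (reL_sqi g))
      (prim_affine_sqi (Im (c - primC g q)) (imL_sqi g))) => x ->.
rewrite -(I_affine_parts (Im (c - primC g q)) (imL_sqi g) tp); apply: I_ae.
- exact: sqi_measM (imL_sqi _) tds.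
- exact: sqi_measM (prim_affine_sqi _ (imL_sqi g)) tds.
- by apply: filterS (mkL2_im (prim_affine_sqi (Re (c - primC g q)) (reL_sqi g))
    (prim_affine_sqi (Im (c - primC g q)) (imL_sqi g))) => x ->.
Qed.

Lemma antideriv_repr q c g :
  {ae mu, forall x, repr (antideriv q c g) x = c + (primC g x - primC g q)}.
Proof.
have F := ae_filter_ringOfSetsType mu.
apply: filterS (mkL2E (prim_affine_sqi (Re (c - primC g q)) (reL_sqi g))
    (prim_affine_sqi (Im (c - primC g q)) (imL_sqi g))) => x ->.
by case: c => c1 c2; rewrite /primC /=; simpc; congr (_ +i* _); ring.
Qed.

Lemma complex_dist_lt (z : C) (e : R) : `|Re z| < e -> `|Im z| < e ->
  `|z| < (2 * e)%:C.
Proof.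
move=> r i; rewrite normc_def ltcR.
have e0 : 0 < e by apply: le_lt_trans r.
rewrite -[ltRHS]ger0_norm; last lra.
rewrite -sqrtr_sqr ltr_sqrt ?exprn_gt0//; last lra.
rewrite -(real_normK (num_real (Re z))) -(real_normK (num_real (Im z))).
by have := normr_ge0 (Re z); have := normr_ge0 (Im z); nra.
Qed.

Lemma complex_cvg (T : Type) (F : set_system T) {FF : Filter F} (p q : T -> R) (l : C) :
  p x @[x --> F] --> Re l -> q x @[x --> F] --> Im l ->
  (p x +i* q x : C^o) @[x --> F] --> (l : C^o).
Proof.
move=> /cvgrPdist_lt pl /cvgrPdist_lt ql; apply/cvgrPdist_lt => e e0.
have [r0 eE] : 0 < Re e /\ e = (Re e)%:C.
  case: e e0 => e1 e2; rewrite ltcE /= => /andP[/eqP i0 r0]; split=> //.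
  by rewrite i0.
have e2 : 0 < Re e / 2 by lra.
apply: filterS2 (pl _ e2) (ql _ e2) => x px qx.
rewrite eE (_ : Re e = 2 * (Re e / 2)); last by lra.
by apply: complex_dist_lt; case: l {pl ql} px qx => l1 l2 /=.
Qed.

Lemma primC_continuous (c : C) g q :
  continuous (fun x => c + (primC g x - primC g q) : C^o).
Proof.
move=> x; case: c => c1 c2.
have cP := prim_continuous (reL_sqi g) (x := x).
have cQ := prim_continuous (imL_sqi g) (x := x).
pose P y := c1 + (prim a b (reL g) y - prim a b (reL g) q).
pose Q y := c2 + (prim a b (imL g) y - prim a b (imL g) q).
apply: (@complex_cvg _ _ _ P Q (P x +i* Q x)) => /=.
  by apply: cvgD; [exact: cvg_cst|apply: cvgB; [exact: cP|exact: cvg_cst]].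
by apply: cvgD; [exact: cvg_cst|apply: cvgB; [exact: cQ|exact: cvg_cst]].
Qed.

Lemma antideriv_trace q c g p :
  is_trace p (antideriv q c g) (c + (primC g p - primC g q)).
Proof.
exists (fun x => c + (primC g x - primC g q)); split=> //; last exact: antideriv_repr.
by apply: continuous_subspaceT; exact: primC_continuous.
Qed.

Lemma ae_leb_exists (P : R -> Prop) (c e : R) : a <= c -> c < e -> e <= b ->
  {ae mu, forall x, P x} -> exists2 x, c < x < e & P x.
Proof.
move=> ac ce eb /ae_leb[N [mN N0 PN]]; apply: contrapT => nex.
have sub : `]c, e[%classic `<=` N.
  move=> x /=; rewrite in_itv/= => /andP[cx xe]; apply: PN => /= Px.
  apply: nex; exists x; first by rewrite cx.
  by apply: Px; rewrite (le_lt_trans ac cx) (lt_le_trans xe eb).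
have lamE : @lebesgue_measure R [set` `]c, e[] = (e - c)%:E.
  by rewrite lebesgue_measure_itv/= lte_fin ce.
have : ((e - c)%:E <= 0)%E.
  rewrite -lamE -N0.
  by apply: le_measure => //; apply: mem_set => //; exact: measurable_itv.
by rewrite lee_fin leNgt subr_gt0 ce.
Qed.

(** A trace is visible from almost everywhere values near the point, hence
    does not depend on the continuous representative. *)
Lemma trace_near f c p : a <= p <= b -> is_trace p f c -> forall e : R, 0 < e ->
  exists2 d, 0 < d & {ae mu, forall x, `|x - p| < d -> `|repr f x - c| < e%:C}.
Proof.
move=> pab [g [cg fg gp]] e e0.
have pin : [set` `[a, b]] p by rewrite /= in_itv.
have eC : 0 < e%:C :> C by rewrite ltcR.
have /(_ p pin) /cvgrPdist_lt /(_ _ eC) := (subspace_continuousP _ g).1 cg.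
move=> /nbhs_ballP[d /= d0 hd]; exists d => //.
have F := ae_filter_ringOfSetsType mu.
have inab : {ae mu, forall x, a < x < b} by apply/ae_leb; apply: aeW.
apply: filterS2 fg inab => x -> /andP[ax xb] xp; rewrite distrC -gp.
by apply: hd; rewrite /ball/= ?in_itv/= ?(ltW ax) ?(ltW xb)// distrC.
Qed.

Lemma trace_unique f c c' p : a <= p <= b -> is_trace p f c -> is_trace p f c' -> c = c'.
Proof.
move=> pab fc fc'; apply/eqP; rewrite -subr_eq0 -normr_le0.
apply/negPn/negP; rewrite normr_le0 -normr_gt0 => nc.
have [e e0 ce] : exists2 e : R, 0 < e & `|c - c'| = e%:C.
  move: nc; rewrite normc_def ltcR => e0.
  by exists (Num.sqrt (Re (c - c') ^+ 2 + Im (c - c') ^+ 2)).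
have e2 : 0 < e / 2 by lra.
have [d d0 h] := trace_near pab fc e2; have [d' d'0 h'] := trace_near pab fc' e2.
have F := ae_filter_ringOfSetsType mu.
pose lo := Num.max a (p - Num.min d d'); pose hi := Num.min b (p + Num.min d d').
have [||||x /andP[lx xh] [h1 h2]] := @ae_leb_exists (fun x =>
    (`|x - p| < d -> `|repr f x - c| < (e / 2)%:C) /\
    (`|x - p| < d' -> `|repr f x - c'| < (e / 2)%:C)) lo hi.
- by rewrite le_max lexx.
- have [ap pb] := andP pab; have m0 : 0 < Num.min d d' by rewrite lt_min d0.
  rewrite gt_max !lt_min ab /=.
  by apply/and3P; split; lra.
- by rewrite ge_min lexx.
- by apply: filterS2 h h' => x.
have xp : `|x - p| < Num.min d d'.
  move: lx xh; rewrite gt_max lt_min => /andP[_ lx] /andP[_ xh].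
  by rewrite ltr_distl lx.
move: xp; rewrite lt_min => /andP[/h1 {}h1 /h2 {}h2].
have := ler_distD (repr f x) c c'; rewrite ce distrC => h3.
have := le_lt_trans h3 (ltrD h1 h2).
by rewrite -rmorphD/= ltcR -splitr ltxx.
Qed.

(** By the du Bois-Reymond lemma f differs from a primitive of g by a
    constant, which the trace determines. *)
Lemma antideriv_unique f g q c : a <= q <= b -> is_wderiv 1 f g -> is_trace q f c ->
  f = antideriv q c g.
Proof.
move=> qab /is_wderiv1P fg fc.
have F := ae_filter_ringOfSetsType mu.
have [r hr] := weak_derivative_prim ab (reL_sqi f) (reL_sqi g) (fun phi tp => (fg phi tp).1).
have [s hs] := weak_derivative_prim ab (imL_sqi f) (imL_sqi g) (fun phi tp => (fg phi tp).2).
have E : f = antideriv q ((r +i* s) + primC g q) g.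
  rewrite -[LHS]reprK -[RHS]reprK; apply/L2_eqP.
  have := antideriv_repr q ((r +i* s) + primC g q) g.
  apply: filterS3 hr hs => x rx sx ->; rewrite addrA addrAC addrK.
  by move: rx sx; rewrite /reL /imL /primC; case: (repr f x) => ? ? /= -> ->.
rewrite E; congr (antideriv _ _ _).
have := antideriv_trace q ((r +i* s) + primC g q) g q.
by rewrite -E subrr addr0 => h; exact: trace_unique qab h fc.
Qed.

End WeakDerivative.

(** * Bounds for antiderivatives *)

Section AntiderivativeBounds.
Context {R : realType} {a b : R}.
Local Notation C := R[i].
Local Notation mu := (leb a b).
Local Notation I h := (\int[mu]_x h x).
Local Notation Re := complex.Re.
Local Notation Im := complex.Im.
Local Notation n2 := (inorm (@ipL R a b)).
Implicit Types f g h : L2 a b.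

Hypothesis ab : a < b.

Let K : R := Num.sqrt (I (cst 1)).

Let I1 : 0 <= I (cst 1).
Proof. exact: I_ge0. Qed.

Let prim_bound (h : R -> R) g x : sqi mu h -> I (fun y => h y ^+ 2) <= n2 g ^+ 2 ->
  `|prim a b h x| <= K * n2 g.
Proof.
move=> sh hg; rewrite -(@ler_pXn2r _ 2)// ?nnegrE ?mulr_ge0 ?sqrtr_ge0//.
rewrite real_normK ?num_real// exprMn sqr_sqrtr// mulrC.
by apply: le_trans (prim_sqr_le x sh) _; exact: ler_wpM2r.
Qed.

Let reL_le g : I (fun y => reL g y ^+ 2) <= n2 g ^+ 2.
Proof.
rewrite (inorm_sqr ipL_inner) ipLE -[leLHS]addr0 lerD//.
by apply: I_ge0 => y; rewrite -expr2 sqr_ge0.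
Qed.

Let imL_le g : I (fun y => imL g y ^+ 2) <= n2 g ^+ 2.
Proof.
rewrite (inorm_sqr ipL_inner) ipLE -[leLHS]add0r lerD//.
by apply: I_ge0 => y; rewrite -expr2 sqr_ge0.
Qed.

(** The integral of g from q to p. *)
Definition jump (q p : R) g : C := primC g p - primC g q.

Let Re_jump q p g : `|Re (jump q p g)| <= 2 * (K * n2 g).
Proof.
have := prim_bound p (reL_sqi g) (reL_le g); have := prim_bound q (reL_sqi g) (reL_le g).
rewrite /jump /primC /= => h1 h2; apply: le_trans (ler_normB _ _) _; lra.
Qed.

Let Im_jump q p g : `|Im (jump q p g)| <= 2 * (K * n2 g).
Proof.
have := prim_bound p (imL_sqi g) (imL_le g); have := prim_bound q (imL_sqi g) (imL_le g).
rewrite /jump /primC /= => h1 h2; apply: le_trans (ler_normB _ _) _; lra.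
Qed.

Lemma jump_bounded q p : exists2 M, 0 <= M & forall g, Re `|jump q p g| <= M * n2 g.
Proof.
exists (4 * K) => [|g]; first by rewrite mulr_ge0 ?sqrtr_ge0.
have := Re_jump q p g; have := Im_jump q p g; case: (jump q p g) => z1 z2 /= h1 h2.
have n0 : 0 <= K * n2 g by rewrite mulr_ge0 ?sqrtr_ge0.
rewrite -(@ler_pXn2r _ 2)// ?nnegrE ?sqrtr_ge0//; last by rewrite -mulrA mulr_ge0.
rewrite sqr_sqrtr ?addr_ge0 ?sqr_ge0// -(real_normK (num_real z1)) -(real_normK (num_real z2)).
by rewrite -mulrA; have := normr_ge0 z1; have := normr_ge0 z2; nra.
Qed.

(** The Poincare inequality, from the pointwise Cauchy-Schwarz bound for
    primitives. *)
Lemma antideriv_bounded q : exists2 M, 0 <= M & forall g, n2 (antideriv q 0 g) <= M * n2 g.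
Proof.
exists (4 * K * K) => [|g]; first by rewrite !mulr_ge0 ?sqrtr_ge0.
have F := ae_filter_ringOfSetsType mu.
have n0 : 0 <= K * n2 g by rewrite mulr_ge0 ?sqrtr_ge0.
have key (h e : R -> R) : sqi mu h -> sqi mu e -> {ae mu, forall x, h x = e x} ->
    (forall x, `|e x| <= 2 * (K * n2 g)) ->
    I (fun x => h x * h x) <= (2 * (K * n2 g)) ^+ 2 * I (cst 1).
  move=> sh se he eb.
  have -> : I (fun x => h x * h x) = I (fun x => e x * e x).
    apply: I_ae; [exact: (sqi_measM sh sh)|exact: (sqi_measM se se)|].
    by apply: filterS he => x ->.
  have i1 := sqi_integr (leb_setT_fin a b) (sqi_cst a b 1).
  rewrite -RintegralZl//; apply: le_Rintegral => //.
  - exact: sqiM.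
  - have := integrableZl measurableT ((2 * (K * n2 g)) ^+ 2) i1; exact: eq_integrable.
  - move=> x _ /=; rewrite mulr1 -expr2 -(real_normK (num_real (e x))).
    by rewrite ler_pXn2r ?nnegrE//; lra.
have rE : {ae mu, forall x, reL (antideriv q 0 g) x = Re (jump q x g)}.
  by apply: filterS (antideriv_repr q 0 g) => x; rewrite /reL => ->; rewrite add0r.
have iE : {ae mu, forall x, imL (antideriv q 0 g) x = Im (jump q x g)}.
  by apply: filterS (antideriv_repr q 0 g) => x; rewrite /imL => ->; rewrite add0r.
have sJr : sqi mu (fun x => Re (jump q x g)).
  have := prim_affine_sqi (- prim a b (reL g) q) (reL_sqi g).
  by congr (sqi _ _); apply/funext => x; rewrite /jump /= addrC.
have sJi : sqi mu (fun x => Im (jump q x g)).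
  have := prim_affine_sqi (- prim a b (imL g) q) (imL_sqi g).
  by congr (sqi _ _); apply/funext => x; rewrite /jump /= addrC.
have h1 := key _ _ (reL_sqi _) sJr rE (fun x => Re_jump q x g).
have h2 := key _ _ (imL_sqi _) sJi iE (fun x => Im_jump q x g).
rewrite -(@ler_pXn2r _ 2)// ?nnegrE ?inorm_ge0//; last first.
  by rewrite !mulr_ge0 ?sqrtr_ge0.
rewrite (inorm_sqr ipL_inner) ipLE; apply: le_trans (lerD h1 h2) _.
rewrite -[I (cst 1)]sqr_sqrtr// -/K.
have := sqr_ge0 (K * n2 g * K); rewrite !exprMn; lra.
Qed.

(** Linearity is read off the uniqueness of antiderivatives instead of their
    representatives. *)
Lemma antideriv_lin q (c x y : C) f g : a <= q <= b ->
  antideriv q (c * x + y) (c *: f + g) = c *: antideriv q x f + antideriv q y g.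
Proof.
move=> qab; apply/esym/antideriv_unique => //.
  by apply: is_wderiv_lin; exact: antideriv_wderiv.
have := is_trace_lin c (antideriv_trace q x f q) (antideriv_trace q y g q).
by rewrite !subrr !addr0.
Qed.

Lemma antideriv_trace0 q g : is_trace q (antideriv q 0 g) 0.
Proof. by have := antideriv_trace q 0 g q; rewrite subrr addr0. Qed.

Lemma antideriv0_lin q (c : C) f g : a <= q <= b ->
  antideriv q 0 (c *: f + g) = c *: antideriv q 0 f + antideriv q 0 g.
Proof. by move=> qab; rewrite -antideriv_lin// mulr0 addr0. Qed.

Lemma jump_lin q p (c : C) f g : a <= q <= b -> a <= p <= b ->
  jump q p (c *: f + g) = c * jump q p f + jump q p g.
Proof.
move=> qab pab; apply: (trace_unique ab pab (f := antideriv q 0 (c *: f + g))).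
  by have := antideriv_trace q 0 (c *: f + g) p; rewrite add0r.
rewrite antideriv0_lin//; apply: is_trace_lin.
  by have := antideriv_trace q 0 f p; rewrite add0r.
by have := antideriv_trace q 0 g p; rewrite add0r.
Qed.

Definition antideriv2 q g := antideriv q 0 (antideriv q 0 g).

Lemma H2_vanishing_antideriv2 q g : H2_vanishing q (antideriv2 q g).
Proof.
have d1 : is_wderiv 1 (antideriv2 q g) (antideriv q 0 g) by exact: antideriv_wderiv.
have d2 : is_wderiv 2 (antideriv2 q g) g.
  by apply: is_wderiv_comp d1 _; exact: antideriv_wderiv.
split; [|exact: antideriv_trace0|exists (antideriv q 0 g) => //; exact: antideriv_trace0].
move=> [|[|[|]]]// _; [exact: has_wderiv0|by exists (antideriv q 0 g)|by exists g].
Qed.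

Lemma wderiv1_antideriv2 q g : wderiv 1 (antideriv2 q g) = antideriv q 0 g.
Proof. by apply: wderivE => //; exact: antideriv_wderiv. Qed.

Lemma wderiv2_antideriv2 q g : wderiv 2 (antideriv2 q g) = g.
Proof.
apply: wderivE => //; apply: (@is_wderiv_comp _ _ _ _ _ (antideriv q 0 g)).
  exact: antideriv_wderiv.
exact: antideriv_wderiv.
Qed.

(** Uniqueness of antiderivatives, applied to the first derivative and then
    to the function. *)
Lemma H2_vanishingE q f : a <= q <= b -> H2_vanishing q f -> f = antideriv2 q (wderiv 2 f).
Proof.
move=> qab [sf f0 [f' ff' f'0]].
have fE := antideriv_unique ab qab ff' f0.
have f2 : is_wderiv 1 f' (wderiv 2 f).
  by apply: is_wderiv_cancel ff' _; apply: wderivP => //; exact: sf.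
by rewrite [LHS]fE; congr (antideriv _ _ _); exact: antideriv_unique f2 f'0.
Qed.

Lemma antideriv2_trace q p g :
  is_trace p (antideriv2 q g) (jump q p (antideriv q 0 g)).
Proof. by have := antideriv_trace q 0 (antideriv q 0 g) p; rewrite add0r. Qed.

End AntiderivativeBounds.

(** * Completeness of the energy space *)

Lemma Re_D (R : realType) (x y : R[i]) : complex.Re (x + y) = complex.Re x + complex.Re y.
Proof. by case: x y => ? ? [? ?]. Qed.

Lemma hilbert_ipL (R : realType) (a b : R) : hilbert (@ipL R a b).
Proof. exact: banach_hilbert ipL_inner ipL_banach. Qed.

Section EnergySpace.
Context {R : realType} (l0 l1 l2 l3 : R).
Hypotheses (l01 : l0 < l1) (l12 : l1 < l2) (l23 : l2 < l3).
Local Notation C := R[i].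
Local Notation Re := complex.Re.
Local Notation bbL := (bbL l0 l1 l2 l3).
Local Notation bbH := (bbH l0 l1 l2 l3).

Definition ip_bbL : bbL -> bbL -> R :=
  prod_ip (prod_ip (@ipL R l0 l1) (@ipL R l1 l2)) (@ipL R l2 l3).

Lemma hilbert_bbL : hilbert ip_bbL.
Proof.
by apply: hilbert_prod; [apply: hilbert_prod|]; exact: hilbert_ipL.
Qed.

Lemma Re_dot_bbL x y : Re (dot_bbL x y) = ip_bbL x y.
Proof. by case: x y => -[u v] w [[u' v'] w']; rewrite /dot_bbL !Re_D. Qed.

(** The derivatives that enter the energy norm. *)
Definition highest (x : bbL) : bbL := (wderiv 2 x.1.1, wderiv 1 x.1.2, wderiv 2 x.2).

(** The difference at l2 of the pieces obtained by integrating from l0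
    through l1 and from l3. *)
Definition mismatch (y : bbL) : C := jump l0 l1 (antideriv l0 0 y.1.1) +
  jump l1 l2 y.1.2 - jump l3 l2 (antideriv l3 0 y.2).

(** Integration from the clamped ends inwards; the middle piece starts at l1
    from the value of the left piece. *)
Definition rebuild (y : bbL) : bbL := (antideriv2 l0 y.1.1,
  antideriv l1 (jump l0 l1 (antideriv l0 0 y.1.1)) y.1.2, antideriv2 l3 y.2).

Let i0 : l0 <= l0 <= l1. Proof. by rewrite lexx ltW. Qed.
Let i01 : l0 <= l1 <= l1. Proof. by rewrite lexx ltW. Qed.
Let i1 : l1 <= l1 <= l2. Proof. by rewrite lexx ltW. Qed.
Let i12 : l1 <= l2 <= l2. Proof. by rewrite lexx ltW. Qed.
Let i2 : l2 <= l2 <= l3. Proof. by rewrite lexx ltW. Qed.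
Let i3 : l2 <= l3 <= l3. Proof. by rewrite lexx ltW. Qed.

Lemma in_bbH_rebuild x : in_bbH x -> x = rebuild (highest x) /\ mismatch (highest x) = 0.
Proof.
case: x => [[u v] w] [Hu Hv Hw [c uc vc] [e ve we]].
have uE := H2_vanishingE l01 i0 Hu; have wE := H2_vanishingE l23 i3 Hw.
have cE : c = jump l0 l1 (antideriv l0 0 (wderiv 2 u)).
  by apply: (trace_unique l01 i01 uc); rewrite [X in is_trace _ X]uE; exact: antideriv2_trace.
have v1 : is_wderiv 1 v (wderiv 1 v) by apply: wderivP => //; exact: Hv.
have vE := antideriv_unique l12 i1 v1 vc.
have eE : e = jump l3 l2 (antideriv l3 0 (wderiv 2 w)).
  by apply: (trace_unique l23 i2 we); rewrite [X in is_trace _ X]wE; exact: antideriv2_trace.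
have eE' : e = c + jump l1 l2 (wderiv 1 v).
  by apply: (trace_unique l12 i12 ve); rewrite [X in is_trace _ X]vE; exact: antideriv_trace.
rewrite /rebuild /highest /mismatch /= -cE -eE -eE' subrr; split=> //.
by congr (_, _, _).
Qed.

Lemma rebuild_in_bbH y : mismatch y = 0 -> in_bbH (rebuild y) /\ highest (rebuild y) = y.
Proof.
case: y => [[h k] m]; rewrite /mismatch /rebuild /highest/= => /eqP; rewrite subr_eq0 => /eqP E.
have d1 := antideriv_wderiv l12 l1 (jump l0 l1 (antideriv l0 0 h)) k.
split; last first.
  by rewrite !wderiv2_antideriv2// (wderivE d1).
split.
- exact: H2_vanishing_antideriv2.
- by move=> [|[|]]// _; [exact: has_wderiv0|exists k].
- exact: H2_vanishing_antideriv2.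
- exists (jump l0 l1 (antideriv l0 0 h)); first exact: antideriv2_trace.
  by have := antideriv_trace l1 (jump l0 l1 (antideriv l0 0 h)) k l1; rewrite subrr addr0.
- exists (jump l3 l2 (antideriv l3 0 m)); last exact: antideriv2_trace.
  by rewrite -E; exact: antideriv_trace.
Qed.

Lemma bbH_valP (x : bbH) : in_bbH (bbH_val x).
Proof. by have /asboolP := valP x. Qed.

Lemma bbH_mk (y : bbL) : in_bbH y -> exists x : bbH, bbH_val x = y.
Proof.
move=> yH; have yP : y \in @bbH_pred R l0 l1 l2 l3 by apply/asboolP.
by exists (MkbbH yP).
Qed.

Lemma bbH_val_lin : clinear (@bbH_val R l0 l1 l2 l3).
Proof. by move=> c x y. Qed.

Lemma highest_lin c x y : in_bbH x -> in_bbH y ->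
  highest (c *: x + y) = c *: highest x + highest y.
Proof.
case: x y => [[u v] w] [[u' v'] w'] [[Hu _ _] Hv [Hw _ _] _ _] [[Hu' _ _] Hv' [Hw' _ _] _ _].
rewrite /highest /=; congr (_, _, _).
- exact: (wderiv_lin c (Hu 2 isT) (Hu' 2 isT)).
- exact: (wderiv_lin c (Hv 1 isT) (Hv' 1 isT)).
- exact: (wderiv_lin c (Hw 2 isT) (Hw' 2 isT)).
Qed.

Lemma highest_clinear : clinear (fun x : bbH => highest (bbH_val x)).
Proof. by move=> c x y; rewrite -highest_lin//; exact: bbH_valP. Qed.

Lemma mismatch_lin : clinear mismatch.
Proof.
move=> c x y; rewrite /mismatch /= (antideriv0_lin l01)// (antideriv0_lin l23)//.
rewrite (jump_lin l01)// (jump_lin l12)// (jump_lin l23)//.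
suff E (A B D A' B' D' : C) : c * A + A' + (c * B + B') - (c * D + D') =
    c * (A + B - D) + (A' + B' - D') by exact: E.
by ring.
Qed.

Local Notation nL := (inorm ip_bbL).
Local Notation n2 := (inorm (@ipL _ _ _)).

Lemma bounded_proj1 : bounded_by nL n2 (fun y : bbL => y.1.1).
Proof.
exists 1 => // y; rewrite mul1r /inorm ler_wsqrtr// /ip_bbL /prod_ip /=.
by rewrite -addrA lerDl addr_ge0 ?(ip_ge0 ipL_inner).
Qed.

Lemma bounded_proj2 : bounded_by nL n2 (fun y : bbL => y.1.2).
Proof.
exists 1 => // y; rewrite mul1r /inorm ler_wsqrtr// /ip_bbL /prod_ip /=.
by rewrite addrAC lerDr addr_ge0 ?(ip_ge0 ipL_inner).
Qed.

Lemma bounded_proj3 : bounded_by nL n2 (fun y : bbL => y.2).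
Proof.
exists 1 => // y; rewrite mul1r /inorm ler_wsqrtr// /ip_bbL /prod_ip /=.
by rewrite lerDr addr_ge0 ?(ip_ge0 ipL_inner).
Qed.

Lemma bounded_trace1 :
  bounded_by nL abs (fun y : bbL => jump l0 l1 (antideriv l0 0 y.1.1)).
Proof.
apply: (bounded_by_comp (bounded_by_comp bounded_proj1 (antideriv_bounded l0))).
exact: jump_bounded.
Qed.

Lemma bounded_mismatch : bounded_by nL abs mismatch.
Proof.
apply: bounded_by_add absD _ (bounded_by_opp absN _).
  apply: bounded_by_add absD bounded_trace1 _.
  exact: bounded_by_comp bounded_proj2 (jump_bounded _ _).
apply: (bounded_by_comp (bounded_by_comp bounded_proj3 (antideriv_bounded l3))).
exact: jump_bounded.
Qed.

Definition ip_bbH (x y : bbH) : R := ip_bbL (highest (bbH_val x)) (highest (bbH_val y)).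

Lemma Re_dot_bbH x y : Re (dot_bbH x y) = ip_bbH x y.
Proof.
rewrite /dot_bbH /ip_bbH /highest.
by case: (bbH_val x) (bbH_val y) => -[u v] w [[u' v'] w']; rewrite !Re_D.
Qed.

(** Taking highest derivatives is isometric, and its range is the kernel of
    the mismatch, which is bounded; hence the range is closed. *)
Lemma hilbert_bbH : hilbert ip_bbH.
Proof.
apply: (hilbert_embed highest_clinear _ hilbert_bbL) => [x x0|x y xy].
  apply: val_inj; have [xE _] := in_bbH_rebuild (bbH_valP x).
  have [zE _] := in_bbH_rebuild (bbH_valP 0).
  rewrite -[LHS]/(bbH_val x) -[RHS]/(bbH_val 0) xE zE x0; congr rebuild.
  exact/esym/(clinear0 highest_clinear).
have [|yH yE] := @rebuild_in_bbH y; last first.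
  by have [z zE] := bbH_mk yH; exists z; rewrite zE.
have [M M0 hM] := bounded_mismatch; have [iL _] := hilbert_bbL.
apply: abs_eq0; apply/ler_addgt0Pr => e e0; rewrite add0r.
have d0 : 0 < e / (M + 1) by rewrite divr_gt0//; lra.
have [|N /(_ N (leqnn N)) hN] := xy ((e / (M + 1)) ^+ 2); first exact: exprn_gt0.
(* the mismatch of every x N vanishes, which leaves that of the error *)
have mE : mismatch y = - mismatch (highest (bbH_val (x N)) - y).
  have [_ xN] := in_bbH_rebuild (bbH_valP (x N)).
  by rewrite (clinearB _ _ mismatch_lin) xN sub0r opprK.
rewrite mE absN; apply: le_trans (hM _) _.
have : nL (highest (bbH_val (x N)) - y) <= e / (M + 1).
  rewrite -(@ler_pXn2r _ 2)// ?nnegrE ?inorm_ge0 ?(ltW d0)// (inorm_sqr iL).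
  exact: ltW.
move=> /(ler_wpM2l M0)/le_trans; apply.
by rewrite mulrA ler_pdivrMr ?ltr_wpDl// mulrC ler_wpM2l ?(ltW e0)//; lra.
Qed.

End EnergySpace.

(** * The variational problem for the resolvent *)

(** As ip (i x) z = - ip x (i z), a real identity valid for all z is stable
    under complex combinations of x. *)
Lemma semi_clin (R : realType) (V : lmodType R[i]) (ip : V -> V -> R) (c : R[i]) x y z :
  semi_inner ip ->
  ip (c *: x + y) z = complex.Re c * ip x z - complex.Im c * ip x ('i *: z) + ip y z.
Proof.
move=> si.
have -> : c *: x + y = (complex.Re c)%:C *: x + ((complex.Im c)%:C *: ('i *: x) + y).
  rewrite scalerA addrA -scalerDl; congr (_ *: _ + _).
  by case: c => c1 c2; simpc.
rewrite !(semiP si).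
suff -> : ip ('i *: x) z = - ip x ('i *: z) by ring.
rewrite -(semiI si x) scalerA.
have -> : 'i * 'i = -1 :> R[i] by have := sqr_i R; rewrite expr2.
rewrite scaleN1r !(semiC si ('i *: x)).
have := semiP si (-1) z z ('i *: x); have := semiP si 1 0 0 ('i *: x).
have := semiP si (-1) z 0 ('i *: x).
rewrite !rmorphN1 !rmorph1 scale1r !scaleN1r !addr0; lra.
Qed.

Section Generator.
Context {R : realType} (l0 l1 l2 l3 : R).
Hypotheses (l01 : l0 < l1) (l12 : l1 < l2) (l23 : l2 < l3).
Variables (rho1 rho2 beta : R).
Hypotheses (rho1_ge0 : 0 <= rho1) (rho2_ge0 : 0 <= rho2) (beta_ge0 : 0 <= beta).
Local Notation C := R[i].
Local Notation Re := complex.Re.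
Local Notation bbL := (bbL l0 l1 l2 l3).
Local Notation bbH := (bbH l0 l1 l2 l3).
Local Notation calH := (calH l0 l1 l2 l3).
Local Notation nL := (inorm (@ip_bbL R l0 l1 l2 l3)).
Local Notation n2 := (inorm (@ipL _ _ _)).
Local Notation ip_bbL := (@ip_bbL R l0 l1 l2 l3).
Local Notation ip_bbH := (@ip_bbH R l0 l1 l2 l3).

Let iL : is_inner ip_bbL. Proof. by case: (hilbert_bbL l0 l1 l2 l3). Qed.
Let iH : is_inner ip_bbH. Proof. by case: (hilbert_bbH l01 l12 l23). Qed.

(** The quantities on which the three damping terms act. *)
Definition damp (x : bbL) : bbL := (wderiv 1 x.1.1, x.1.2, wderiv 1 x.2).

Definition ip_damp (x y : bbL) : R :=
  rho1 * ipL x.1.1 y.1.1 + beta * ipL x.1.2 y.1.2 + rho2 * ipL x.2 y.2.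

Lemma semi_damp : semi_inner ip_damp.
Proof.
apply: semi_add; first apply: semi_add; apply: semi_scale => //.
- by apply: (@semi_pull _ _ _ _ (fun x : bbL => x.1.1)) => //; exact: inner_semi ipL_inner.
- by apply: (@semi_pull _ _ _ _ (fun x : bbL => x.1.2)) => //; exact: inner_semi ipL_inner.
- by apply: (@semi_pull _ _ _ _ (fun x : bbL => x.2)) => //; exact: inner_semi ipL_inner.
Qed.

Lemma ip_damp_le x : ip_damp x x <= (rho1 + beta + rho2) * ip_bbL x x.
Proof.
have u0 := ip_ge0 ipL_inner x.1.1; have v0 := ip_ge0 ipL_inner x.1.2.
have w0 := ip_ge0 ipL_inner x.2.
rewrite /ip_damp ![in leRHS]mulrDl.
have -> : ip_bbL x x = ipL x.1.1 x.1.1 + ipL x.1.2 x.1.2 + ipL x.2 x.2 by [].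
move: (ipL x.1.1 x.1.1) (ipL x.1.2 x.1.2) (ipL x.2 x.2) u0 v0 w0 => u v w u0 v0 w0.
by apply: lerD; [apply: lerD|]; apply: ler_wpM2l => //; lra.
Qed.

Lemma damp_clinear : clinear (fun x : bbH => damp (bbH_val x)).
Proof.
move=> c x y; rewrite bbH_val_lin.
move: (bbH_val x) (bbH_val y) (bbH_valP x) (bbH_valP y).
move=> [[u v] w] [[u' v'] w'] [[Hu _ _] Hv [Hw _ _] _ _] [[Hu' _ _] Hv' [Hw' _ _] _ _].
rewrite /damp /=; congr (_, _, _).
- exact: (wderiv_lin c (Hu 1 isT) (Hu' 1 isT)).
- exact: (wderiv_lin c (Hw 1 isT) (Hw' 1 isT)).
Qed.

Lemma bounded_by_bbL (J : bbL -> bbL) :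
  bounded_by nL n2 (fun y => (J y).1.1) -> bounded_by nL n2 (fun y => (J y).1.2) ->
  bounded_by nL n2 (fun y => (J y).2) -> bounded_by nL nL J.
Proof.
have sL a b := inner_semi (@ipL_inner R a b).
move=> bu bv bw.
have b12 := @bounded_by_prod R bbL (L2 l0 l1) (L2 l1 l2) nL _ _
  (fun y => (J y).1) (sL l0 l1) (sL l1 l2) bu bv.
have [i12 _] := hilbert_prod (@hilbert_ipL R l0 l1) (@hilbert_ipL R l1 l2).
exact: (@bounded_by_prod R bbL (L2 l0 l1 * L2 l1 l2)%type (L2 l2 l3) nL _ _
  J (inner_semi i12) (sL l2 l3) b12 bw).
Qed.

(** The constant of integration of the middle piece is itself a bounded
    functional of y. *)
Lemma bounded_rebuild_mid : bounded_by nL n2 (fun y : bbL => (rebuild y).1.2).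
Proof.
have i1 : l1 <= l1 <= l2 by rewrite lexx ltW.
have E (y : bbL) : (rebuild y).1.2 = jump l0 l1 (antideriv l0 0 y.1.1) *:
    antideriv l1 1 0 + antideriv l1 0 y.1.2.
  by rewrite -antideriv_lin// scaler0 add0r mulr1 addr0.
have -> : (fun y : bbL => (rebuild y).1.2) = (fun y : bbL =>
    jump l0 l1 (antideriv l0 0 y.1.1) *: antideriv l1 1 0 + antideriv l1 0 y.1.2).
  exact/funext.
apply: bounded_by_add; first exact: (inormD ipL_inner).
  have cb : bounded_by (@abs R) n2 (fun z : C => z *: antideriv l1 1 (0 : L2 l1 l2)).
    exists (n2 (antideriv l1 1 (0 : L2 l1 l2))) => [|z]; first exact: inorm_ge0.
    by rewrite (nrmZ ipL_banach) mulrC.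
  exact: (bounded_by_comp (bounded_trace1 l0 l1 l2 l3) cb).
exact: bounded_by_comp (bounded_proj2 l0 l1 l2 l3) (antideriv_bounded _).
Qed.

Lemma bounded_rebuild : bounded_by nL nL (@rebuild R l0 l1 l2 l3).
Proof.
apply: bounded_by_bbL; [|exact: bounded_rebuild_mid|].
  apply: (bounded_by_comp (bounded_by_comp (bounded_proj1 l0 l1 l2 l3)
    (antideriv_bounded l0))); exact: antideriv_bounded.
apply: (bounded_by_comp (bounded_by_comp (bounded_proj3 l0 l1 l2 l3)
  (antideriv_bounded l3))); exact: antideriv_bounded.
Qed.

Lemma bounded_damp : bounded_by nL nL (fun y => damp (rebuild y)).
Proof.
apply: bounded_by_bbL; [|exact: bounded_rebuild_mid|].
  have -> : (fun y : bbL => (damp (rebuild y)).1.1) = (fun y => antideriv l0 0 y.1.1).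
    by apply/funext => y; exact: wderiv1_antideriv2.
  exact: (bounded_by_comp (bounded_proj1 l0 l1 l2 l3) (antideriv_bounded l0)).
have -> : (fun y : bbL => (damp (rebuild y)).2) = (fun y => antideriv l3 0 y.2).
  by apply/funext => y; exact: wderiv1_antideriv2.
exact: (bounded_by_comp (bounded_proj3 l0 l1 l2 l3) (antideriv_bounded l3)).
Qed.

Section Resolvent.
Variable h : R.
Hypothesis h_gt0 : 0 < h.

(** The form that remains of U - h A U = F when the position is eliminated. *)
Definition res_form (x y : bbH) : R := ip_bbL (bbH_val x) (bbH_val y) +
  (h ^+ 2 * ip_bbH x y + h * ip_damp (damp (bbH_val x)) (damp (bbH_val y))).

Lemma res_form_semi : semi_inner res_form.
Proof.
apply: semi_add; first exact: semi_pull (@bbH_val_lin _ _ _ _ _) (inner_semi iL).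
apply: semi_add.
  by apply: semi_scale (sqr_ge0 h) (inner_semi iH).
exact: semi_scale (ltW h_gt0) (semi_pull damp_clinear semi_damp).
Qed.

Lemma res_form_ge x : ip_bbL (bbH_val x) (bbH_val x) <= res_form x x /\
  h ^+ 2 * ip_bbH x x <= res_form x x.
Proof.
have a0 := ip_ge0 iL (bbH_val x).
have b0 := mulr_ge0 (sqr_ge0 h) (ip_ge0 iH x).
have c0 := mulr_ge0 (ltW h_gt0) (semi_ge0 semi_damp (damp (bbH_val x))).
by rewrite /res_form; split; lra.
Qed.

(** The energy product controls the lower-order terms, as functions are
    rebuilt from their highest derivatives; conversely it is a summand, with
    weight h^2. *)
Lemma hilbert_res_form : hilbert res_form.
Proof.
have sL := inner_semi iL.
have [M M0 hM] := bounded_by_sqr sL sL bounded_rebuild.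
have [N N0 hN] := bounded_by_sqr sL sL bounded_damp.
pose K := M + h ^+ 2 + h * ((rho1 + beta + rho2) * N) + 1.
have r0 : 0 <= rho1 + beta + rho2 by rewrite !addr_ge0.
have K0 : 0 < K by rewrite ltr_wpDl// !addr_ge0 ?mulr_ge0 ?(ltW h_gt0).
apply: (hilbert_equiv (c := h ^+ 2) (K := K) (hilbert_bbH l01 l12 l23) res_form_semi) => //.
- by rewrite exprn_gt0.
- by move=> x; case: (res_form_ge x).
move=> x; have [xE _] := in_bbH_rebuild l01 l12 l23 (bbH_valP x).
have := hM (highest (bbH_val x)); have := hN (highest (bbH_val x)); rewrite -xE.
rewrite -/(ip_bbH x x) => h1 h2.
have h3 := ip_damp_le (damp (bbH_val x)).
have h4 := ler_wpM2l r0 h1.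
have h5 := ler_wpM2l (ltW h_gt0) (le_trans h3 h4).
have h6 := ip_ge0 iH x.
by rewrite /res_form /K !mulrDl mul1r -!mulrA; lra.
Qed.

(** The right-hand side is bounded because each of its terms is dominated by
    one summand of the form. *)
Lemma res_form_solve (f : bbH) (g : bbL) : exists x, forall y,
  res_form x y = ip_bbL g (bbH_val y) - h * ip_bbH f y.
Proof.
apply: (riesz (K := nL g + inorm ip_bbH f) hilbert_res_form).
  move=> a x y; rewrite bbH_val_lin (ipDr iL) (ipZr iL) (ipDr iH) (ipZr iH).
  move: (ip_bbL _ _) (ip_bbL _ _) (ip_bbH _ _) (ip_bbH _ _) => p q r s.
  by ring.
move=> x; apply: le_trans (ler_normB _ _) _; rewrite mulrDl lerD//.
  apply: le_trans (cauchy_schwarz iL _ _) _; apply: ler_wpM2l; first exact: inorm_ge0.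
  by rewrite /inorm ler_wsqrtr//; case: (res_form_ge x).
rewrite normrM gtr0_norm//.
apply: le_trans (ler_wpM2l (ltW h_gt0) (cauchy_schwarz iH _ _)) _.
rewrite mulrCA; apply: ler_wpM2l; first exact: inorm_ge0.
rewrite -(ger0_norm (ltW h_gt0)) -sqrtr_sqr /inorm -sqrtrM ?sqr_ge0//.
by rewrite ler_wsqrtr//; case: (res_form_ge x).
Qed.

End Resolvent.
End Generator.

(** * From the variational identity to differential equations *)

Section TestClass.
Context {R : realType} {a b : R}.
Local Notation C := R[i].
Local Notation mu := (leb a b).
Local Notation I h := (\int[mu]_x h x).
Implicit Types f g r u v : L2 a b.
Hypothesis ab : a < b.

Definition testL2 psi (tp : test_fun a b psi) : L2 a b :=
  mkL2 (test_fun_sqi tp) (sqi_cst a b 0).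

Lemma testL2_wderiv psi (tp : test_fun a b psi) :
  is_wderiv 1 (testL2 tp) (testL2 (test_fun_derive1 tp)).
Proof.
have F := ae_filter_ringOfSetsType mu.
apply/is_wderiv1P => phi tph.
have tre := mkL2_re (test_fun_sqi tp) (sqi_cst a b 0).
have tim := mkL2_im (test_fun_sqi tp) (sqi_cst a b 0).
have tre' := mkL2_re (test_fun_sqi (test_fun_derive1 tp)) (sqi_cst a b 0).
have tim' := mkL2_im (test_fun_sqi (test_fun_derive1 tp)) (sqi_cst a b 0).
have s1 := test_fun_sqi tph; have s2 := test_fun_sqi (test_fun_derive1 tph).
have E (h k z : R -> R) : sqi mu h -> sqi mu k -> sqi mu z ->
    {ae mu, forall x, h x = k x} -> I (fun x => h x * z x) = I (fun x => k x * z x).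
  move=> sh sk sz hk; apply: I_ae; [exact: (sqi_measM sh sz)|exact: (sqi_measM sk sz)|].
  by apply: filterS hk => x ->.
split.
  rewrite (E _ _ _ (reL_sqi _) (test_fun_sqi tp) s2 tre).
  rewrite (E _ _ _ (reL_sqi _) (test_fun_sqi (test_fun_derive1 tp)) s1 tre').
  by rewrite I_parts//; exact: test_fun_smooth tph.
rewrite (E _ _ _ (imL_sqi _) (sqi_cst a b 0) s2 tim).
rewrite (E _ _ _ (imL_sqi _) (sqi_cst a b 0) s1 tim').
have z (k : R -> R) : I (fun x => cst 0 x * k x) = 0.
  rewrite (_ : (fun x => cst 0 x * k x) = cst 0); last first.
    by apply/funext => x /=; rewrite mul0r.
  by rewrite /Rintegral integral0.
by rewrite !z oppr0.
Qed.

Lemma dotL2_test f psi (tp : test_fun a b psi) :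
  dotL2 f (testL2 tp) = cint a b (fun x => repr f x * (psi x)%:C).
Proof.
have F := ae_filter_ringOfSetsType mu.
have tre := mkL2_re (test_fun_sqi tp) (sqi_cst a b 0).
have tim := mkL2_im (test_fun_sqi tp) (sqi_cst a b 0).
have E (h k z : R -> R) : sqi mu h -> sqi mu k -> sqi mu z ->
    {ae mu, forall x, h x = k x} -> I (fun x => z x * h x) = I (fun x => z x * k x).
  move=> sh sk sz hk; apply: I_ae; [exact: (sqi_measM sz sh)|exact: (sqi_measM sz sk)|].
  by apply: filterS hk => x ->.
have z (k : R -> R) : I (fun x => k x * cst 0 x) = 0.
  rewrite (_ : (fun x => k x * cst 0 x) = cst 0); last first.
    by apply/funext => x /=; rewrite mulr0.
  by rewrite /Rintegral integral0.
rewrite cint_test dotL2E ipLE.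
rewrite (E _ _ _ (reL_sqi (testL2 tp)) (test_fun_sqi tp) (reL_sqi f) tre).
rewrite (E _ _ _ (reL_sqi (testL2 tp)) (test_fun_sqi tp) (imL_sqi f) tre).
rewrite (E _ _ _ (imL_sqi (testL2 tp)) (sqi_cst a b 0) (reL_sqi f) tim).
rewrite (E _ _ _ (imL_sqi (testL2 tp)) (sqi_cst a b 0) (imL_sqi f) tim).
by rewrite !z addr0 subr0.
Qed.

Lemma testL2_trace p psi (tp : test_fun a b psi) : ~~ (a < p < b) ->
  is_trace p (testL2 tp) 0.
Proof.
move=> pout; exists (fun x => (psi x)%:C); split.
- apply: continuous_subspaceT => x.
  apply: (@complex_cvg _ _ _ _ psi (cst 0) (psi x)%:C); last exact: cvg_cst.
  exact: (smooth_continuous (test_fun_smooth tp)).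
- by have := mkL2E (test_fun_sqi tp) (sqi_cst a b 0).
- by rewrite (test_fun_out tp pout).
Qed.

Lemma testL2_H2_vanishing p psi (tp : test_fun a b psi) : ~~ (a < p < b) ->
  H2_vanishing p (testL2 tp).
Proof.
move=> pout; split; [|exact: testL2_trace|].
  move=> [|[|[|]]]// _; first exact: has_wderiv0.
    by exists (testL2 (test_fun_derive1 tp)); exact: testL2_wderiv.
  exists (testL2 (test_fun_derive1 (test_fun_derive1 tp))).
  by apply: is_wderiv_comp (testL2_wderiv tp) _; exact: testL2_wderiv.
exists (testL2 (test_fun_derive1 tp)); [exact: testL2_wderiv|exact: testL2_trace].
Qed.

Lemma wderiv1_test psi (tp : test_fun a b psi) :
  wderiv 1 (testL2 tp) = testL2 (test_fun_derive1 tp).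
Proof. by apply: wderivE; exact: testL2_wderiv. Qed.

Lemma wderiv2_test psi (tp : test_fun a b psi) :
  wderiv 2 (testL2 tp) = testL2 (test_fun_derive1 (test_fun_derive1 tp)).
Proof.
by apply: wderivE; apply: is_wderiv_comp (testL2_wderiv tp) _; exact: testL2_wderiv.
Qed.

Lemma wderiv_zero k : wderiv k (0 : L2 a b) = 0.
Proof. by apply: wderivE; exact: is_wderiv0. Qed.

Lemma dotL2_zero f : dotL2 f (0 : L2 a b) = 0.
Proof. by rewrite dotL2_ip scaler0 ipL_sym ipL0. Qed.

Definition testint psi f : C := cint a b (fun x => repr f x * (psi x)%:C).

Lemma testint_clinear psi : test_fun a b psi -> clinear (testint psi).
Proof.
by move=> tp c f g; rewrite /testint (cint_repr_lin c f g (test_fun_good 0 tp)).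
Qed.

(** The identity says that the second derivative of u has a weak second
    derivative; composing with the first two derivatives gives the fourth
    one. *)
Lemma beam_strong (rho : R) u v r :
  sobolev 2 u -> sobolev 2 v ->
  (forall psi (tp : test_fun a b psi), dotL2 r (testL2 tp) +
     (dotL2 (wderiv 2 u) (testL2 (test_fun_derive1 (test_fun_derive1 tp))) +
      rho%:C * dotL2 (wderiv 1 v) (testL2 (test_fun_derive1 tp))) = 0) ->
  is_wderiv 4 u (- r + rho%:C *: wderiv 2 v).
Proof.
move=> su sv weak.
have u1 := wderivP (su 1 isT); have u2 := wderivP (su 2 isT).
have v1 := wderivP (sv 1 isT); have v2 := wderivP (sv 2 isT).
have u12 := is_wderiv_cancel u1 u2; have v12 := is_wderiv_cancel v1 v2.
apply: (is_wderiv_comp u1); apply: (is_wderiv_comp u12) => psi tp.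
have := weak psi tp; rewrite !dotL2_test (v12 psi tp).
rewrite -!/(testint psi _) [- r + _]addrC.
have tl := testint_clinear tp.
rewrite (clinearB _ _ tl) (clinearZ _ _ tl) -[_ *: testint _ _]/(_ * testint _ _).
move: (testint _ _) (testint _ _) (cint _ _ _) => p q s.
rewrite expr1 mulN1r mulrN expr2 mulrNN !mul1r => E.
by rewrite -[RHS]add0r -E; ring.
Qed.

Lemma wave_strong (beta : R) u v r :
  has_wderiv 1 u ->
  (forall psi (tp : test_fun a b psi), dotL2 r (testL2 tp) +
     (dotL2 (wderiv 1 u) (testL2 (test_fun_derive1 tp)) +
      beta%:C * dotL2 v (testL2 tp)) = 0) ->
  is_wderiv 2 u (r + beta%:C *: v).
Proof.
move=> su weak; apply: (is_wderiv_comp (wderivP su)) => psi tp.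
have := weak psi tp; rewrite !dotL2_test.
rewrite -!/(testint psi _) [r + _]addrC.
have tl := testint_clinear tp.
rewrite tl -[_ *: testint _ _]/(_ * testint _ _).
move: (testint _ _) (testint _ _) (cint _ _ _) => p q s.
by rewrite expr1 mulN1r => E; rewrite -[RHS]add0r -E; ring.
Qed.

End TestClass.

(** * The operator and its variational graph *)

Lemma dotL2_anti (R : realType) (a b : R) (f g : L2 a b) :
  dotL2 f ('i *: g) = - 'i * dotL2 f g.
Proof.
have E : ipL f ('i *: ('i *: g)) = - ipL f g.
  rewrite scalerA; have -> : 'i * 'i = -1 :> R[i] by have := sqr_i R; rewrite expr2.
  by rewrite scaleN1r !(ipC ipL_inner f) (ipNl ipL_inner).
by rewrite !dotL2_ip E; simpc.
Qed.

Section Generator.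
Context {R : realType} (l0 l1 l2 l3 : R).
Hypotheses (l01 : l0 < l1) (l12 : l1 < l2) (l23 : l2 < l3).
Variables (rho1 rho2 beta : R).
Hypotheses (rho1_ge0 : 0 <= rho1) (rho2_ge0 : 0 <= rho2) (beta_ge0 : 0 <= beta).
Local Notation C := R[i].
Local Notation Re := complex.Re.
Local Notation bbL := (bbL l0 l1 l2 l3).
Local Notation bbH := (bbH l0 l1 l2 l3).
Local Notation calH := (calH l0 l1 l2 l3).
Local Notation ip_bbL := (@ip_bbL R l0 l1 l2 l3).
Local Notation ip_bbH := (@ip_bbH R l0 l1 l2 l3).
Local Notation ip_damp := (@ip_damp R l0 l1 l2 l3 rho1 rho2 beta).
Local Notation opA := (@opA R l0 l1 l2 l3 rho1 rho2 beta).
Local Notation domA := (@domA R l0 l1 l2 l3 rho1 rho2 beta).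

Let iL : is_inner ip_bbL. Proof. by case: (hilbert_bbL l0 l1 l2 l3). Qed.
Let iH : is_inner ip_bbH. Proof. by case: (hilbert_bbH l01 l12 l23). Qed.
Let sD : semi_inner ip_damp.
Proof. exact: (semi_damp l0 l1 l2 l3 rho1_ge0 rho2_ge0 beta_ge0). Qed.

Definition ip_calH : calH -> calH -> R := prod_ip ip_bbH ip_bbL.

Lemma hilbert_calH : hilbert ip_calH.
Proof. exact: (hilbert_prod (hilbert_bbH l01 l12 l23) (hilbert_bbL l0 l1 l2 l3)). Qed.

Lemma norm_calHE : @norm_calH R l0 l1 l2 l3 = inorm ip_calH.
Proof.
apply/funext => U; rewrite /norm_calH /inorm; congr Num.sqrt.
by rewrite /dot_calH Re_D Re_dot_bbH Re_dot_bbL.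
Qed.

(** The balance of virtual work with virtual displacement phi. It encodes the
    differential equations and the transmission conditions at once. *)
Definition graph (U F : calH) := bbH_val F.1 = U.2 /\ forall phi : bbH,
  ip_bbL F.2 (bbH_val phi) + (ip_bbH U.1 phi +
    ip_damp (damp (bbH_val F.1)) (damp (bbH_val phi))) = 0.

Lemma graph_lin c U F U' F' : graph U F -> graph U' F' ->
  graph (c *: U + U') (c *: F + F').
Proof.
move=> [FU w] [FU' w']; split=> [|phi].
  rewrite -[(c *: F + F').1]/(c *: F.1 + F'.1) bbH_val_lin FU FU'.
  by [].
rewrite -[(c *: F + F').1]/(c *: F.1 + F'.1) -[(c *: F + F').2]/(c *: F.2 + F'.2).
rewrite -[(c *: U + U').1]/(c *: U.1 + U'.1).
have dl : clinear (fun x : bbH => damp (bbH_val x)) by exact: damp_clinear.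
have vl : clinear (@bbH_val R l0 l1 l2 l3) by exact: bbH_val_lin.
have -> := dl c F.1 F'.1.
rewrite (semi_clin _ _ _ _ (inner_semi iL)) (semi_clin _ _ _ _ (inner_semi iH)) (semi_clin _ _ _ _ sD).
have <- := clinearZ 'i phi vl; have <- := clinearZ 'i phi dl.
have := w phi; have := w ('i *: phi); have := w' phi.
move: (ip_bbL _ _) (ip_bbL _ _) (ip_bbL _ _) (ip_bbH _ _) (ip_bbH _ _) (ip_bbH _ _).
move: (ip_damp _ _) (ip_damp _ _) (ip_damp _ _) => p q r p' q' r' p'' q'' r'' e1 e2 e3.
have -> : Re c * p' - complex.Im c * q' + r' + (Re c * p'' - complex.Im c * q'' + r'' +
    (Re c * p - complex.Im c * q + r)) = Re c * (p' + (p'' + p)) -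
    complex.Im c * (q' + (q'' + q)) + (r' + (r'' + r)) by ring.
by rewrite e1 e2 e3 !mulr0 subr0 addr0.
Qed.

(** With y the unknown velocity and U = (f1 + h y, y), the balance of virtual
    work becomes the variational problem for y. *)
Lemma graph_onto h f : 0 < h -> exists U F, graph U F /\ U - h%:C *: F = f.
Proof.
case: f => f1 g h0.
have [y yP] := res_form_solve l01 l12 l23 rho1_ge0 rho2_ge0 beta_ge0 h0 f1 g.
exists (f1 + h%:C *: y, bbH_val y), (y, (h^-1)%:C *: (bbH_val y - g)).
split; last first.
  congr (_, _) => /=; first by rewrite addrK.
  by rewrite scalerA -rmorphM/= divff ?gt_eqF// scale1r opprB addrC subrK.
split=> // phi /=.
rewrite (ipZl iL) (ipBl iL) (ipDl iH) (ipZl iH).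
have := yP phi; rewrite /res_form.
move: (ip_bbL _ _) (ip_bbL _ _) (ip_bbH _ _) (ip_bbH _ _) (ip_damp _ _) => p q r s t E.
have -> : p = q + (h ^+ 2 * s + h * t) + h * r by rewrite E subrK.
by field; rewrite gt_eqF.
Qed.

(** With the velocity as virtual displacement the elastic terms cancel and
    only the damping remains. *)
Lemma graph_dissipative U F : graph U F -> ip_calH F U <= 0.
Proof.
move=> [FU w]; have := w F.1; rewrite FU => E.
rewrite /ip_calH /prod_ip (ipC iH F.1).
have := semi_ge0 sD (damp (bbH_val F.1)); rewrite FU => D.
by move: (ip_bbL _ _) (ip_bbH _ _) (ip_damp _ _) E D => p q r E D; lra.
Qed.

Definition dot_damp (x y : bbL) : C := rho1%:C * dotL2 x.1.1 y.1.1 +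
  beta%:C * dotL2 x.1.2 y.1.2 + rho2%:C * dotL2 x.2 y.2.

Lemma Re_dot_damp x y : Re (dot_damp x y) = ip_damp x y.
Proof.
have E (z1 z2 z3 : C) : Re (rho1%:C * z1 + beta%:C * z2 + rho2%:C * z3) =
    rho1 * Re z1 + beta * Re z2 + rho2 * Re z3.
  by case: z1 z2 z3 => ? ? [? ?] [? ?] /=; rewrite !mul0r !subr0.
exact: E.
Qed.

Lemma dot_bbL_anti (x y : bbL) : dot_bbL x ('i *: y) = - 'i * dot_bbL x y.
Proof.
case: x y => -[u v] w [[u' v'] w'].
rewrite -[LHS]/(dotL2 u ('i *: u') + dotL2 v ('i *: v') + dotL2 w ('i *: w')).
by rewrite !dotL2_anti -!mulrDr.
Qed.

Lemma dot_damp_anti (x y : bbL) : dot_damp x ('i *: y) = - 'i * dot_damp x y.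
Proof.
rewrite /dot_damp -[('i *: y).1.1]/('i *: y.1.1) -[('i *: y).1.2]/('i *: y.1.2).
rewrite -[('i *: y).2]/('i *: y.2) !dotL2_anti.
by rewrite 3!(mulrCA _ (- 'i)) -!mulrDr.
Qed.

(** Virtual displacements may be multiplied by i, so the real identity
    implies the complex one. *)
Lemma graph_complex U F : graph U F -> forall phi : bbH,
  dot_bbL F.2 (bbH_val phi) + (dot_bbL (highest (bbH_val U.1)) (highest (bbH_val phi)) +
    dot_damp (damp (bbH_val F.1)) (damp (bbH_val phi))) = 0.
Proof.
move=> [_ w].
have dl : clinear (fun x : bbH => damp (bbH_val x)) by exact: damp_clinear.
have hl : clinear (fun x : bbH => highest (bbH_val x)) by exact: highest_clinear.
have vl : clinear (@bbH_val R l0 l1 l2 l3) by exact: bbH_val_lin.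
apply: (@complex_form_eq R bbH _ (fun=> 0)) => [x|x|x].
- have -> := clinearZ 'i x vl; have -> := clinearZ 'i x dl; have -> := clinearZ 'i x hl.
  by rewrite !dot_bbL_anti dot_damp_anti !mulrDr.
- by rewrite mulr0.
- by rewrite 2!Re_D 2!Re_dot_bbL Re_dot_damp w.
Qed.

Definition strong_image (U : calH) : bbL :=
  (- wderiv 4 (bbH_val U.1).1.1 + rho1%:C *: wderiv 2 U.2.1.1,
   wderiv 2 (bbH_val U.1).1.2 - beta%:C *: U.2.1.2,
   - wderiv 4 (bbH_val U.1).2 + rho2%:C *: wderiv 2 U.2.2).

Lemma opAE U : opA U = (insubd 0 U.2, strong_image U).
Proof.
rewrite /opA /strong_image; case: (bbH_val U.1) => -[u1 v1] w1.
by case: U.2 => -[u2 v2] w2.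
Qed.

Lemma opA_val1 U : in_bbH U.2 -> bbH_val (opA U).1 = U.2.
Proof. by move=> UH; rewrite opAE insubdK//; apply/asboolP. Qed.

Lemma formAE U V : formA rho1 rho2 beta U V =
  dot_bbL (highest U.2) (highest (bbH_val V.1)) -
  (dot_bbL (highest (bbH_val U.1)) (highest V.2) + dot_damp (damp U.2) (damp V.2)).
Proof.
rewrite /formA /dot_damp /damp /highest /=.
case: (bbH_val U.1) (bbH_val V.1) => -[u1 v1] w1 [[s1 t1] r1].
case: U.2 V.2 => -[u2 v2] w2 [[s2 t2] r2] /=.
move: (dotL2 _ _) (dotL2 _ _) (dotL2 _ _) (dotL2 _ _) (dotL2 _ _) (dotL2 _ _)
  (dotL2 _ _) (dotL2 _ _) (dotL2 _ _) => x1 x2 x3 x4 x5 x6 x7 x8 x9.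
by ring.
Qed.

(** The position component of the test pair contributes the same term to both
    sides. *)
Lemma transmissionE U : in_bbH U.2 ->
  transmission rho1 rho2 beta U <-> forall phi : bbL, in_bbH phi ->
    dot_bbL (opA U).2 phi + (dot_bbL (highest (bbH_val U.1)) (highest phi) +
      dot_damp (damp U.2) (damp phi)) = 0.
Proof.
move=> UH.
have E V : dot_calH (opA U) V = dot_bbL (highest U.2) (highest (bbH_val V.1)) +
    dot_bbL (opA U).2 V.2.
  rewrite /dot_calH /dot_bbH opA_val1//; congr (_ + _).
  by rewrite /highest; case: U.2 (bbH_val V.1) => -[? ?] ? [[? ?] ?].
split=> [tr phi phiH|w V VH].
  have := tr (0, phi) phiH; rewrite E formAE => /addrI ->.
  by rewrite addNr.
by rewrite E formAE; congr (_ + _); apply/eqP; rewrite -addr_eq0 w.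
Qed.

(** Virtual displacements supported in a single piece yield the differential
    equation on that piece. *)
Lemma graph_strong U F : graph U F -> [/\ has_wderiv 4 (bbH_val U.1).1.1,
  has_wderiv 2 (bbH_val U.1).1.2, has_wderiv 4 (bbH_val U.1).2 & F.2 = strong_image U].
Proof.
move=> gUF; have cg := graph_complex gUF; have [FU _] := gUF.
have := bbH_valP U.1; have := bbH_valP F.1; rewrite FU in cg *.
rewrite /strong_image; case: F.2 cg {FU gUF} => -[r s] q.
case: (bbH_val U.1) => -[u1 v1] w1; case: U.2 => -[u2 v2] w2 cg /=.
move=> [[Hu2 _ _] Hv2 [Hw2 _ _] _ _] [[Hu1 _ _] Hv1 [Hw1 _ _] _ _].
have out (a b : R) : a < b -> (~~ (a < a < b)) /\ (~~ (a < b < b)) by rewrite !ltxx andbF.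
have [n01 n01'] := out _ _ l01; have [n12 n12'] := out _ _ l12; have [n23 n23'] := out _ _ l23.
have s0 (a b : R) k : sobolev k (0 : L2 a b) by move=> j _; exists 0; exact: is_wderiv0.
have du : is_wderiv 4 u1 (- r + rho1%:C *: wderiv 2 u2).
  apply: beam_strong => // psi tp.
  have [phi phiE] := @bbH_mk R l0 l1 l2 l3 (testL2 tp, 0, 0) (And5
    (testL2_H2_vanishing l01 tp n01) (s0 _ _ _) (H2_vanishing0 _ _ _)
    (ex_intro2 _ _ 0 (testL2_trace tp n01') (is_trace0 _ _ _))
    (ex_intro2 _ _ 0 (is_trace0 _ _ _) (is_trace0 _ _ _))).
  have := cg phi; rewrite phiE /dot_damp /damp /highest /=.
  by rewrite !wderiv_zero !dotL2_zero !mulr0 !addr0 (wderiv1_test l01) (wderiv2_test l01).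
have dv : is_wderiv 2 v1 (s + beta%:C *: v2).
  apply: wave_strong => [|psi tp]; first exact: Hv1.
  have sv : sobolev 1 (testL2 tp).
    move=> [|[|]]// _; first exact: has_wderiv0.
    by exists (testL2 (test_fun_derive1 tp)); exact: testL2_wderiv.
  have [phi phiE] := @bbH_mk R l0 l1 l2 l3 (0, testL2 tp, 0) (And5
    (H2_vanishing0 _ _ _) sv (H2_vanishing0 _ _ _)
    (ex_intro2 _ _ 0 (is_trace0 _ _ _) (testL2_trace tp n12))
    (ex_intro2 _ _ 0 (testL2_trace tp n12') (is_trace0 _ _ _))).
  have := cg phi; rewrite phiE /dot_damp /damp /highest /=.
  by rewrite !wderiv_zero !dotL2_zero !mulr0 !addr0 !add0r (wderiv1_test l12).
have dw : is_wderiv 4 w1 (- q + rho2%:C *: wderiv 2 w2).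
  apply: beam_strong => // psi tp.
  have [phi phiE] := @bbH_mk R l0 l1 l2 l3 (0, 0, testL2 tp) (And5
    (H2_vanishing0 _ _ _) (s0 _ _ _) (testL2_H2_vanishing l23 tp n23')
    (ex_intro2 _ _ 0 (is_trace0 _ _ _) (is_trace0 _ _ _))
    (ex_intro2 _ _ 0 (is_trace0 _ _ _) (testL2_trace tp n23))).
  have := cg phi; rewrite phiE /dot_damp /damp /highest /=.
  by rewrite !wderiv_zero !dotL2_zero !mulr0 !add0r (wderiv1_test l23) (wderiv2_test l23).
split; [by exists (- r + rho1%:C *: wderiv 2 u2)|by exists (s + beta%:C *: v2)|
  by exists (- q + rho2%:C *: wderiv 2 w2)|].
rewrite (wderivE du) (wderivE dv) (wderivE dw); congr (_, _, _).
- by rewrite opprD opprK subrK.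
- by rewrite addrK.
- by rewrite opprD opprK subrK.
Qed.

(** The regularity required in the domain of the operator is a consequence of
    the variational identity. *)
Lemma graphP U F : (domA U /\ opA U = F) <-> graph U F.
Proof.
split=> [[dU <-]|gUF].
  have [UH tr] : in_bbH U.2 /\ transmission rho1 rho2 beta U.
    by move: dU; rewrite /domA /=; case: (bbH_val U.1) => -[? ?] ? [].
  split=> [|phi]; first exact: opA_val1.
  have := (transmissionE UH).1 tr _ (bbH_valP phi).
  rewrite -(opA_val1 UH) => /(congr1 (@complex.Re R)).
  by rewrite 2!Re_D 2!Re_dot_bbL Re_dot_damp.
have [u4 v2 w4 FE] := graph_strong gUF; have cg := graph_complex gUF.
have [FU _] := gUF; have UH : in_bbH U.2 by rewrite -FU; exact: bbH_valP.
have AF : opA U = F.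
  rewrite opAE -FE; case: F FU {FE gUF cg} => F1 F2 /= FU; congr (_, _).
  by apply: val_inj; rewrite insubdK; [exact/esym|apply/asboolP].
split=> //.
have tr : transmission rho1 rho2 beta U.
  apply/transmissionE => // phi phiH; have [x xE] := bbH_mk phiH.
  by rewrite AF -FU -xE.
by move: u4 v2 w4; rewrite /domA /=; case: (bbH_val U.1) => -[? ?] ?; split.
Qed.

Lemma m_dissipative_opA : m_dissipative (inorm ip_calH) domA opA.
Proof.
have [iC cC] := hilbert_calH; have bC := hilbert_banach hilbert_calH.
have g0 : graph 0 0.
  split=> // phi; rewrite /= (ip0l iL) (ip0l iH) !add0r.
  have dl : clinear (fun x : bbH => damp (bbH_val x)) by exact: damp_clinear.
  have -> := clinear0 dl.
  have := semiP sD 1 0 0 (damp (bbH_val phi)); rewrite rmorph1 scale1r addr0 mul1r.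
  by move: (ip_damp _ _) => p; lra.
have gof U : domA U -> graph U (opA U) by move=> dU; apply/graphP.
have gop U F : graph U F -> domA U /\ opA U = F by move=> /graphP.
apply: (hilbert_m_dissipative iC bC).
- exact: (gop _ _ g0).1.
- by move=> c x y /gof gx /gof gy; exact: (gop _ _ (graph_lin c gx gy)).1.
- by move=> c x y /gof gx /gof gy; exact: (gop _ _ (graph_lin c gx gy)).2.
- by move=> x /gof; exact: graph_dissipative.
- move=> h f h0; have [U [F [/gop[dU <-] E]]] := graph_onto f h0.
  by exists U.
Qed.

End Generator.

(** * Well-posedness of the transmission problem *)

Theorem theorem3p2 (R : realType) (l0 l1 l2 l3 : R)
    (l01 : l0 < l1) (l12 : l1 < l2) (l23 : l2 < l3)
    (rho1 rho2 beta : R) (rho1_ge0 : 0 <= rho1) (rho2_ge0 : 0 <= rho2)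
    (beta_ge0 : 0 <= beta) :
  let H := calH l0 l1 l2 l3 in
  let nrm : H -> R := @norm_calH R l0 l1 l2 l3 in
  let D : set H := domA rho1 rho2 beta in
  let A : H -> H := opA rho1 rho2 beta in
  [/\ exists2 S : R -> H -> H,
        contraction_semigroup nrm S & is_generator nrm D A S,
      forall U0, D U0 -> exists2 U, classical_solution nrm D A U0 U &
        forall V, classical_solution nrm D A U0 V ->
          forall t, 0 <= t -> V t = U t
    & forall (U0 : H) (U0_ : nat -> H) (U : R -> H) (U_ : nat -> R -> H),
        D U0 -> (forall n, D (U0_ n)) ->
        classical_solution nrm D A U0 U ->
        (forall n, classical_solution nrm D A (U0_ n) (U_ n)) ->
        ncvg nrm \oo U0_ U0 ->
        forall a b, 0 <= a -> a <= b -> forall eps, 0 < eps ->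
          \forall n \near \oo, forall t, a <= t <= b ->
            nrm (U_ n t - U t) < eps].
Proof.
move=> H nrm D A; rewrite /nrm norm_calHE.
have bn := hilbert_banach (hilbert_calH l01 l12 l23).
exact: (m_dissipative_well_posed bn
  (m_dissipative_opA l01 l12 l23 rho1_ge0 rho2_ge0 beta_ge0)).
Qed.
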